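(* Let $M^{2n+1}(f,\xi,\eta,g)$ be a $K$-contact manifold with a global $f$-basis $e_1,\dots,e_{2n}$ of $f(TM)$, i.e., $fe_i=e_{n+i}$ ($1\le i\le n$). Suppose that $\mathcal D_1$ is spanned by $e_1,\dots,e_n$, $\mathcal D_2$ is spanned by $e_{n+1},\dots,e_{2n}$, $\mathcal D_3$ is spanned by $\xi$, $\mathcal D_1$ and $\mathcal D_2$ are integrable and totally geodesic, and $T^{\rm mix}_{13}=T^{\rm mix}_{23}=0$. Then $g$ is a critical point of the action $J_{\mathcal D_1,\mathcal D_2}$ with respect to volume-preserving variations of metric keeping orthogonality of $\mathcal D_1$ and $\mathcal D_2$ and such that $\partial_tg_t|_{t=0}(\xi,\xi)=0$.
   Context: $K$-contact manifold $M^{2n+1}(f,\xi,\eta,g)$: a vector field $\xi$, a one-form $\eta$ with $\eta(\xi)=1$, a $(1,1)$-tensor $f$ of rank $2n$ with $f^2=-\mathrm{id}+\eta\otimes\xi$, $f\xi=0$, $\eta\circ f=0$, and a Riemannian metric $g$ with $g(fX,fY)=g(X,Y)-\eta(X)\eta(Y)$, such that $d\eta=\Phi$, where $\Phi(X,Y)=g(X,fY)$, and $\xi$ is a Killing vector field. An $f$-basis is an orthonormal frame $e_1,\dots,e_{2n}$ of $f(TM)=\xi^\perp$ with $fe_i=e_{n+i}$, $1\le i\le n$. $\nabla$ is the Levi-Civita connection, $P_m$ the orthoprojector onto $\mathcal D_m$, $P_m^\perp=\mathrm{id}-P_m$; $\tilde T_m(X,Y)=\frac12P_m(\nabla_{P_m^\perp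 X}P_m^\perp Y-\nabla_{P_m^\perp Y}P_m^\perp X)$, and for $\{i,j,k\}=\{1,2,3\}$, $T^{\rm mix}_{ij}(X,Y)=\tilde T_k(P_iX,P_jY)+\tilde T_k(P_jX,P_iY)$. A distribution $\mathcal D_m$ is totally geodesic if $P_m^\perp(\nabla_XY+\nabla_YX)=0$ for all sections $X,Y$ of $\mathcal D_m$. For local orthonormal frames $\{E_a\}$ of $\mathcal D_1$ and $\{\mathcal E_i\}$ of $\mathcal D_2$, the mutual curvature is $S_{\mathcal D_1,\mathcal D_2}=\sum_{a,i}g(R(E_a,\mathcal E_i)\mathcal E_i,E_a)$ (sum of sectional curvatures of the planes $E_a\wedge\mathcal E_i$). The action is $J_{\mathcal D_1,\mathcal D_2}(g)=\int_MS_{\mathcal D_1,\mathcal D_2}\,d\mathrm{vol}_g$, on metrics making $\mathcal D_1,\mathcal D_2$ orthogonal; if $M$ is non-compact one integrates over an arbitrary relatively compact domain $\Omega$ containing the support of the variation. A variation is a smooth family $g_t$, $|t|<\varepsilon$, of Riemannian metrics with $g_0=g$, $g_t=g$ outside $\Omega$ ($\Omega=M$ if $M$ is compact); it is volume-preserving if $\mathrm{Vol}(\Omega,g_t)=\mathrm{Vol}(\Omega,g)$ for all $t$. $g$ is critical with respect to a class of variations if $\frac{d}{dt}J_{\mathcal D_1,\mathcal D_2}(g_t)|_{t=0}=0$ for all variations in the class. *)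

(* Defs.v *)
From HB Require Import structures.
From mathcomp Require Import all_boot all_order all_algebra.
From mathcomp Require Import all_classical all_reals all_analysis.
Set Implicit Arguments.
Unset Strict Implicit.
Unset Printing Implicit Defensive.
Import Order.TTheory GRing.Theory Num.Theory.
Import numFieldNormedType.Exports.
Local Open Scope classical_set_scope.
Local Open Scope ring_scope.

Section Euclidean.
Variable R : realType.

Fixpoint Ck (N k : nat) (U : set 'rV[R]_N) (h : 'rV[R]_N -> R) : Prop :=
  match k with
  | 0 => forall x, U x -> {for x, continuous h}
  | k'.+1 => forall v : 'rV[R]_N,
      (forall x, U x -> derivable h x v) /\ Ck k' U (fun x => 'D_v h x)
  end.

(* Only used for open [U]. *)
Definition smooth_on (N : nat) (U : set 'rV[R]_N) (h : 'rV[R]_N -> R) : Prop :=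
  forall k, Ck k U h.

(* The Lebesgue integral over R^N, as an iterated integral; only used for
   nonnegative Borel functions, where this is Tonelli's theorem. *)
Fixpoint lebesgue_int (N : nat) : ('rV[R]_N -> \bar R) -> \bar R :=
  match N return ('rV[R]_N -> \bar R) -> \bar R with
  | 0 => fun h => h 0
  | N'.+1 => fun h =>
      (\int[@lebesgue_measure R]_x
         lebesgue_int (fun v : 'rV[R]_N' => h (row_mx (const_mx x : 'rV_1) v)))%E
  end.

End Euclidean.

(* Charts [coord c : dom c -> R^N] with inverses [param c]; both maps are total
   functions with irrelevant values outside [dom c] and [coord c @` dom c]. *)
Record manifold (R : realType) (N : nat) (M : ptopologicalType) := Manifold {
  chart : Type;
  dom : chart -> set M;
  coord : chart -> M -> 'rV[R]_N;
  param : chart -> 'rV[R]_N -> M;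
  hausdorff_carrier : hausdorff_space M;
  second_countable_carrier : @second_countable M;
  dom_cover : forall p, exists c, dom c p;
  dom_open : forall c, open (dom c);
  coord_open : forall c, open (coord c @` dom c);
  coordK : forall c p, dom c p -> param c (coord c p) = p;
  coord_continuous : forall c p, dom c p -> {for p, continuous (coord c)};
  param_continuous : forall c x, (coord c @` dom c) x ->
    {for x, continuous (param c)};
  transition_smooth : forall (c c' : chart) (i : 'I_N),
    smooth_on (coord c @` (dom c `&` dom c'))
      (fun x => coord c' (param c x) ord0 i)
}.

Arguments chart {R N M}.
Arguments dom {R N M}.
Arguments coord {R N M}.
Arguments param {R N M}.

(* Tangent vectors at a point are the point derivations of C^oo(M) (see
   [tangent_at]), hence elements of the vector space [tvec R M]; vector fields,
   metrics and tensors are total functions constrained only on tangent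
   vectors. *)
Notation tvec R M := ((M -> R) -> R^o).
Notation vfield R M := (M -> tvec R M).
Notation metric R M := (M -> tvec R M -> tvec R M -> R).
Notation connection R M := (vfield R M -> vfield R M -> vfield R M).
Notation tdistribution R M := (M -> set (tvec R M)).
Notation borel M := (g_sigma_algebraType (@open M)).

Section Manifold.
Variables (R : realType) (N : nat) (M : ptopologicalType).
Variable A : manifold R N M.

Definition smooth (h : M -> R) : Prop :=
  forall c : chart A, smooth_on (coord A c @` dom A c) (h \o param A c).

(* The last clause fixes the irrelevant values on nonsmooth functions, so that
   equality of tangent vectors is equality of functions. *)
Definition tangent_at (p : M) (v : tvec R M) : Prop :=
  [/\ forall (a : R) (h k : M -> R), smooth h -> smooth k ->
        v (fun q => a * h q + k q) = a * v h + v k,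
      forall h k : M -> R, smooth h -> smooth k ->
        v (fun q => h q * k q) = v h * k p + h p * v k
    & forall h : M -> R, ~ smooth h -> v h = 0].

Definition is_vfield (X : vfield R M) : Prop :=
  (forall p, tangent_at p (X p)) /\
  (forall h, smooth h -> smooth (fun p => X p h)).

Definition scale_vf (h : M -> R) (X : vfield R M) : vfield R M :=
  fun p => h p *: X p.

Definition bracket (X Y : vfield R M) : vfield R M :=
  fun p h => X p (fun q => Y q h) - Y p (fun q => X q h).

Definition coord_vec (c : chart A) (i : 'I_N) (p : M) : tvec R M :=
  fun h => if `[< smooth h >]
           then 'D_(delta_mx ord0 i) (h \o param A c) (coord A c p) else 0.

Definition spanned (k : nat) (e : 'I_k -> vfield R M) : tdistribution R M :=
  fun p => [set v | exists a : 'I_k -> R, v = \sum_i a i *: e i p].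

Definition section_of (D : tdistribution R M) (X : vfield R M) : Prop :=
  is_vfield X /\ forall p, D p (X p).

Definition riemannian_metric (g : metric R M) : Prop :=
  [/\ forall p u v, tangent_at p u -> tangent_at p v -> g p u v = g p v u,
      forall p (a : R) u v w, tangent_at p u -> tangent_at p v ->
        tangent_at p w -> g p (a *: u + v) w = a * g p u w + g p v w,
      forall p u, tangent_at p u -> u != 0 -> 0 < g p u u
    & forall X Y, is_vfield X -> is_vfield Y ->
        smooth (fun p => g p (X p) (Y p))].

Definition is_levi_civita (g : metric R M) (nabla : connection R M) : Prop :=
  (forall X Y, is_vfield X -> is_vfield Y -> is_vfield (nabla X Y)) /\
  [/\ forall h X X' Y, smooth h -> is_vfield X -> is_vfield X' -> is_vfield Y ->
        nabla (scale_vf h X + X') Y = scale_vf h (nabla X Y) + nabla X' Y,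
      forall h X Y Y', smooth h -> is_vfield X -> is_vfield Y -> is_vfield Y' ->
        nabla X (scale_vf h Y + Y') =
        scale_vf (fun p => X p h) Y + scale_vf h (nabla X Y) + nabla X Y',
      forall X Y, is_vfield X -> is_vfield Y ->
        nabla X Y - nabla Y X = bracket X Y
    & forall X Y Z p, is_vfield X -> is_vfield Y -> is_vfield Z ->
        X p (fun q => g q (Y q) (Z q)) =
        g p (nabla X Y p) (Z p) + g p (Y p) (nabla X Z p)].

(* Exists, and is unique as an operation on vector fields. *)
Definition levi_civita (g : metric R M) : connection R M :=
  get [set nabla | is_levi_civita g nabla].

Definition curvature (g : metric R M) (X Y Z : vfield R M) : vfield R M :=
  let nabla := levi_civita g in
  nabla X (nabla Y Z) - nabla Y (nabla X Z) - nabla (bracket X Y) Z.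

Definition orthoproj_at (g : metric R M) (D : tdistribution R M) (p : M)
    (v : tvec R M) : tvec R M :=
  get [set w | D p w /\ forall z, D p z -> g p (v - w) z = 0].

Definition orthoproj (g : metric R M) (D : tdistribution R M)
    (X : vfield R M) : vfield R M :=
  fun p => orthoproj_at g D p (X p).

Definition orthoproj_perp (g : metric R M) (D : tdistribution R M)
    (X : vfield R M) : vfield R M :=
  X - orthoproj g D X.

Definition totally_geodesic (g : metric R M) (D : tdistribution R M) : Prop :=
  forall X Y, section_of D X -> section_of D Y ->
    orthoproj_perp g D (levi_civita g X Y + levi_civita g Y X) = 0.

(* Vanishing of the integrability tensor of [D]: the normal part of
   [levi_civita g X Y - levi_civita g Y X], that is, of the bracket. *)
Definition integrable_distribution (D : tdistribution R M) : Prop :=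
  forall X Y, section_of D X -> section_of D Y -> section_of D (bracket X Y).

Definition Ttilde (g : metric R M) (D : tdistribution R M)
    (X Y : vfield R M) : vfield R M :=
  let nabla := levi_civita g in
  let Q := orthoproj_perp g D in
  scale_vf (fun=> 2^-1)
    (orthoproj g D (nabla (Q X) (Q Y) - nabla (Q Y) (Q X))).

(* T^mix_ij, where [Dk] is the remaining distribution. *)
Definition Tmix (g : metric R M) (Dk Di Dj : tdistribution R M)
    (X Y : vfield R M) : vfield R M :=
  Ttilde g Dk (orthoproj g Di X) (orthoproj g Dj Y) +
  Ttilde g Dk (orthoproj g Dj X) (orthoproj g Di Y).

Definition local_orthonormal_frame (g : metric R M) (D : tdistribution R M)
    (k : nat) (U : set M) (E : 'I_k -> vfield R M) : Prop :=
  (forall a, is_vfield (E a)) /\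
  forall q, U q ->
    (forall a b, g q (E a q) (E b q) = (a == b)%:R) /\ D q = spanned E q.

(* The value does not depend on the frames; local frames are given by global
   fields, which is no restriction after shrinking the neighbourhood [U]. *)
Definition mutual_curvature (g : metric R M) (D1 D2 : tdistribution R M)
    (p : M) : R :=
  get [set s | exists (k l : nat) (U : set M)
      (E : 'I_k -> vfield R M) (F : 'I_l -> vfield R M),
    [/\ open_nbhs p U, local_orthonormal_frame g D1 U E,
        local_orthonormal_frame g D2 U F
      & s = \sum_a \sum_i g p (curvature g (E a) (F i) (F i) p) (E a p)]].

Definition is_volume_measure (g : metric R M)
    (mu : {measure set (borel M) -> \bar R}) : Prop :=
  forall (c : chart A) (B : set (borel M)), measurable B -> B `<=` dom A c ->
    mu B = lebesgue_int (fun x =>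
      (\1_(coord A c @` B) x *
       Num.sqrt (\det (\matrix_(i, j)
         g (param A c x) (coord_vec c i (param A c x))
           (coord_vec c j (param A c x)))))%:E).

(* The Riemannian measure exists and is unique for every metric, so that the
   default value is never used. *)
Definition volume (g : metric R M) : {measure set (borel M) -> \bar R} :=
  match pselect (exists mu, is_volume_measure g mu) with
  | left h => projT1 (cid h)
  | right _ => mzero
  end.

Definition mutual_action (Omega : set M) (D1 D2 : tdistribution R M)
    (g : metric R M) : R :=
  Rintegral (volume g) (Omega : set (borel M)) (mutual_curvature g D1 D2).

Definition orthogonal_distributions (g : metric R M)
    (D1 D2 : tdistribution R M) : Prop :=
  forall p u v, D1 p u -> D2 p v -> g p u v = 0.

Definition admissible_domain (Omega : set M) : Prop :=
  [/\ open Omega, compact (closure Omega)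
    & compact [set: M] -> Omega = [set: M]].

Definition same_metric_at (g g' : metric R M) (p : M) : Prop :=
  forall u v, tangent_at p u -> tangent_at p v -> g p u v = g' p u v.

(* Smoothness of a family of metrics is joint smoothness in the parameter and
   the point; the first entry of [z] is the parameter. *)
Definition smooth_family (eps : R) (gt : R -> metric R M) : Prop :=
  forall (X Y : vfield R M) (c : chart A), is_vfield X -> is_vfield Y ->
    smooth_on
      [set z : 'rV[R]_(1 + N) | `|z ord0 ord0| < eps /\
                                (coord A c @` dom A c) (rsubmx z)]
      (fun z => let q := param A c (rsubmx z) in
                gt (z ord0 ord0) q (X q) (Y q)).

Definition variation_support (eps : R) (g : metric R M) (gt : R -> metric R M)
    : set M :=
  closure [set p | exists t : R, `|t| < eps /\ ~ same_metric_at g (gt t) p].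

Definition metric_variation (Omega : set M) (eps : R) (g : metric R M)
    (gt : R -> metric R M) : Prop :=
  [/\ 0 < eps,
      forall t, `|t| < eps -> riemannian_metric (gt t),
      forall p, same_metric_at g (gt 0) p,
      smooth_family eps gt
    & variation_support eps g gt `<=` Omega].

Definition volume_preserving (Omega : set M) (eps : R) (g : metric R M)
    (gt : R -> metric R M) : Prop :=
  forall t, `|t| < eps ->
    volume (gt t) (Omega : set (borel M)) = volume g (Omega : set (borel M)).

(* [C Omega eps gt] is a class of variations of [g]. *)
Definition critical_point (D1 D2 : tdistribution R M)
    (C : set M -> R -> (R -> metric R M) -> Prop) (g : metric R M) : Prop :=
  forall (Omega : set M) (eps : R) (gt : R -> metric R M),
    admissible_domain Omega -> metric_variation Omega eps g gt -> C Omega eps gt ->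
    is_derive (0 : R) (1 : R) (fun t => mutual_action Omega D1 D2 (gt t)) 0.

Definition is_one_form (eta : M -> tvec R M -> R) : Prop :=
  (forall p (a : R) u v, tangent_at p u -> tangent_at p v ->
     eta p (a *: u + v) = a * eta p u + eta p v) /\
  (forall X, is_vfield X -> smooth (fun p => eta p (X p))).

Definition is_endo_field (f : M -> tvec R M -> tvec R M) : Prop :=
  [/\ forall p u, tangent_at p u -> tangent_at p (f p u),
      forall p (a : R) u v, tangent_at p u -> tangent_at p v ->
        f p (a *: u + v) = a *: f p u + f p v
    & forall X, is_vfield X -> is_vfield (fun p => f p (X p))].

Definition image_field (f : M -> tvec R M -> tvec R M) : tdistribution R M :=
  fun p => f p @` [set v | tangent_at p v].

Definition has_rank (f : M -> tvec R M -> tvec R M) (r : nat) : Prop :=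
  forall p, exists b : 'I_r -> tvec R M,
    (forall a : 'I_r -> R, \sum_i a i *: b i = 0 -> forall i, a i = 0) /\
    image_field f p = [set v | exists a : 'I_r -> R, v = \sum_i a i *: b i].

(* The normalization with the factor 1/2, customary in contact geometry. *)
Definition ext_der (eta : M -> tvec R M -> R) (X Y : vfield R M) (p : M) : R :=
  2^-1 * (X p (fun q => eta q (Y q)) - Y p (fun q => eta q (X q))
          - eta p (bracket X Y p)).

Definition killing (g : metric R M) (xi : vfield R M) : Prop :=
  forall X Y p, is_vfield X -> is_vfield Y ->
    xi p (fun q => g q (X q) (Y q)) =
    g p (bracket xi X p) (Y p) + g p (X p) (bracket xi Y p).

End Manifold.

Record K_contact (R : realType) (n : nat) (M : ptopologicalType)
    (A : manifold R (n + n).+1 M) (f : M -> tvec R M -> tvec R M)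
    (xi : vfield R M) (eta : M -> tvec R M -> R) (g : metric R M) : Prop :=
  KContact {
    Kc_endo : is_endo_field A f;
    Kc_vfield : is_vfield A xi;
    Kc_form : is_one_form A eta;
    Kc_metric : riemannian_metric A g;
    Kc_eta_xi : forall p, eta p (xi p) = 1;
    Kc_rank : has_rank A f (n + n);
    Kc_square : forall p u, tangent_at A p u ->
      f p (f p u) = - u + eta p u *: xi p;
    Kc_f_xi : forall p, f p (xi p) = 0;
    Kc_eta_f : forall p u, tangent_at A p u -> eta p (f p u) = 0;
    Kc_compat : forall p u v, tangent_at A p u -> tangent_at A p v ->
      g p (f p u) (f p v) = g p u v - eta p u * eta p v;
    Kc_contact : forall X Y p, is_vfield A X -> is_vfield A Y ->
      ext_der eta X Y p = g p (X p) (f p (Y p));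
    Kc_killing : killing A g xi
  }.

(* e_i and f e_i = e_(n+i) are [e (lshift n i)] and [e (rshift n i)]. *)
Definition f_basis (R : realType) (n : nat) (M : ptopologicalType)
    (A : manifold R (n + n).+1 M) (f : M -> tvec R M -> tvec R M)
    (g : metric R M) (e : 'I_(n + n) -> vfield R M) : Prop :=
  [/\ forall i, is_vfield A (e i),
      forall p i j, g p (e i p) (e j p) = (i == j)%:R,
      forall p, image_field A f p = spanned e p
    & forall p (i : 'I_n), f p (e (lshift n i) p) = e (rshift n i) p].

(* Main.v *)
(** A global orthonormal frame turns mutual curvature into an expression in the
    structure functions c_ijk = g([E_i, E_j], E_k): Walczak's formula writes it as a
    sum of divergences plus a quadratic polynomial Q in the connection coefficients.

    For a variation g_t, Gram-Schmidt inside D1 and inside D2, which stay orthogonal,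
    followed by normalizing the rest of xi, gives g_t-orthonormal frames adapted to D1
    and D2 whose distance to the f-basis is O(t).  For the f-basis the only
    nonzero terms of Q come from c(e_a, e_(n+a), xi) = 2, so to first order only these
    and the functions c(xi, e_a, e_(n+a)), c(xi, e_(n+a), e_a) matter.  The former are
    controlled by the traces of the Gram matrix of g_t, that is, by the volume density
    rho_t, because g_t(xi, xi) = 1 + O(t^2).  The trace of the latter is the divergence
    of a compactly supported field; this uses the xi-component of the Jacobi identity.
    Altogether

      Q_t rho_t = -3n + (6 - 3n)(rho_t - 1) + divergence + O(t^2),

    and integrating over Omega, where rho_t - 1 has integral zero, shows that the
    action changes by O(t^2). *)
Require Import Defs.
From HB Require Import structures.
From mathcomp Require Import all_boot all_order all_algebra.
From mathcomp Require Import all_classical all_reals all_analysis.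
From mathcomp Require Import perm measurable_realfun ring lra.
Set Implicit Arguments.
Unset Strict Implicit.
Unset Printing Implicit Defensive.
Import Order.TTheory GRing.Theory Num.Theory.
Import numFieldNormedType.Exports.
Local Open Scope classical_set_scope.
Local Open Scope ring_scope.

(** Criticality is read off a quadratic bound on the action, so nothing is differentiated under the
    integral; the price is that every estimate must be uniform on the compact support of the
    variation, off which the new frames equal the f-basis. Origin of the constants: with x = c(E_a,
    E_(n+b), xi), y = c(xi, E_a, E_(n+b)), z = c(xi, E_(n+b), E_a), the xi-part of Q is the sum of
    -3/4 x^2 + x (y - z) / 2 + (y + z)^2 / 4. Since x is near 2 for a = b, this gives -3n, and only
    the trace of y - z counts. For H the Gram matrix of g_t on the f-basis, x^2 is 4 H_xi,xi (2 -
    H_a,a) (2 - H_n+a,n+a) up to O(t^2); the deviations add up to 3 tr (H - 1), which is 6 (rho -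
    1). The factor rho turns 6 into 6 - 3n. The trace of y - z is the divergence of f applied to the
    new unit normal of D1 + D2. Two volumes occur: Walczak's divergences are taken for g_t and
    integrated against its own volume, the last one for g. The fields of the former have compact
    support because the leaves are totally geodesic for g, so that their mean curvatures vanish
    wherever g_t = g. *)

Local Notation coord := Defs.coord.

(** * Smooth functions on open subsets of R^N *)
Section DirectionalDerivatives.
Variables (R : realType) (V : normedModType R).
Implicit Types (f h : V -> R) (x v : V).

(** Both sides are the same difference quotient, so directional derivatives obey the one-variable
    theory along lines. *)
Lemma derive_lineE f x v (s0 : R) :
  (fun s : R => s^-1 *: (((fun r : R => f (r *: v + x)) \o shift s0) (s *: (1 : R))
     - f (s0 *: v + x))) =
  (fun s : R => s^-1 *: ((f \o shift (s0 *: v + x)) (s *: v) - f (s0 *: v + x))).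
Proof.
apply/funext => s /=; congr (_ *: (f _ - _)).
by rewrite -[s *: 1]/(s * 1) mulr1 scalerDl addrA.
Qed.

Lemma derivable_line f x v (s0 : R) :
  derivable f (s0 *: v + x) v <-> derivable (fun s : R => f (s *: v + x)) s0 1.
Proof. by rewrite /derivable derive_lineE. Qed.

Lemma derive_line f x v (s0 : R) :
  'D_v f (s0 *: v + x) = 'D_1 (fun s : R => f (s *: v + x)) s0.
Proof. by rewrite /derive derive_lineE. Qed.

Lemma is_derive_line f x v (s0 d : R) :
  is_derive (s0 *: v + x) v f d <-> is_derive s0 (1 : R) (fun s : R => f (s *: v + x)) d.
Proof.
split=> -[df <-]; apply: DeriveDef.
- exact/derivable_line.
- by rewrite -derive_line.
- exact/derivable_line.
- by rewrite derive_line.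
Qed.

Lemma is_derive_line0 f x v (d : R) :
  is_derive x v f d <-> is_derive (0 : R) (1 : R) (fun s : R => f (s *: v + x)) d.
Proof. by rewrite -is_derive_line scale0r add0r. Qed.

Lemma is_derive_comp1 (phi : R -> R) f x v a d :
  is_derive (f x) (1 : R) phi a -> is_derive x v f d ->
  is_derive x v (phi \o f) (a * d).
Proof.
move=> dphi /is_derive_line0 df; apply/is_derive_line0.
have dphi' : is_derive ((fun s : R => f (s *: v + x)) 0) (1 : R) phi a.
  by rewrite scale0r add0r.
exact: (@is_derive1_comp _ phi (fun s : R => f (s *: v + x)) 0 a d dphi' df).
Qed.

Lemma near_is_derive f h x v d :
  {near x, f =1 h} -> is_derive x v f d -> is_derive x v h d.
Proof.
move=> fh [df <-]; rewrite (near_eq_derive _ fh).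
apply: DeriveDef; last by [].
exact: near_eq_derivable fh df.
Qed.

End DirectionalDerivatives.

Lemma is_derive_sqrt (R : realType) (y : R) : 0 < y ->
  is_derive y (1 : R) Num.sqrt (2 * Num.sqrt y)^-1.
Proof.
move=> y0; have [z z0 zE] : exists2 z : R, 0 < z & y = z ^+ 2.
  by exists (Num.sqrt y); rewrite ?sqrtr_gt0 // sqr_sqrtr ?ltW.
rewrite zE sqrtr_sqr (gtr0_norm z0).
apply: (@is_derive_inverse R (fun u => u ^+ 2) Num.sqrt (2 * z) z).
- near=> u; rewrite sqrtr_sqr gtr0_norm //.
  near: u; exact: lt_nbhsr.
- near=> u; apply: exprn_continuous.
- have -> : (fun u : R => u ^+ 2) = (id : R -> R) * (id : R -> R).
    by apply/funext => u; rewrite expr2.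
  apply: (is_derive_eq (is_deriveM (is_derive_id z 1) (is_derive_id z 1))).
  by rewrite -[z *: 1]/(z * 1) mulr1 mulr_natl.
- by rewrite mulf_neq0 // ?pnatr_eq0 // gt_eqF.
Unshelve. all: by end_near. Qed.

Section SmoothOn.
Variables (R : realType) (N : nat).
Implicit Types (U W : set 'rV[R]_N) (f h : 'rV[R]_N -> R) (x v : 'rV[R]_N).

(** Derivatives are taken in the whole space, so each clause of [Ck] is a condition at a single
    point and singletons are legitimate arguments although they are not open. Monotonicity in the
    set and locality follow. *)
Lemma Ck_pointwise k U h : Ck k U h <-> forall x, U x -> Ck k [set x] h.
Proof.
elim: k h => [|k IH] h /=.
  by split=> H x Ux; [move=> y ->; apply: H|apply: (H x Ux x)].
split.
  move=> H x Ux v; have [H1 H2] := H v; split; first by move=> y ->; apply: H1.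
  by move/IH : H2; apply.
move=> H v; split; first by move=> x Ux; apply: (H x Ux v).1.
by apply/IH => x Ux; apply: (H x Ux v).2.
Qed.

Lemma Ck_sub k U W h : W `<=` U -> Ck k U h -> Ck k W h.
Proof. by move=> WU /Ck_pointwise H; apply/Ck_pointwise => x /WU; exact: H. Qed.

Lemma near_near_eq f h x : {near x, f =1 h} ->
  \forall y \near x, {near y, f =1 h}.
Proof. by move=> fh; apply: near_join. Qed.

Lemma Ck_near k x f h : {near x, f =1 h} -> Ck k [set x] f -> Ck k [set x] h.
Proof.
elim: k f h => [|k IH] f h fh /=.
  move=> H y ->; have fx := H x erefl.
  have E : f x = h x by apply: nbhs_singleton fh.
  rewrite /prop_for /continuous_at -E; apply: cvg_trans fx.
  exact: (near_eq_cvg fh).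
move=> H v; have [H1 H2] := H v; split.
  by move=> y ->; apply: (near_eq_derivable fh); exact: H1.
apply: IH H2; near=> y; apply: near_eq_derive.
by near: y; exact: near_near_eq.
Unshelve. all: by end_near. Qed.

Lemma Ck_eq k U f h : open U -> (forall x, U x -> f x = h x) ->
  Ck k U f -> Ck k U h.
Proof.
move=> oU fh /Ck_pointwise H; apply/Ck_pointwise => x Ux.
apply: Ck_near (H x Ux); have := open_nbhs_nbhs (conj oU Ux).
by apply: filterS => y; exact: fh.
Qed.

(* [Ck k] does not contain the lower orders, which the Leibniz rule needs. *)
Definition Cle k U h := forall j, (j <= k)%N -> Ck j U h.

Lemma CleS k U h : Cle k.+1 U h <->
  (forall x, U x -> {for x, continuous h}) /\
  forall v, (forall x, U x -> derivable h x v) /\ Cle k U (fun x => 'D_v h x).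
Proof.
split=> [H|[H1 H2] [|j] jk].
  split; first exact: (H 0%N).
  move=> v; split; first exact: (H 1%N _ v).1.
  by move=> j jk; exact: (H j.+1 _ v).2.
  exact: H1.
by move=> v; have [H3 H4] := H2 v; split => //; exact: H4.
Qed.

Lemma Cle0 U h : Cle 0 U h <-> forall x, U x -> {for x, continuous h}.
Proof. by split=> [/(_ 0%N)|H [|//]] //; apply. Qed.

Lemma CleW k U h : Cle k.+1 U h -> Cle k U h.
Proof. by move=> H j jk; apply: H; exact: leqW. Qed.

Lemma smoothP U h : smooth_on U h <-> forall k, Cle k U h.
Proof. by split=> [H k j _|H k]; [|exact: (H k k)]. Qed.

Lemma Cle_eq k U f h : open U -> (forall x, U x -> f x = h x) ->
  Cle k U f -> Cle k U h.
Proof. by move=> oU fh H j /H; exact: Ck_eq. Qed.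

(** The common induction step of the closure properties below: a formula for the derivative on the
    open set passes its regularity to 'D_v. *)
Lemma Cle_derive_eq k U v f df : open U ->
  (forall x, U x -> is_derive x v f (df x)) -> Cle k U df ->
  (forall x, U x -> derivable f x v) /\ Cle k U (fun x => 'D_v f x).
Proof.
move=> oU H Hd; split; first by move=> x /H [].
by apply: Cle_eq Hd => // x /H [_ ->].
Qed.

Lemma Cle_cst k U (a : R) : open U -> Cle k U (fun=> a).
Proof.
move=> oU; elim: k a => [|k IH] a; first by apply/Cle0 => x _; exact: cst_continuous.
apply/CleS; split; first by move=> x _; exact: cst_continuous.
by move=> v; apply: (@Cle_derive_eq _ _ _ _ (fun=> 0)) => // x _; apply: is_derive_cst.
Qed.

Lemma Cle_add k U f h : open U -> Cle k U f -> Cle k U h ->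
  Cle k U (fun x => f x + h x).
Proof.
move=> oU; elim: k f h => [|k IH] f h.
  move=> /Cle0 Hf /Cle0 Hh; apply/Cle0 => x Ux.
  by apply: continuousD; [exact: Hf|exact: Hh].
move=> /CleS[cf Hf] /CleS[ch Hh]; apply/CleS; split.
  by move=> x Ux; apply: continuousD; [exact: cf|exact: ch].
move=> v; have [df Hdf] := Hf v; have [dh Hdh] := Hh v.
apply: (@Cle_derive_eq _ _ _ _ (fun x => 'D_v f x + 'D_v h x)) => //; last exact: IH.
by move=> x Ux; apply: is_deriveD; apply: derivableP; [exact: df|exact: dh].
Qed.

Lemma Cle_mul k U f h : open U -> Cle k U f -> Cle k U h ->
  Cle k U (fun x => f x * h x).
Proof.
move=> oU; elim: k f h => [|k IH] f h.
  move=> /Cle0 Hf /Cle0 Hh; apply/Cle0 => x Ux.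
  by apply: continuousM; [exact: Hf|exact: Hh].
move=> Hf0 Hh0; have /CleS[cf Hf] := Hf0; have /CleS[ch Hh] := Hh0.
apply/CleS; split.
  by move=> x Ux; apply: continuousM; [exact: cf|exact: ch].
move=> v; have [df Hdf] := Hf v; have [dh Hdh] := Hh v.
apply: (@Cle_derive_eq _ _ _ _ (fun x => f x * 'D_v h x + h x * 'D_v f x)) => //.
  by move=> x Ux; apply: is_deriveM; apply: derivableP; [exact: df|exact: dh].
by apply: Cle_add => //; apply: IH => //; exact: CleW.
Qed.

Lemma Cle_inv k U f : open U -> (forall x, U x -> f x != 0) -> Cle k U f ->
  Cle k U (fun x => (f x)^-1).
Proof.
move=> oU f0; elim: k f f0 => [|k IH] f f0.
  move=> /Cle0 Hf; apply/Cle0 => x Ux.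
  by apply: continuousV; [exact: f0|exact: Hf].
move=> Hf0; have /CleS[cf Hf] := Hf0; apply/CleS; split.
  by move=> x Ux; apply: continuousV; [exact: f0|exact: cf].
move=> v; have [df Hdf] := Hf v.
apply: (@Cle_derive_eq _ _ _ _ (fun x => (-1) * (((f x)^-1 * (f x)^-1) * 'D_v f x))) => //.
  move=> x Ux; apply: DeriveDef.
    by apply: derivableV; [exact: f0|exact: df].
  rewrite deriveV; [|exact: f0|exact: df].
  by rewrite mulN1r expr2 invfM scaleNr.
have IHf := IH _ f0 (CleW Hf0).
by apply: Cle_mul => //; [exact: Cle_cst|do !apply: Cle_mul].
Qed.

Lemma Cle_sqrt k U f : open U -> (forall x, U x -> 0 < f x) -> Cle k U f ->
  Cle k U (fun x => Num.sqrt (f x)).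
Proof.
move=> oU f0; elim: k f f0 => [|k IH] f f0.
  move=> /Cle0 Hf; apply/Cle0 => x Ux.
  by apply: (@continuous_comp _ _ _ f); [exact: Hf|exact: sqrt_continuous].
move=> Hf0; have /CleS[cf Hf] := Hf0; apply/CleS; split.
  by move=> x Ux; apply: (@continuous_comp _ _ _ f); [exact: cf|exact: sqrt_continuous].
move=> v; have [df Hdf] := Hf v.
apply: (@Cle_derive_eq _ _ _ _ (fun x => (2 * Num.sqrt (f x))^-1 * 'D_v f x)) => //.
  move=> x Ux; apply: is_derive_comp1; first exact: is_derive_sqrt (f0 _ Ux).
  exact: derivableP (df _ Ux).
apply: Cle_mul => //; apply: Cle_inv => //.
  by move=> x Ux; rewrite mulf_neq0 // ?pnatr_eq0 // gt_eqF // sqrtr_gt0 f0.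
apply: Cle_mul => //; first exact: Cle_cst.
by apply: IH => //; exact: CleW.
Qed.

Lemma smooth_on_sub U W h : W `<=` U -> smooth_on U h -> smooth_on W h.
Proof. by move=> WU H k; exact: Ck_sub (H k). Qed.

Lemma smooth_on_eq U f h : open U -> (forall x, U x -> f x = h x) ->
  smooth_on U f -> smooth_on U h.
Proof. by move=> oU fh H k; exact: Ck_eq (H k). Qed.

Lemma smooth_on_cst U (a : R) : open U -> smooth_on U (fun=> a).
Proof. by move=> oU; apply/smoothP => k; exact: Cle_cst. Qed.

Lemma smooth_on_add U f h : open U -> smooth_on U f -> smooth_on U h ->
  smooth_on U (fun x => f x + h x).
Proof. by move=> oU /smoothP Hf /smoothP Hh; apply/smoothP => k; exact: Cle_add. Qed.

Lemma smooth_on_mul U f h : open U -> smooth_on U f -> smooth_on U h ->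
  smooth_on U (fun x => f x * h x).
Proof. by move=> oU /smoothP Hf /smoothP Hh; apply/smoothP => k; exact: Cle_mul. Qed.

Lemma smooth_on_inv U f : open U -> (forall x, U x -> f x != 0) ->
  smooth_on U f -> smooth_on U (fun x => (f x)^-1).
Proof. by move=> oU f0 /smoothP Hf; apply/smoothP => k; exact: Cle_inv. Qed.

Lemma smooth_on_sqrt U f : open U -> (forall x, U x -> 0 < f x) ->
  smooth_on U f -> smooth_on U (fun x => Num.sqrt (f x)).
Proof. by move=> oU f0 /smoothP Hf; apply/smoothP => k; exact: Cle_sqrt. Qed.

Lemma smooth_on_continuous U f x : smooth_on U f -> U x -> {for x, continuous f}.
Proof. by move=> /(_ 0%N); apply. Qed.

Lemma smooth_on_derivable U f x v : smooth_on U f -> U x -> derivable f x v.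
Proof. by move=> /(_ 1%N v)[H _]; exact: H. Qed.

Lemma smooth_on_derive U f v : smooth_on U f -> smooth_on U (fun x => 'D_v f x).
Proof. by move=> H k; exact: (H k.+1 v).2. Qed.

Lemma smooth_on_local U f :
  (forall x, U x -> exists2 W, W x & smooth_on W f) -> smooth_on U f.
Proof.
move=> H k; apply/Ck_pointwise => x /H[W Wx Hf].
exact: (Ck_pointwise k W f).1 (Hf k) x Wx.
Qed.

Lemma smooth_on_near U f :
  (forall x, U x -> exists W h, [/\ open W, W x, smooth_on W h
     & forall y, W y -> f y = h y]) -> smooth_on U f.
Proof.
move=> H; apply: smooth_on_local => x /H[W [h [oW Wx Hh fh]]]; exists W => //.
by apply: smooth_on_eq Hh => // y /fh.
Qed.

End SmoothOn.

(** * Smooth functions, tangent vectors and vector fields *)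

Section SmoothFunctions.
Variables (R : realType) (N : nat) (M : ptopologicalType) (A : manifold R N M).
Implicit Types (h k : M -> R) (p : M).

Local Notation smooth := (smooth A).
Local Notation tangent_at := (tangent_at A).
Local Notation is_vfield := (is_vfield A).

Lemma eq_smooth h k : (forall p, h p = k p) -> smooth h -> smooth k.
Proof. by move=> /funext ->. Qed.

Lemma smooth_cst (a : R) : smooth (fun=> a).
Proof. by move=> c; apply: smooth_on_cst; exact: coord_open. Qed.

Lemma smooth_add h k : smooth h -> smooth k -> smooth (fun p => h p + k p).
Proof.
by move=> Hh Hk c; apply: smooth_on_add; [exact: coord_open|exact: Hh|exact: Hk].
Qed.

Lemma smooth_mul h k : smooth h -> smooth k -> smooth (fun p => h p * k p).
Proof.
by move=> Hh Hk c; apply: smooth_on_mul; [exact: coord_open|exact: Hh|exact: Hk].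
Qed.

Lemma smooth_inv h : (forall p, h p != 0) -> smooth h -> smooth (fun p => (h p)^-1).
Proof.
move=> h0 Hh c; apply: smooth_on_inv; [exact: coord_open| |exact: Hh].
by move=> x _; exact: h0.
Qed.

Lemma smooth_sqrt h : (forall p, 0 < h p) -> smooth h ->
  smooth (fun p => Num.sqrt (h p)).
Proof.
move=> h0 Hh c; apply: smooth_on_sqrt; [exact: coord_open| |exact: Hh].
by move=> x _; exact: h0.
Qed.

Lemma smooth_opp h : smooth h -> smooth (fun p => - h p).
Proof.
move=> Hh; apply: (@eq_smooth (fun p => (-1) * h p)); first by move=> p; rewrite mulN1r.
by apply: smooth_mul => //; exact: smooth_cst.
Qed.

Lemma smooth_sub h k : smooth h -> smooth k -> smooth (fun p => h p - k p).
Proof. by move=> Hh Hk; apply: smooth_add => //; exact: smooth_opp. Qed.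

Lemma smooth_sum (I : Type) (r : seq I) (P : pred I) (F : I -> M -> R) :
  (forall i, smooth (F i)) -> smooth (fun p => \sum_(i <- r | P i) F i p).
Proof.
move=> HF; elim: r => [|i r IH].
  by apply: (@eq_smooth (fun=> 0)); [move=> p; rewrite big_nil|exact: smooth_cst].
apply: (@eq_smooth (fun p => (if P i then F i p else 0) + \sum_(i <- r | P i) F i p)).
  by move=> p; rewrite big_cons; case: ifP => // _; rewrite add0r.
by apply: smooth_add => //; case: (P i) => //; exact: smooth_cst.
Qed.

Lemma smooth_prod (I : Type) (r : seq I) (F : I -> M -> R) :
  (forall i, smooth (F i)) -> smooth (fun p => \prod_(i <- r) F i p).
Proof.
move=> HF; elim: r => [|i r IH].
  by apply: (@eq_smooth (fun=> 1)); [move=> p; rewrite big_nil|exact: smooth_cst].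
apply: (@eq_smooth (fun p => F i p * \prod_(i <- r) F i p)).
  by move=> p; rewrite big_cons.
exact: smooth_mul.
Qed.

Lemma smooth_continuous h : smooth h -> continuous h.
Proof.
move=> Hh p; have [c cp] := dom_cover A p.
have Hx : (coord A c @` dom A c) (coord A c p) by exists p.
have ch := smooth_on_continuous (Hh c) Hx.
have cc : {for p, continuous (coord A c)} by exact: Defs.coord_continuous.
have := @continuous_comp _ _ _ (coord A c) (h \o param A c) p cc ch.
have E : {near p, (h \o param A c) \o coord A c =1 h}.
  near=> q; rewrite /= coordK //; near: q.
  exact: open_nbhs_nbhs (conj (dom_open c) cp).
rewrite /prop_for /continuous_at /= (coordK cp) => H.
by apply: cvg_trans H; apply: near_eq_cvg.
Unshelve. all: by end_near. Qed.

Section Tangent.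
Variables (p : M) (v : tvec R M).
Hypothesis tv : tangent_at p v.

Lemma tangentD h k : smooth h -> smooth k -> v (fun q => h q + k q) = v h + v k.
Proof.
case: tv => lin _ _ Hh Hk; have := lin 1 h k Hh Hk; rewrite mul1r => <-.
by congr v; apply/funext => q; rewrite mul1r.
Qed.

Lemma tangent0 : v (fun=> 0) = 0.
Proof.
have := tangentD (smooth_cst 0) (smooth_cst 0); rewrite addr0 => /esym/eqP.
by rewrite addrC -subr_eq0 addrK => /eqP.
Qed.

Lemma tangentZ (a : R) h : smooth h -> v (fun q => a * h q) = a * v h.
Proof.
case: tv => lin _ _ Hh; have := lin a h _ Hh (smooth_cst 0); rewrite tangent0 addr0 => <-.
by congr v; apply/funext => q; rewrite addr0.
Qed.

Lemma tangentN h : smooth h -> v (fun q => - h q) = - v h.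
Proof.
by move=> Hh; rewrite -mulN1r -tangentZ //; congr v; apply/funext => q; rewrite mulN1r.
Qed.

Lemma tangentB h k : smooth h -> smooth k -> v (fun q => h q - k q) = v h - v k.
Proof. by move=> Hh Hk; rewrite tangentD ?tangentN //; exact: smooth_opp. Qed.

Lemma tangentM h k : smooth h -> smooth k ->
  v (fun q => h q * k q) = v h * k p + h p * v k.
Proof. by case: tv => _ + _; apply. Qed.

Lemma tangent_cst (a : R) : v (fun=> a) = 0.
Proof.
have v1 : v (fun=> 1) = 0.
  have := tangentM (smooth_cst 1) (smooth_cst 1); rewrite !mulr1 mul1r => /esym/eqP.
  by rewrite addrC -subr_eq0 addrK => /eqP.
transitivity (v (fun=> a * 1)); first by congr v; apply/funext => q; rewrite mulr1.
by rewrite tangentZ; [rewrite v1 mulr0|exact: smooth_cst].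
Qed.

Lemma tangent_sum (I : Type) (r : seq I) (P : pred I) (F : I -> M -> R) :
  (forall i, smooth (F i)) ->
  v (fun q => \sum_(i <- r | P i) F i q) = \sum_(i <- r | P i) v (F i).
Proof.
move=> HF; elim: r => [|i r IH].
  rewrite big_nil -[RHS]tangent0; congr v.
  by apply/funext => q; rewrite big_nil.
rewrite big_cons -IH; case: (boolP (P i)) => Pi.
  rewrite -tangentD //; last exact: smooth_sum.
  by congr v; apply/funext => q; rewrite big_cons Pi.
by congr v; apply/funext => q; rewrite big_cons (negbTE Pi).
Qed.

(** Leibniz applied to h * h^-1 = 1; for the square root below, to sqrt h * sqrt h = h. *)
Lemma tangentV h : (forall q, h q != 0) -> smooth h ->
  v (fun q => (h q)^-1) = - v h / h p ^+ 2.
Proof.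
move=> h0 Hh; have Hi := smooth_inv h0 Hh.
have E : v (fun q => h q * (h q)^-1) = 0.
  by rewrite -(tangent_cst 1); congr v; apply/funext => q; rewrite mulfV.
have := tangentM Hh Hi; rewrite E => /esym/eqP; rewrite addrC addr_eq0 => /eqP e.
apply: (mulfI (h0 p)); rewrite e expr2; field; exact: h0.
Qed.

Lemma tangent_sqrt h : (forall q, 0 < h q) -> smooth h ->
  v (fun q => Num.sqrt (h q)) = v h / (2 * Num.sqrt (h p)).
Proof.
move=> h0 Hh; have Hs := smooth_sqrt h0 Hh.
have := tangentM Hs Hs.
have -> : (fun q => Num.sqrt (h q) * Num.sqrt (h q)) = h.
  by apply/funext => q; rewrite -expr2 sqr_sqrtr // ltW.
move=> ->; have s0 : Num.sqrt (h p) != 0 by rewrite gt_eqF // sqrtr_gt0.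
field; exact: s0.
Qed.

End Tangent.

(** The normalization in [tangent_at] settles the nonsmooth arguments. *)
Lemma tangent_ext p (v w : tvec R M) : tangent_at p v -> tangent_at p w ->
  (forall h, smooth h -> v h = w h) -> v = w.
Proof.
move=> [_ _ v0] [_ _ w0] H; apply/funext => h.
by have [/H//|nh] := pselect (smooth h); rewrite v0 // w0.
Qed.

Lemma tangent_at0 p : tangent_at p 0.
Proof. by split=> *; rewrite /GRing.zero /= ?mulr0 ?mul0r ?addr0. Qed.

Lemma tvecDZE (a : R) (v w : tvec R M) h : (a *: v + w) h = a * v h + w h.
Proof. by []. Qed.

Lemma tvecZE (a : R) (v : tvec R M) h : (a *: v) h = a * v h.
Proof. by []. Qed.

Lemma tvecDE (v w : tvec R M) h : (v + w) h = v h + w h.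
Proof. by []. Qed.

Lemma tvecNE (v : tvec R M) h : (- v) h = - v h.
Proof. by []. Qed.

Lemma tvec_sumE (I : Type) (r : seq I) (P : pred I) (F : I -> tvec R M) h :
  (\sum_(i <- r | P i) F i) h = \sum_(i <- r | P i) F i h.
Proof.
by elim/big_rec2 : _ => [//|i a b _ <-]; rewrite tvecDE.
Qed.

Lemma tangent_atDZ p (a : R) v w : tangent_at p v -> tangent_at p w ->
  tangent_at p (a *: v + w).
Proof.
move=> [v1 v2 v3] [w1 w2 w3]; split.
- by move=> b h k Hh Hk; rewrite !tvecDZE v1 // w1 //; ring.
- by move=> h k Hh Hk; rewrite !tvecDZE v2 // w2 //; ring.
- by move=> h nh; rewrite !tvecDZE v3 // w3 // addr0 mulr0.
Qed.

Lemma tangent_atZ p (a : R) v : tangent_at p v -> tangent_at p (a *: v).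
Proof. by move=> tv; rewrite -[_ *: _]addr0; apply: tangent_atDZ => //; exact: tangent_at0. Qed.

Lemma tangent_atD p v w : tangent_at p v -> tangent_at p w -> tangent_at p (v + w).
Proof. by move=> tv tw; rewrite -[v]scale1r; exact: tangent_atDZ. Qed.

Lemma tangent_atN p v : tangent_at p v -> tangent_at p (- v).
Proof. by rewrite -scaleN1r; exact: tangent_atZ. Qed.

Lemma tangent_at_sum p (I : Type) (r : seq I) (P : pred I) (F : I -> tvec R M) :
  (forall i, tangent_at p (F i)) -> tangent_at p (\sum_(i <- r | P i) F i).
Proof.
move=> HF; elim/big_ind : _ => // [|u w]; [exact: tangent_at0|exact: tangent_atD].
Qed.

Implicit Types X Y Z : vfield R M.

Lemma vfield_smooth X h : is_vfield X -> smooth h -> smooth (fun p => X p h).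
Proof. by case=> _; apply. Qed.

Lemma vfield_tangent X p : is_vfield X -> tangent_at p (X p).
Proof. by case. Qed.

Lemma is_vfield0 : is_vfield 0.
Proof. by split=> [p|h _]; [exact: tangent_at0|exact: smooth_cst]. Qed.

Lemma is_vfieldD X Y : is_vfield X -> is_vfield Y -> is_vfield (X + Y).
Proof.
move=> HX HY; split=> [p|h Hh].
  by apply: tangent_atD; exact: vfield_tangent.
by apply: (@smooth_add (fun p => X p h) (fun p => Y p h)); exact: vfield_smooth.
Qed.

Lemma is_vfield_scale h X : smooth h -> is_vfield X -> is_vfield (scale_vf h X).
Proof.
move=> Hh HX; split=> [p|k Hk].
  by apply: tangent_atZ; exact: vfield_tangent.
by apply: (@smooth_mul h (fun p => X p k)) => //; exact: vfield_smooth.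
Qed.

Lemma is_vfieldN X : is_vfield X -> is_vfield (- X).
Proof.
move=> HX; suff -> : - X = scale_vf (fun=> -1) X.
  by apply: is_vfield_scale => //; exact: smooth_cst.
by apply/funext => p; rewrite /scale_vf scaleN1r.
Qed.

Lemma is_vfieldB X Y : is_vfield X -> is_vfield Y -> is_vfield (X - Y).
Proof. by move=> HX HY; apply: is_vfieldD => //; exact: is_vfieldN. Qed.

Lemma vfield_sumE (I : Type) (r : seq I) (P : pred I) (F : I -> vfield R M) p :
  (\sum_(i <- r | P i) F i) p = \sum_(i <- r | P i) F i p.
Proof. by elim/big_rec2 : _ => [//|i a b _ <-]. Qed.

Lemma is_vfield_sum (I : Type) (r : seq I) (P : pred I) (F : I -> vfield R M) :
  (forall i, is_vfield (F i)) -> is_vfield (\sum_(i <- r | P i) F i).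
Proof.
move=> HF; elim/big_ind : _ => // [|u w]; [exact: is_vfield0|exact: is_vfieldD].
Qed.

Lemma is_vfield_lin (I : finType) (x : I -> M -> R) (F : I -> vfield R M) :
  (forall i, smooth (x i)) -> (forall i, is_vfield (F i)) ->
  is_vfield (fun p => \sum_i x i p *: F i p).
Proof.
move=> Hx HF; suff -> : (fun p => \sum_i x i p *: F i p) = \sum_i scale_vf (x i) (F i).
  by apply: is_vfield_sum => i; exact: is_vfield_scale.
by apply/funext => p; rewrite vfield_sumE.
Qed.

Lemma is_vfield_bracket X Y : is_vfield X -> is_vfield Y -> is_vfield (bracket X Y).
Proof.
move=> HX HY; have tX p := vfield_tangent p HX; have tY p := vfield_tangent p HY.
have sX h := @vfield_smooth X h HX; have sY h := @vfield_smooth Y h HY.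
split=> [p|h Hh]; last by apply: smooth_sub; [apply/sX/sY|apply/sY/sX].
split.
- move=> a h k Hh Hk; rewrite /bracket.
  have EX : (fun q => X q (fun r => a * h r + k r)) = (fun q => a * X q h + X q k).
    by apply/funext => q; case: (tX q) => + _ _; apply.
  have EY : (fun q => Y q (fun r => a * h r + k r)) = (fun q => a * Y q h + Y q k).
    by apply/funext => q; case: (tY q) => + _ _; apply.
  rewrite EX EY; case: (tX p) => -> //; [|exact: sY|exact: sY].
  move=> _ _; case: (tY p) => -> //; [|exact: sX|exact: sX].
  by move=> _ _; ring.
- move=> h k Hh Hk; rewrite /bracket.
  have EX : (fun q => X q (fun r => h r * k r)) = (fun q => X q h * k q + h q * X q k).
    by apply/funext => q; rewrite (tangentM (tX q)).
  have EY : (fun q => Y q (fun r => h r * k r)) = (fun q => Y q h * k q + h q * Y q k).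
    by apply/funext => q; rewrite (tangentM (tY q)).
  have mXk := smooth_mul Hh (sX _ Hk); have mXh := smooth_mul (sX _ Hh) Hk.
  have mYk := smooth_mul Hh (sY _ Hk); have mYh := smooth_mul (sY _ Hh) Hk.
  rewrite EX EY (tangentD (tX p)) // (tangentD (tY p)) //.
  rewrite !(tangentM (tX p)) //; try exact: sY.
  rewrite !(tangentM (tY p)) //; try exact: sX.
  by ring.
(* For nonsmooth [h] both inner functions are identically 0, so the bracket takes the default value
   required by [tangent_at]. *)
- move=> h nh; rewrite /bracket.
  have -> : (fun q => X q h) = (fun=> 0) by apply/funext => q; case: (tX q) => _ _ ->.
  have -> : (fun q => Y q h) = (fun=> 0) by apply/funext => q; case: (tY q) => _ _ ->.
  by rewrite (tangent0 (tX p)) (tangent0 (tY p)) subr0.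
Qed.

Lemma bracket_scalel h X Y : smooth h -> is_vfield X -> is_vfield Y ->
  bracket (scale_vf h X) Y = scale_vf h (bracket X Y) - scale_vf (fun p => Y p h) X.
Proof.
move=> Hh HX HY; apply/funext => p.
have tY := vfield_tangent p HY.
apply: (@tangent_ext p).
- by apply: vfield_tangent; apply: is_vfield_bracket => //; exact: is_vfield_scale.
- apply: (@vfield_tangent (scale_vf h (bracket X Y) - scale_vf (fun p => Y p h) X)).
  apply: is_vfieldB; apply: is_vfield_scale => //; first exact: is_vfield_bracket.
  exact: vfield_smooth.
- move=> k Hk.
  change (h p * X p (fun q => Y q k) - Y p (fun q => h q * X q k) =
    h p * (X p (fun q => Y q k) - Y p (fun q => X q k)) - Y p h * X p k).
  rewrite (tangentM tY) //; last exact: vfield_smooth.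
  by ring.
Qed.

Lemma bracketDl X X' Y : is_vfield X -> is_vfield X' -> is_vfield Y ->
  bracket (X + X') Y = bracket X Y + bracket X' Y.
Proof.
move=> HX HX' HY; apply/funext => p; apply: (@tangent_ext p).
- by apply: vfield_tangent; apply: is_vfield_bracket => //; exact: is_vfieldD.
- apply: (@vfield_tangent (bracket X Y + bracket X' Y)).
  by apply: is_vfieldD; exact: is_vfield_bracket.
- move=> h Hh.
  change (X p (fun q => Y q h) + X' p (fun q => Y q h)
    - Y p (fun q => X q h + X' q h) = X p (fun q => Y q h) - Y p (fun q => X q h)
    + (X' p (fun q => Y q h) - Y p (fun q => X' q h))).
  rewrite (tangentD (vfield_tangent p HY)) //; try exact: vfield_smooth.
  by ring.
Qed.

Lemma bracketC X Y : bracket X Y = - bracket Y X.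
Proof. by apply/funext => p; apply/funext => h; rewrite /bracket /= opprB. Qed.

Lemma bracket_jacobi X Y Z p h : is_vfield X -> is_vfield Y -> is_vfield Z ->
  smooth h ->
  bracket (bracket X Y) Z p h + bracket (bracket Y Z) X p h +
  bracket (bracket Z X) Y p h = 0.
Proof.
move=> HX HY HZ Hh; rewrite /bracket.
have sX k := @vfield_smooth X k HX; have sY k := @vfield_smooth Y k HY.
have sZ k := @vfield_smooth Z k HZ.
rewrite (tangentB (vfield_tangent p HZ)); [|exact/sX/sY|exact/sY/sX].
rewrite (tangentB (vfield_tangent p HX)); [|exact/sY/sZ|exact/sZ/sY].
rewrite (tangentB (vfield_tangent p HY)); [|exact/sZ/sX|exact/sX/sZ].
by ring.
Qed.

End SmoothFunctions.

(** * Bump functions *)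

(** The form in which criticality is obtained at the end; it also gives the derivative of [flat] at
    0. *)
Lemma is_derive_quadratic (R : realType) (F : R -> R) (C : R) :
  (\forall t \near 0, `|F t - F 0| <= C * t ^+ 2) ->
  is_derive (0 : R) (1 : R) F 0.
Proof.
move=> H.
suff L : (fun h : R => h^-1 *: ((F \o shift 0) (h *: (1 : R)) - F 0)) @ 0^' --> (0 : R).
  by apply: DeriveDef; [apply/cvg_ex; exists 0|exact: cvg_lim L].
apply/cvgr0Pnorm_le => e e0; near=> h.
have h0 : h != 0 by near: h; exact: nbhs_dnbhs_neq.
rewrite /= addr0 -[h *: 1]/(h * 1) mulr1 -[_ *: _]/(_ * _) normrM normfV.
rewrite ler_pdivrMl ?normr_gt0 //.
have : `|F h - F 0| <= C * h ^+ 2.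
  by near: h; exact: (nbhs_dnbhs H).
move=> /le_trans; apply; rewrite -[h ^+ 2]real_normK ?num_real // expr2 mulrA mulrC.
rewrite ler_wpM2l // (@le_trans _ _ (`|C| * `|h|)) ?ler_wpM2r ?ler_norm //.
(* The added 1 keeps the divisor positive when C = 0. *)
rewrite (@le_trans _ _ ((`|C| + 1) * `|h|)) ?ler_wpM2r ?lerDl //.
rewrite -ler_pdivlMl ?ltr_wpDl //; near: h.
apply: dnbhs0_le; rewrite mulr_gt0 // invr_gt0 ltr_wpDl //.
Unshelve. all: by end_near. Qed.

Section FlatFunction.
Variable R : realType.

(* [flat 0] is exp(-1/y) continued by 0; the factor y^-m makes the family stable
   under derivation. *)
Definition flat (m : nat) (y : R) : R :=
  if 0 < y then y^-1 ^+ m * expR (- y^-1) else 0.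

Lemma flat_ge0 m y : 0 <= flat m y.
Proof.
rewrite /flat; case: ifP => // y0; rewrite mulr_ge0 ?expR_ge0 // exprn_ge0 // invr_ge0.
exact: ltW.
Qed.

Lemma flat0_gt0 y : 0 < y -> 0 < flat 0 y.
Proof. by move=> y0; rewrite /flat y0 expr0 mul1r expR_gt0. Qed.

Lemma flat_le0 m y : y <= 0 -> flat m y = 0.
Proof. by move=> y0; rewrite /flat ltNge y0. Qed.

(** With k = m + 2, exp(1/y) = exp(1/(ky))^k is at least (1/(ky))^k, so y^-m exp(-1/y) is at most
    k^k y^(k - m). The exponent k is chosen to leave exactly y^2. *)
Lemma flat_bound m y : flat m y <= (m.+2)%:R ^+ m.+2 * y ^+ 2.
Proof.
rewrite /flat; case: ifPn => [y0|_]; last first.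
  by apply: mulr_ge0; [apply: exprn_ge0|exact: sqr_ge0].
have yi : 0 < y^-1 by rewrite invr_gt0.
set k := m.+2.
have k0 : 0 < k%:R :> R by rewrite ltr0n.
have E : expR (- y^-1) <= (k%:R * y) ^+ k.
  rewrite expRN -[X in X^-1]/(expR (y^-1)).
  have -> : y^-1 = k%:R * (y^-1 / k%:R) by rewrite mulrCA divff ?gt_eqF // mulr1.
  rewrite expRM_natl -exprVn lerXn2r ?nnegrE //.
    by rewrite mulr_ge0 ?ltW.
  have -> : k%:R * y = (y^-1 / k%:R)^-1 by rewrite invfM !invrK mulrC.
  rewrite lef_pV2 ?posrE ?expR_gt0 ?divr_gt0 //.
  by apply: le_trans (expR_ge1Dx _); rewrite lerDr.
have := ler_wpM2l (exprn_ge0 m (ltW yi)) E.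
move=> /le_trans; apply; rewrite exprMn mulrCA ler_wpM2l ?exprn_ge0 //.
by rewrite /k -addn2 exprD mulrA -exprMn mulVf ?gt_eqF // expr1n mul1r.
Qed.

(** For y > 0 this is the product rule, by induction on m. At y = 0 the quadratic [flat_bound] gives
    derivative 0, which is why that bound has order 2. *)
Lemma is_derive_flat m y :
  is_derive y (1 : R) (flat m) ((- m%:R) * flat m.+1 y + flat m.+2 y).
Proof.
have [y0|y0|y0] := ltgtP 0 y.
- have nE j : {near y, (fun z => z^-1 ^+ j * expR (- z^-1)) =1 flat j}.
    by near=> z; rewrite /flat ifT //; near: z; exact: lt_nbhsr.
  apply: near_is_derive (nE m) _.
  rewrite /flat y0.
  have dV : is_derive y (1 : R) (fun z : R => z^-1) (- y^-1 ^+ 2).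
    apply: DeriveDef; first by apply: derivableV; [rewrite gt_eqF|exact: derivable_id].
    rewrite deriveV; [|by rewrite gt_eqF|exact: derivable_id].
    by rewrite derive_id exprVn -[LHS]/(_ * 1) mulr1.
  elim: m => [|m IH].
    have dN : is_derive y (1 : R) (fun z : R => - z^-1) (y^-1 ^+ 2).
      by apply: is_derive_eq; rewrite opprK.
    have := is_derive_comp1 (@is_derive_expR _ _) dN.
    rewrite oppr0 mul0r add0r mulrC.
    suff -> : (fun z : R => z^-1 ^+ 0 * expR (- z^-1)) = expR \o (fun z : R => - z^-1) by [].
    by apply/funext => z; rewrite expr0 mul1r.
  have -> : (fun z : R => z^-1 ^+ m.+1 * expR (- z^-1)) =
      (fun z : R => z^-1) * (fun z : R => z^-1 ^+ m * expR (- z^-1)).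
    by apply/funext => z; rewrite exprS -mulrA.
  apply: (is_derive_eq (is_deriveM dV IH)).
  rewrite -![_ *: _]/(_ * _) !exprS -natr1; ring.
- apply: near_is_derive (_ : {near y, (fun=> 0) =1 flat m}) _.
    near=> z; rewrite flat_le0 // ltW //; near: z; exact: lt_nbhsl.
  rewrite !flat_le0 ?ltW // mulr0 addr0; exact: is_derive_cst.
- rewrite -y0 !flat_le0 // mulr0 addr0.
  apply: (@is_derive_quadratic _ _ ((m.+2)%:R ^+ m.+2)).
  near=> t; rewrite [flat m 0]flat_le0 // subr0 ger0_norm ?flat_ge0 //.
  exact: flat_bound.
Unshelve. all: by end_near. Qed.

Lemma Cle_flat (N : nat) (U : set 'rV[R]_N) k m f : open U -> Cle k U f ->
  Cle k U (fun x => flat m (f x)).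
Proof.
move=> oU; elim: k m f => [|k IH] m f Hf.
  apply/Cle0 => x Ux; apply: (@continuous_comp _ _ _ f (flat m)).
    by move/Cle0: Hf; apply.
  apply: differentiable_continuous; apply/derivable1_diffP.
  by have [] := is_derive_flat m (f x).
have /CleS[cf df] := Hf; apply/CleS; split.
  move=> x Ux; apply: (@continuous_comp _ _ _ f (flat m)); first exact: cf.
  apply: differentiable_continuous; apply/derivable1_diffP.
  by have [] := is_derive_flat m (f x).
move=> v; have [dfv Hdf] := df v.
apply: (@Cle_derive_eq _ _ _ _ _ _
  (fun x => ((- m%:R) * flat m.+1 (f x) + flat m.+2 (f x)) * 'D_v f x)) => //.
  move=> x Ux; apply: is_derive_comp1; first exact: is_derive_flat.
  exact: derivableP (dfv _ Ux).
have HfW := CleW Hf.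
apply: Cle_mul => //; apply: Cle_add => //; last exact: IH.
by apply: Cle_mul => //; [exact: Cle_cst|exact: IH].
Qed.

Definition smooth_step (y : R) : R := flat 0 y / (flat 0 y + flat 0 (1 - y)).

Lemma smooth_step_den y : 0 < flat 0 y + flat 0 (1 - y).
Proof.
have [y0|y0] := ltP 0 y; first by rewrite ltr_pwDl ?flat0_gt0 ?flat_ge0.
by rewrite ltr_wpDl ?flat_ge0 // flat0_gt0 // subr_gt0 (le_lt_trans y0).
Qed.

Lemma smooth_step_le0 y : y <= 0 -> smooth_step y = 0.
Proof. by move=> y0; rewrite /smooth_step flat_le0 // mul0r. Qed.

Lemma smooth_step_ge1 y : 1 <= y -> smooth_step y = 1.
Proof.
move=> y1; rewrite /smooth_step [flat 0 (1 - y)]flat_le0 ?subr_le0 // addr0.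
by rewrite divff // gt_eqF // flat0_gt0 // (lt_le_trans ltr01).
Qed.

Lemma smooth_on_step (N : nat) (U : set 'rV[R]_N) f : open U -> smooth_on U f ->
  smooth_on U (fun x => smooth_step (f x)).
Proof.
move=> oU Hf.
have F h : smooth_on U h -> smooth_on U (fun x => flat 0 (h x)).
  by move/smoothP => Hh; apply/smoothP => k; exact: Cle_flat.
apply: smooth_on_mul => //; first exact: F.
apply: smooth_on_inv => //; first by move=> x _; rewrite gt_eqF // smooth_step_den.
apply: smooth_on_add => //; first exact: F.
apply: F; apply: smooth_on_add => //; first exact: smooth_on_cst.
apply: (@smooth_on_eq _ _ U (fun x => (-1) * f x)) => //.
  by move=> x _; rewrite mulN1r.
by apply: smooth_on_mul => //; exact: smooth_on_cst.
Qed.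

End FlatFunction.

Definition box (R : realType) (N : nat) (x0 : 'rV[R]_N) (r : R) : set 'rV[R]_N :=
  [set x | forall j, `|x ord0 j - x0 ord0 j| <= r].

Section Boxes.
Variables (R : realType) (N : nat).

Lemma box_compact (x0 : 'rV[R]_N) r : compact (box x0 r).
Proof.
have -> : box x0 r = [set v | forall i : 'I_N,
    (fun i => [set` `[x0 ord0 i - r, x0 ord0 i + r]]) i (v ord0 i)].
  apply/seteqP; split => x /= H j; have := H j; rewrite in_itv /= ler_distl //.
by apply: (@rV_compact R N (fun i => [set` `[x0 ord0 i - r, x0 ord0 i + r]])) => i;
  exact: segment_compact.
Qed.

Lemma nbhs_box (x0 : 'rV[R]_N) r : 0 < r -> nbhs x0 (box x0 r).
Proof.
move=> r0; apply/nbhs_ballP; exists r => //= x xr j.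
by have [_ H] := xr; have := H ord0 j; rewrite /ball /= distrC => /ltW.
Qed.

Lemma nbhs_sub_box (x0 : 'rV[R]_N) (W : set 'rV[R]_N) : nbhs x0 W ->
  exists2 r : R, 0 < r & box x0 r `<=` W.
Proof.
move=> /nbhs_ballP[e /= e0 We]; exists (e / 2); first by rewrite divr_gt0.
move=> x bx; apply: We; split=> // i j; rewrite ord1 /ball /= distrC.
by apply: le_lt_trans (bx j) _; rewrite ltr_pdivrMr // ltr_pMr // ltr1n.
Qed.

Lemma rV0_coord_derive (x v : 'rV[R]_N) j :
  is_derive x v (fun y : 'rV[R]_N => y ord0 j) (v ord0 j).
Proof.
apply/is_derive_line0.
have -> : (fun s : R => (s *: v + x) ord0 j) = (fun s : R => s * v ord0 j + x ord0 j).
  by apply/funext => s; rewrite !mxE.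
have -> : (fun s : R => s * v ord0 j + x ord0 j) = (v ord0 j \*: id) + cst (x ord0 j).
  by apply/funext => s; rewrite !fctE /= -[_ *: _]/(_ * _) mulrC.
apply: (is_derive_eq (is_deriveD (is_deriveZ _ (is_derive_id (0 : R) (1 : R)))
   (is_derive_cst _ _ _))).
by rewrite addr0 -[_ *: _]/(_ * _) mulr1.
Qed.

Lemma smooth_on_prod (U : set 'rV[R]_N) (I : Type) (s : seq I)
    (F : I -> 'rV[R]_N -> R) : open U ->
  (forall i, smooth_on U (F i)) -> smooth_on U (fun x => \prod_(i <- s) F i x).
Proof.
move=> oU HF; elim: s => [|i s IH].
  apply: (@smooth_on_eq _ _ U (fun=> 1)) => //; last exact: smooth_on_cst.
  by move=> x _; rewrite big_nil.
apply: (@smooth_on_eq _ _ U (fun x => F i x * \prod_(i <- s) F i x)) => //.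
  by move=> x _; rewrite big_cons.
exact: smooth_on_mul.
Qed.

End Boxes.

Section Bumps.
Variables (R : realType) (N : nat) (M : ptopologicalType) (A : manifold R N M).

Local Notation cdom c := (coord A c @` dom A c).

Lemma cdom_param c x : cdom c x -> dom A c (param A c x).
Proof. by case=> p cp <-; rewrite coordK. Qed.

Lemma cdom_paramK c x : cdom c x -> coord A c (param A c x) = x.
Proof. by case=> p cp <-; rewrite coordK. Qed.

Lemma cdomE c p : dom A c p -> cdom c (coord A c p).
Proof. by exists p. Qed.

Lemma open_coord_image c (O : set M) : open O -> open (coord A c @` (dom A c `&` O)).
Proof.
move=> oO; have -> : coord A c @` (dom A c `&` O) = cdom c `&` (param A c @^-1` O).
  apply/seteqP; split => [x [p [cp Op] <-]|x [cx Ox]].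
    by split; [exists p|rewrite /= coordK].
  exists (param A c x); last exact: cdom_paramK.
  by split => //; exact: cdom_param.
rewrite openE => x [cx Ox]; apply: filterI.
  have oV : open (cdom c) by exact: coord_open.
  exact: open_nbhs_nbhs (conj oV cx).
have H : {for x, continuous (param A c)} := @param_continuous R N M A c x cx.
exact: (H _ (open_nbhs_nbhs (conj oO Ox))).
Qed.

Lemma nbhs_coord c p (W : set 'rV[R]_N) : dom A c p -> nbhs (coord A c p) W ->
  nbhs p (dom A c `&` (coord A c @^-1` W)).
Proof.
move=> cp nW; apply: filterI; first exact: open_nbhs_nbhs (conj (dom_open c) cp).
have H : {for p, continuous (coord A c)} by exact: Defs.coord_continuous.
exact: (H _ nW).
Qed.

Lemma param_box_compact c x0 r : box x0 r `<=` cdom c ->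
  compact (param A c @` box x0 r).
Proof.
move=> bV; apply: continuous_compact; last exact: box_compact.
apply: continuous_in_subspaceT => x /set_mem/bV cx.
exact: (@param_continuous R N M A c x cx).
Qed.

(** A product of one-variable steps in the chart, extended by 0. The extension is smooth because the
    image of the compact box is closed in the Hausdorff space M. *)
Lemma exists_bump c p r : dom A c p -> 0 < r ->
  box (coord A c p) r `<=` cdom c ->
  exists chi : M -> R, [/\ smooth A chi,
    (forall q, ~ (param A c @` box (coord A c p) r) q -> chi q = 0) &
    forall q, dom A c q -> box (coord A c p) (r / 2) (coord A c q) -> chi q = 1].
Proof.
move=> cp r0 bV; set x0 := coord A c p in bV *.
(* The argument 2 - (2 (x_j - x0_j) / r)^2 is at least 1 when |x_j - x0_j| <= r/2 and negative
   beyond r; the square avoids the nonsmooth absolute value. *)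
pose b (x : 'rV[R]_N) := \prod_(j <- enum 'I_N)
  smooth_step (2 + (-1) * (((x ord0 j + - x0 ord0 j) * (2 / r)) *
                    ((x ord0 j + - x0 ord0 j) * (2 / r)))).
pose chi q := if `[< dom A c q >] then b (coord A c q) else 0.
have r2 : 0 < 2 / r by rewrite divr_gt0.
have b0 x : ~ box x0 r x -> b x = 0.
  move=> /existsNP[j /negP]; rewrite -ltNge => jr.
  rewrite /b (bigD1_seq j) ?mem_enum ?enum_uniq //= smooth_step_le0 ?mul0r //.
  rewrite -expr2 mulN1r subr_le0 exprMn -real_normK ?num_real //.
  rewrite (@le_trans _ _ (r ^+ 2 * (2 / r) ^+ 2)) //.
    rewrite -exprMn mulrCA divff ?gt_eqF // mulr1 expr2; lra.
  by rewrite ler_wpM2r ?sqr_ge0 // lerXn2r ?nnegrE // ltW.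
have b1 x : box x0 (r / 2) x -> b x = 1.
  move=> H; rewrite /b big1_seq // => j _; rewrite smooth_step_ge1 //.
  rewrite -expr2 mulN1r lerBrDr -lerBrDl exprMn -real_normK ?num_real //.
  rewrite (_ : 2 - 1 = 1); last by lra.
  rewrite (@le_trans _ _ ((r / 2) ^+ 2 * (2 / r) ^+ 2)) //; last first.
    by rewrite -exprMn (_ : r / 2 * (2 / r) = 1) ?expr1n //; field; rewrite gt_eqF.
  apply: ler_wpM2r; first exact: sqr_ge0.
  by rewrite ler_sqr ?nnegrE //; rewrite ltW // divr_gt0.
exists chi; split.
- move=> c'; apply: smooth_on_near => x cx; set q := param A c' x.
  have c'q : dom A c' q by exact: cdom_param.
  have xE : coord A c' q = x by exact: cdom_paramK.
  have [cq|ncq] := pselect (dom A c q).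
    pose W := coord A c' @` (dom A c' `&` dom A c).
    have oW : open W by apply: open_coord_image; exact: dom_open.
    exists W, (b \o (fun y => coord A c (param A c' y))); split => //.
    - by exists q.
    - have T j : smooth_on W (fun y => coord A c (param A c' y) ord0 j).
        exact: transition_smooth.
      apply: smooth_on_prod => // j; apply: smooth_on_step => //.
      have C a : smooth_on W (fun=> a : R) by exact: smooth_on_cst.
      apply: smooth_on_add => //; apply: smooth_on_mul => //.
      by do !apply: smooth_on_mul => //; apply: smooth_on_add.
    - move=> y [q' [c'q' cq'] <-]; rewrite /chi /= coordK //.
      by rewrite asboolT.
  (* A point outside the chart domain has a neighbourhood missing the closed set [Kq], and the bump
     is 0 there. *)
  pose Kq := param A c @` box x0 r.
  have cK : closed Kq.
    by apply: compact_closed; [exact: hausdorff_carrier A|exact: param_box_compact].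
  pose W := coord A c' @` (dom A c' `&` ~` Kq).
  have oW : open W by apply: open_coord_image; rewrite openC.
  exists W, (fun=> 0); split => //.
  - exists q => //; split => // -[y by_ yq]; apply: ncq; rewrite -yq.
    exact/cdom_param/bV.
  - exact: smooth_on_cst.
  - move=> y [q' [c'q' nKq'] <-]; rewrite /chi /= coordK //.
    case: asboolP => // cq'; apply: b0 => bq'; apply: nKq'.
    by exists (coord A c q') => //; exact: coordK.
- move=> q nK; rewrite /chi; case: asboolP => // cq; apply: b0 => bq; apply: nK.
  by exists (coord A c q) => //; exact: coordK.
- by move=> q cq bq; rewrite /chi asboolT // b1.
Qed.

End Bumps.

(** * Orthonormal frames and coordinates *)

(** The last clause says that the frame spans, in the form of an expansion of every derivation at p.
    All later facts about derivations, including their expression in coordinates, are drawn from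
    it. *)
Definition orthoframe (R : realType) (N : nat) (M : ptopologicalType)
    (A : manifold R N M) (I : finType) (g : metric R M) (E : I -> vfield R M) :=
  [/\ riemannian_metric A g, forall i, is_vfield A (E i),
      forall p i j, g p (E i p) (E j p) = (i == j)%:R
    & forall p v, tangent_at A p v -> v = \sum_i g p v (E i p) *: E i p].

Section CoordinateVectors.
Variables (R : realType) (N : nat) (M : ptopologicalType) (A : manifold R N M).

Local Notation cdom c := (coord A c @` dom A c).
Local Notation dlt j := (delta_mx ord0 j : 'rV[R]_N).

Lemma coord_vecE c i p h : smooth A h ->
  coord_vec c i p h = 'D_(dlt i) (h \o param A c) (coord A c p).
Proof. by move=> Hh; rewrite /coord_vec asboolT. Qed.

Lemma smooth_derivable c p h v : smooth A h -> dom A c p ->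
  derivable (h \o param A c) (coord A c p) v.
Proof. by move=> Hh cp; apply: smooth_on_derivable (Hh c) _; exact: cdomE. Qed.

Lemma coord_vec_tangent c i p : dom A c p -> tangent_at A p (coord_vec c i p).
Proof.
move=> cp; split.
- move=> a h k Hh Hk.
  have Hah := smooth_mul (@smooth_cst _ _ _ A a) Hh.
  rewrite !coord_vecE //; last exact: smooth_add.
  have dh := @smooth_derivable c p h (dlt i) Hh cp.
  have dk := @smooth_derivable c p k (dlt i) Hk cp.
  have -> : (fun q => a * h q + k q) \o param A c =
      (a \*: (h \o param A c)) + (k \o param A c) by [].
  have dah := @derivableZ _ _ _ _ a _ _ dh.
  by rewrite (deriveD dah dk) (@deriveZ _ _ _ _ a _ _ dh).
- move=> h k Hh Hk.
  rewrite !coord_vecE //; last exact: smooth_mul.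
  have dh := @smooth_derivable c p h (dlt i) Hh cp.
  have dk := @smooth_derivable c p k (dlt i) Hk cp.
  have -> : (fun q => h q * k q) \o param A c =
      (h \o param A c) * (k \o param A c) by [].
  rewrite (deriveM dh dk) -![_ *: _]/(_ * _).
  have hK u : (u \o param A c) (coord A c p) = u p by rewrite /= coordK.
  by rewrite !hK addrC mulrC.
- by move=> h nh; rewrite /coord_vec asboolF.
Qed.

(** Tangent vectors act on global smooth functions only, so the coordinate functions are multiplied
    by a bump that is 1 near p. *)
Lemma local_coordinates c p : dom A c p ->
  exists (zeta : 'I_N -> M -> R) (W : set M),
  [/\ open W, W p, W `<=` dom A c, (forall j, smooth A (zeta j))
    & forall q i j, W q -> coord_vec c i q (zeta j) = (i == j)%:R].
Proof.
move=> cp.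
have nV : nbhs (coord A c p) (cdom c).
  apply: open_nbhs_nbhs; split; first exact: coord_open.
  exact: cdomE.
have [r r0 bV] := nbhs_sub_box nV.
have [chi [chiS chi0 chi1]] := exists_bump cp r0 bV.
have r2 : 0 < r / 2 by rewrite divr_gt0.
pose W := dom A c `&` (coord A c @^-1` (box (coord A c p) (r / 2))°).
pose zeta j q := if `[< dom A c q >] then chi q * coord A c q ord0 j else 0.
have sz j : smooth A (zeta j).
  move=> c'; apply: smooth_on_near => x cx; set q := param A c' x.
  have c'q : dom A c' q by exact: cdom_param.
  have xE : coord A c' q = x by exact: cdom_paramK.
  have [cq|ncq] := pselect (dom A c q).
    pose U := coord A c' @` (dom A c' `&` dom A c).
    have oU : open U by apply: open_coord_image; exact: dom_open.
    exists U, (fun y => (chi \o param A c') y * coord A c (param A c' y) ord0 j).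
    split => //.
    - by exists q.
    - apply: smooth_on_mul => //; last exact: transition_smooth.
      by apply: smooth_on_sub (chiS c') => y [q' [c'q' _] <-]; exists q'.
    - by move=> y [q' [c'q' cq'] <-]; rewrite /zeta /= coordK // asboolT.
  pose Kq := param A c @` box (coord A c p) r.
  have cK : closed Kq.
    by apply: compact_closed; [exact: hausdorff_carrier A|exact: param_box_compact].
  pose U := coord A c' @` (dom A c' `&` ~` Kq).
  have oU : open U by apply: open_coord_image; rewrite openC.
  exists U, (fun=> 0); split => //.
  - exists q => //; split => // -[y by_ yq]; apply: ncq; rewrite -yq.
    exact/cdom_param/bV.
  - exact: smooth_on_cst.
  - move=> y [q' [c'q' nKq'] <-]; rewrite /zeta /= coordK //.
    by case: asboolP => // _; rewrite chi0 // mul0r.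
exists zeta, W; split => //.
- rewrite openE => q [cq bq]; apply: nbhs_coord => //.
  by apply: open_nbhs_nbhs; split => //; exact: open_interior.
- by split => //; exact: nbhs_box.
- by move=> q [].
- move=> q i j [cq bq]; rewrite coord_vecE //.
  rewrite (@near_eq_derive _ _ _ _ (fun x : 'rV[R]_N => x ord0 j)); last first.
    have nW : nbhs (coord A c q) (cdom c `&` (box (coord A c p) (r / 2))°).
      apply: open_nbhs_nbhs; split; last by split => //; exact: cdomE.
      by apply: openI; [exact: coord_open|exact: open_interior].
    apply: filterS nW => x [cx bx]; rewrite /zeta /= asboolT; last exact: cdom_param.
    rewrite chi1 ?mul1r ?cdom_paramK //; first exact: cdom_param.
    exact: interior_subset bx.
  have [_ ->] := rV0_coord_derive (coord A c q) (dlt i) j.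
  by rewrite mxE eqxx /= eq_sym.
Qed.

(** Coordinate vectors expand in the frame by [orthoframe]; evaluating these expansions on [zeta]
    gives a matrix identity a b = 1. The frame has as many members as there are coordinates, so b a
    = 1 too, and this expands the frame in coordinate vectors. *)
Lemma frame_coordinates (g : metric R M) (E : 'I_N -> vfield R M) c p :
  orthoframe A g E -> dom A c p ->
  exists (zeta : 'I_N -> M -> R) (W : set M),
  [/\ open W, W p, W `<=` dom A c, (forall j, smooth A (zeta j)) &
    forall q, W q -> [/\
    (forall i j, coord_vec c i q (zeta j) = (i == j)%:R),
    (forall i, E i q = \sum_j E i q (zeta j) *: coord_vec c j q),
    (forall i, coord_vec c i q = \sum_j g q (coord_vec c i q) (E j q) *: E j q) &
    (\matrix_(i, j) g q (coord_vec c i q) (E j q)) *m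
      (\matrix_(i, j) E i q (zeta j)) = 1%:M]].
Proof.
move=> [gr Ev Eo Es] cp.
have [zeta [W [oW Wp Wd sz dz]]] := local_coordinates cp.
exists zeta, W; split => // q Wq.
have cE i : coord_vec c i q = \sum_j g q (coord_vec c i q) (E j q) *: E j q.
  by apply: Es; apply: coord_vec_tangent; exact: Wd.
have ab : (\matrix_(i, j) g q (coord_vec c i q) (E j q)) *m
    (\matrix_(i, j) E i q (zeta j)) = 1%:M.
  apply/matrixP => i j; rewrite !mxE -(dz q i j Wq) [in RHS]cE tvec_sumE.
  by apply: eq_bigr => k _; rewrite !mxE.
split => // [i j|i]; first exact: dz.
have ba := mulmx1C ab.
transitivity (\sum_j (\matrix_(i, j) E i q (zeta j) *m
    \matrix_(i, j) g q (coord_vec c i q) (E j q)) i j *: E j q).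
  rewrite ba (bigD1 i) //= mxE eqxx scale1r big1 ?addr0 // => j ji.
  by rewrite mxE eq_sym (negbTE ji) scale0r.
under [RHS]eq_bigr => j _ do rewrite cE scaler_sumr.
rewrite exchange_big /=; apply: eq_bigr => j _.
rewrite mxE scaler_suml; apply: eq_bigr => k _.
by rewrite !mxE scalerA.
Qed.

End CoordinateVectors.

(** * The Levi-Civita connection in an orthonormal frame *)

Section RiemannianMetric.
Variables (R : realType) (N : nat) (M : ptopologicalType) (A : manifold R N M).
Variables (g : metric R M) (gr : riemannian_metric A g) (p : M).
Implicit Types u v w : tvec R M.
Local Notation tg := (tangent_at A p).

Lemma metric_sym u v : tg u -> tg v -> g p u v = g p v u.
Proof. by case: gr => + _ _ _; apply. Qed.

Lemma metricDZl a u v w : tg u -> tg v -> tg w ->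
  g p (a *: u + v) w = a * g p u w + g p v w.
Proof. by case: gr => _ + _ _; apply. Qed.

Lemma metricDl u v w : tg u -> tg v -> tg w -> g p (u + v) w = g p u w + g p v w.
Proof. by move=> tu tv tw; rewrite -[u]scale1r metricDZl // mul1r scale1r. Qed.

Lemma metric0l w : tg w -> g p 0 w = 0.
Proof.
move=> tw; have := metricDl (tangent_at0 A p) (tangent_at0 A p) tw.
by rewrite addr0 => /esym/eqP; rewrite addrC -subr_eq0 addrK => /eqP.
Qed.

Lemma metricZl a u w : tg u -> tg w -> g p (a *: u) w = a * g p u w.
Proof.
move=> tu tw; rewrite -[a *: u]addr0 metricDZl ?metric0l ?addr0 //.
exact: tangent_at0.
Qed.

Lemma metricNl u w : tg u -> tg w -> g p (- u) w = - g p u w.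
Proof. by move=> tu tw; rewrite -scaleN1r metricZl // mulN1r. Qed.

Lemma metricBl u v w : tg u -> tg v -> tg w -> g p (u - v) w = g p u w - g p v w.
Proof. by move=> tu tv tw; rewrite metricDl ?metricNl //; exact: tangent_atN. Qed.

Lemma metric_suml (I : Type) (r : seq I) (P : pred I) (a : I -> R)
    (F : I -> tvec R M) w : (forall i, tg (F i)) -> tg w ->
  g p (\sum_(i <- r | P i) a i *: F i) w = \sum_(i <- r | P i) a i * g p (F i) w.
Proof.
move=> HF tw; elim: r => [|i r IH]; first by rewrite !big_nil metric0l.
rewrite !big_cons; case: ifP => // _; rewrite metricDZl ?IH //.
by apply: tangent_at_sum => j; exact: tangent_atZ.
Qed.

Lemma metric_sumr (I : Type) (r : seq I) (P : pred I) (a : I -> R)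
    (F : I -> tvec R M) w : (forall i, tg (F i)) -> tg w ->
  g p w (\sum_(i <- r | P i) a i *: F i) = \sum_(i <- r | P i) a i * g p w (F i).
Proof.
move=> HF tw; rewrite metric_sym //; last first.
  by apply: tangent_at_sum => j; exact: tangent_atZ.
by rewrite metric_suml //; apply: eq_bigr => i _; rewrite metric_sym.
Qed.

End RiemannianMetric.

Lemma smooth_metric (R : realType) (N : nat) (M : ptopologicalType)
    (A : manifold R N M) (g : metric R M) (X Y : vfield R M) :
  riemannian_metric A g -> is_vfield A X -> is_vfield A Y ->
  smooth A (fun p => g p (X p) (Y p)).
Proof. by case=> _ _ _; apply. Qed.

Section FrameGeometry.
Variables (R : realType) (N : nat) (M : ptopologicalType) (A : manifold R N M).
Variables (I : finType) (g : metric R M) (E : I -> vfield R M).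
Hypothesis frE : orthoframe A g E.

Let gr : riemannian_metric A g. Proof. by case: frE. Qed.
Let Ev i : is_vfield A (E i). Proof. by case: frE. Qed.
Let Eo p i j : g p (E i p) (E j p) = (i == j)%:R. Proof. by case: frE. Qed.
Let Et i p : tangent_at A p (E i p). Proof. exact: vfield_tangent. Qed.

Definition fcomp (X : vfield R M) i p := g p (X p) (E i p).

Lemma fcomp_smooth X i : is_vfield A X -> smooth A (fcomp X i).
Proof. by move=> HX; exact: smooth_metric gr HX (Ev i). Qed.

Lemma fcompE X p : is_vfield A X -> X p = \sum_i fcomp X i p *: E i p.
Proof. by move=> HX; case: frE => _ _ _; apply; exact: vfield_tangent. Qed.

Lemma fcomp_lin (x : I -> M -> R) i p :
  fcomp (fun q => \sum_j x j q *: E j q) i p = x i p.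
Proof.
rewrite /fcomp (metric_suml gr) // (bigD1 i) //= Eo eqxx mulr1 big1 ?addr0 //.
by move=> j ji; rewrite Eo (negbTE ji) mulr0.
Qed.

Lemma metric_fcomp p u v : tangent_at A p u -> tangent_at A p v ->
  g p u v = \sum_i g p u (E i p) * g p v (E i p).
Proof.
move=> tu tv; case: frE => _ _ _ Es; rewrite {1}(Es p u tu) (metric_suml gr) //.
by apply: eq_bigr => i _; rewrite (metric_sym gr tv).
Qed.

Lemma fcomp_ext X Y : is_vfield A X -> is_vfield A Y ->
  (forall p i, fcomp X i p = fcomp Y i p) -> X = Y.
Proof.
move=> HX HY H; apply/funext => p; rewrite (fcompE p HX) (fcompE p HY).
by apply: eq_bigr => i _; rewrite H.
Qed.

Lemma fcompD X Y i p : is_vfield A X -> is_vfield A Y ->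
  fcomp (X + Y) i p = fcomp X i p + fcomp Y i p.
Proof. by move=> HX HY; rewrite /fcomp (metricDl gr) //; exact: vfield_tangent. Qed.

Lemma fcompB X Y i p : is_vfield A X -> is_vfield A Y ->
  fcomp (X - Y) i p = fcomp X i p - fcomp Y i p.
Proof. by move=> HX HY; rewrite /fcomp (metricBl gr) //; exact: vfield_tangent. Qed.

Lemma fcompZ h X i p : is_vfield A X -> fcomp (scale_vf h X) i p = h p * fcomp X i p.
Proof. by move=> HX; rewrite /fcomp (metricZl gr) //; exact: vfield_tangent. Qed.

Definition structure_fun i j k p := g p (bracket (E i) (E j) p) (E k p).
Local Notation cc := structure_fun.

(* [christoffel i j k] is g(nabla_{E_i} E_j, E_k), by the Koszul formula. *)
Definition christoffel i j k p := 2^-1 * (cc i j k p - cc j k i p + cc k i j p).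
Local Notation Gm := christoffel.

Lemma structure_smooth i j k : smooth A (cc i j k).
Proof. by apply: smooth_metric => //; exact: is_vfield_bracket. Qed.

Lemma structureC i j k p : cc j i k p = - cc i j k p.
Proof.
rewrite /structure_fun bracketC (metricNl gr) //.
by apply: vfield_tangent; exact: is_vfield_bracket.
Qed.

Lemma structure_diag i k p : cc i i k p = 0.
Proof. by have := structureC i i k p; lra. Qed.

Lemma christoffel_smooth i j k : smooth A (Gm i j k).
Proof.
apply: smooth_mul; first exact: smooth_cst.
apply: smooth_add; last exact: structure_smooth.
by apply: smooth_sub; exact: structure_smooth.
Qed.

Lemma christoffel_torsion i j k p : Gm i j k p - Gm j i k p = cc i j k p.
Proof.
rewrite /christoffel (structureC i j k) (structureC i k j) (structureC k j i).
by field.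
Qed.

Lemma christoffel_metric i j k p : Gm i j k p + Gm i k j p = 0.
Proof.
rewrite /christoffel (structureC i j k) (structureC i k j) (structureC k j i).
by rewrite (structureC k i j) (structureC j i k) (structureC j k i); field.
Qed.

(** The connection with coefficients [christoffel]. It is the witness that gives the [get] in
    [levi_civita] its meaning. *)
Definition frame_connection (X Y : vfield R M) : vfield R M := fun p =>
  \sum_k (X p (fcomp Y k) + \sum_i \sum_j fcomp X i p * fcomp Y j p * Gm i j k p) *: E k p.
Local Notation nab := frame_connection.

Lemma fcomp_connection X Y k p : fcomp (nab X Y) k p =
  X p (fcomp Y k) + \sum_i \sum_j fcomp X i p * fcomp Y j p * Gm i j k p.
Proof. exact: (fcomp_lin (fun k p => X p (fcomp Y k) +
  \sum_i \sum_j fcomp X i p * fcomp Y j p * Gm i j k p)). Qed.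

Lemma frame_connection_vfield X Y : is_vfield A X -> is_vfield A Y ->
  is_vfield A (nab X Y).
Proof.
move=> HX HY; apply: is_vfield_lin => // k; apply: smooth_add.
  by apply: vfield_smooth => //; exact: fcomp_smooth.
apply: smooth_sum => i; apply: smooth_sum => j.
apply: smooth_mul; last exact: christoffel_smooth.
by apply: smooth_mul; exact: fcomp_smooth.
Qed.

Lemma fcomp_bracket X Y k p : is_vfield A X -> is_vfield A Y ->
  fcomp (bracket X Y) k p = X p (fcomp Y k) - Y p (fcomp X k) +
    \sum_i \sum_j fcomp X i p * fcomp Y j p * cc i j k p.
Proof.
move=> HX HY; have HB := is_vfield_bracket HX HY.
suff brE : bracket X Y p = \sum_k (X p (fcomp Y k) - Y p (fcomp X k) +
    \sum_i \sum_j fcomp X i p * fcomp Y j p * cc i j k p) *: E k p.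
  rewrite {1}/fcomp brE.
  exact: (fcomp_lin (fun k q => X p (fcomp Y k) - Y p (fcomp X k) +
    \sum_i \sum_j fcomp X i p * fcomp Y j p * cc i j k p)).
apply: (@tangent_ext _ _ _ A p); first exact: vfield_tangent.
  by apply: tangent_at_sum => i; apply: tangent_atZ; exact: Et.
move=> h Hh; rewrite tvec_sumE {k}.
(* Z(W h) has a part of first order in h and a part with the second derivatives E_i(E_j h). In the
   commutator the latter antisymmetrize to brackets of frame fields, hence to structure
   functions. *)
have expand Z W : is_vfield A Z -> is_vfield A W ->
    Z p (fun q => W q h) = \sum_k Z p (fcomp W k) * E k p h +
    \sum_i \sum_j fcomp Z i p * fcomp W j p * E i p (fun q => E j q h).
  move=> HZ HW; have tZ := vfield_tangent p HZ.
  have -> : (fun q => W q h) = (fun q => \sum_k fcomp W k q * E k q h).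
    by apply/funext => q; rewrite (fcompE q HW) tvec_sumE.
  rewrite (tangent_sum tZ); last first.
    by move=> k; apply: smooth_mul; [exact: fcomp_smooth|exact: vfield_smooth].
  under eq_bigr => k _.
    rewrite (tangentM tZ); [|exact: fcomp_smooth|exact: vfield_smooth].
    over.
  rewrite big_split /=; congr (_ + _); rewrite exchange_big /=.
  apply: eq_bigr => k _; rewrite [in LHS](fcompE p HZ) tvec_sumE mulr_sumr.
  by apply: eq_bigr => i _; rewrite tvecZE; ring.
rewrite {1}/bracket (expand X Y) // (expand Y X) //.
under [RHS]eq_bigr => k _ do rewrite tvecZE mulrDl mulrBl.
rewrite big_split /= sumrB /=.
have aux (a b c d e : R) : b - d = e -> a + b - (c + d) = a - c + e.
  by move=> <-; ring.
apply: aux.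
under [RHS]eq_bigr => k _ do rewrite mulr_suml.
rewrite [RHS]exchange_big /= [X in _ - X]exchange_big /= -sumrB; apply: eq_bigr => i _.
rewrite -sumrB; under [RHS]eq_bigr => k _ do rewrite mulr_suml.
rewrite exchange_big /=; apply: eq_bigr => j _.
have HBij := is_vfield_bracket (Ev i) (Ev j).
transitivity (fcomp X i p * fcomp Y j p * bracket (E i) (E j) p h).
  by rewrite /bracket; ring.
rewrite (fcompE p HBij) tvec_sumE mulr_sumr; apply: eq_bigr => k _.
by rewrite tvecZE /fcomp /structure_fun; ring.
Qed.

End FrameGeometry.

Lemma vfieldDE (R : realType) (M : ptopologicalType) (X Y : vfield R M) p :
  (X + Y) p = X p + Y p.
Proof. by []. Qed.

Lemma vfieldNE (R : realType) (M : ptopologicalType) (X : vfield R M) p :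
  (- X) p = - X p.
Proof. by []. Qed.

Section LeviCivita.
Variables (R : realType) (N : nat) (M : ptopologicalType) (A : manifold R N M).
Variables (I : finType) (g : metric R M) (E : I -> vfield R M).
Hypothesis frE : orthoframe A g E.

Let gr : riemannian_metric A g. Proof. by case: frE. Qed.
Let Ev i : is_vfield A (E i). Proof. by case: frE. Qed.
Let Eo p i j : g p (E i p) (E j p) = (i == j)%:R. Proof. by case: frE. Qed.
Let Et i p : tangent_at A p (E i p). Proof. exact: vfield_tangent. Qed.
Local Notation cc := (structure_fun g E).
Local Notation Gm := (christoffel g E).
Local Notation fcomp := (fcomp g E).
Local Notation nab := (frame_connection g E).
Local Notation vf := (is_vfield A).

Lemma frame_connection_levi_civita : is_levi_civita A g nab.
Proof.
have fs := fcomp_smooth frE; have nv := frame_connection_vfield frE.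
split; first exact: nv.
split.
- move=> h X X' Y Hh HX HX' HY.
  have HhX := is_vfield_scale Hh HX.
  apply: (fcomp_ext frE); [apply: nv => //; exact: is_vfieldD| |].
    by apply: is_vfieldD; [apply: is_vfield_scale => //|]; exact: nv.
  move=> p k; rewrite (fcompD frE); [|apply: is_vfield_scale => //; exact: nv|exact: nv].
  rewrite (fcompZ frE); last exact: nv.
  rewrite !(fcomp_connection frE).
  have -> : (scale_vf h X + X') p (fcomp Y k) = h p * X p (fcomp Y k) + X' p (fcomp Y k) by [].
  have aux (a b c s s' s'' : R) : s = a * s' + s'' ->
      a * b + c + s = a * (b + s') + (c + s'') by move=> ->; ring.
  apply: aux; rewrite mulr_sumr -big_split /=; apply: eq_bigr => i _.
  rewrite mulr_sumr -big_split /=; apply: eq_bigr => j _.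
  by rewrite (fcompD frE) // (fcompZ frE) //; ring.
- move=> h X Y Y' Hh HX HY HY'.
  have HhY := is_vfield_scale Hh HY.
  have HXh := vfield_smooth HX Hh.
  have H1 : vf (scale_vf (fun p => X p h) Y) by exact: is_vfield_scale.
  have H2 : vf (scale_vf h (nab X Y)) by apply: is_vfield_scale => //; exact: nv.
  have H3 : vf (nab X Y') by exact: nv.
  have H4 := is_vfieldD H1 H2.
  apply: (fcomp_ext frE); [apply: nv => //; exact: is_vfieldD|exact: is_vfieldD|].
  move=> p k; rewrite !(fcompD frE) // !(fcompZ frE) //; last exact: nv.
  rewrite !(fcomp_connection frE).
  have -> : fcomp (scale_vf h Y + Y') k = fun q => h q * fcomp Y k q + fcomp Y' k q.
    by apply/funext => q; rewrite (fcompD frE) // (fcompZ frE).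
  have tX := vfield_tangent p HX.
  rewrite (tangentD tX); [|apply: smooth_mul => //; exact: fs|exact: fs].
  rewrite (tangentM tX) //; last exact: fs.
  have aux (x y h1 a b s s' s'' : R) : s = h1 * s' + s'' ->
      x * y + h1 * a + b + s = x * y + h1 * (a + s') + (b + s'') by move=> ->; ring.
  apply: aux; rewrite mulr_sumr -big_split /=; apply: eq_bigr => i _.
  rewrite mulr_sumr -big_split /=; apply: eq_bigr => j _.
  by rewrite (fcompD frE) // (fcompZ frE) //; ring.
- move=> X Y HX HY.
  have HB := is_vfield_bracket HX HY.
  have HXY := nv _ _ HX HY; have HYX := nv _ _ HY HX.
  apply: (fcomp_ext frE) => //; first exact: is_vfieldB.
  move=> p k; rewrite (fcompB frE) // !(fcomp_connection frE) (fcomp_bracket frE) //.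
  have aux (a b s s' s'' : R) : s - s' = s'' -> a + s - (b + s') = a - b + s''.
    by move=> <-; ring.
  apply: aux; rewrite [X in _ - X]exchange_big /= -sumrB; apply: eq_bigr => i _.
  rewrite -sumrB; apply: eq_bigr => j _.
  by rewrite -(christoffel_torsion frE); ring.
- move=> X Y Z p HX HY HZ.
  have tX := vfield_tangent p HX.
  have HXY := nv _ _ HX HY; have HXZ := nv _ _ HX HZ.
  have -> : (fun q => g q (Y q) (Z q)) = fun q => \sum_k fcomp Y k q * fcomp Z k q.
    by apply/funext => q; rewrite (metric_fcomp frE) //; exact: vfield_tangent.
  rewrite (tangent_sum tX); last by move=> k; apply: smooth_mul; exact: fs.
  rewrite !(metric_fcomp frE) //; try exact: vfield_tangent.
  have fE W k : g p (W p) (E k p) = fcomp W k p by [].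
  under [X in _ = X + _]eq_bigr => k _ do rewrite !fE (fcomp_connection frE) mulrDl.
  under [X in _ = _ + X]eq_bigr => k _ do rewrite !fE (fcomp_connection frE) mulrDr.
  rewrite !big_split /=.
  under eq_bigr => k _ do rewrite (tangentM tX (fs Y k HY) (fs Z k HZ)).
  rewrite big_split /=.
  have aux (a b s s' : R) : s + s' = 0 -> a + b = a + s + (b + s').
    by move=> H; rewrite addrACA H addr0.
  apply: aux.
  under eq_bigr => k _ do rewrite mulr_suml.
  rewrite exchange_big /=.
  under [X in _ + X]eq_bigr => k _ do rewrite mulr_sumr.
  rewrite [X in _ + X]exchange_big /= -big_split /= big1 // => i _.
  under eq_bigr => k _ do rewrite mulr_suml.
  under [X in _ + X]eq_bigr => k _ do rewrite mulr_sumr.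
  rewrite [X in X + _]exchange_big /= -big_split /= big1 // => j _.
  rewrite -big_split /= big1 // => k _.
  have := christoffel_metric frE i j k p => /eqP; rewrite addr_eq0 => /eqP ->.
  ring.
Qed.

Local Notation lc := (levi_civita A g).

Lemma levi_civitaP : is_levi_civita A g lc.
Proof.
rewrite /levi_civita; apply: (@getPex _ [set nabla | is_levi_civita A g nabla]).
by exists nab; exact: frame_connection_levi_civita.
Qed.

Lemma lc_vfield X Y : vf X -> vf Y -> vf (lc X Y).
Proof. by case: levi_civitaP => + _; apply. Qed.

Lemma lc_linl h X X' Y : smooth A h -> vf X -> vf X' -> vf Y ->
  lc (scale_vf h X + X') Y = scale_vf h (lc X Y) + lc X' Y.
Proof. by case: levi_civitaP => _ [+ _ _ _]; apply. Qed.

Lemma lc_linr h X Y Y' : smooth A h -> vf X -> vf Y -> vf Y' ->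
  lc X (scale_vf h Y + Y') =
    scale_vf (fun p => X p h) Y + scale_vf h (lc X Y) + lc X Y'.
Proof. by case: levi_civitaP => _ [_ + _ _]; apply. Qed.

Lemma lc_torsion X Y : vf X -> vf Y -> lc X Y - lc Y X = bracket X Y.
Proof. by case: levi_civitaP => _ [_ _ + _]; apply. Qed.

Lemma lc_metric X Y Z p : vf X -> vf Y -> vf Z ->
  X p (fun q => g q (Y q) (Z q)) = g p (lc X Y p) (Z p) + g p (Y p) (lc X Z p).
Proof. by case: levi_civitaP => _ [_ _ _]; apply. Qed.

(** Koszul's argument: vanishing torsion ([T]) and skewness in the last two indices ([S]), taken
    over the three cyclic positions, are linear equations that determine the symbol. *)
Lemma lc_frame i j k p : g p (lc (E i) (E j) p) (E k p) = Gm i j k p.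
Proof.
pose G i j k := g p (lc (E i) (E j) p) (E k p).
have lt i' j' : tangent_at A p (lc (E i') (E j') p).
  by apply: vfield_tangent; exact: lc_vfield.
have T i' j' k' : G i' j' k' - G j' i' k' = cc i' j' k' p.
  rewrite /structure_fun -lc_torsion // -(metricBl gr) //.
have S i' j' k' : G i' j' k' + G i' k' j' = 0.
  have := @lc_metric (E i') (E j') (E k') p (Ev _) (Ev _) (Ev _).
  have -> : (fun q => g q (E j' q) (E k' q)) = (fun=> (j' == k')%:R).
    by apply/funext => q; rewrite Eo.
  by rewrite (tangent_cst (Et _ _)) (metric_sym gr (Et j' p)).
rewrite -/(G i j k) /christoffel -!T.
have := S i j k; have := S j i k; have := S k i j; lra.
Qed.

Local Notation curv := (curvature A g).

(** The linearity clause combines scaling and addition; with factor -1 and zero fields it reads lc 0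
    Y = - lc 0 Y + lc 0 Y. [linear_zero] below is the same trick. *)
Lemma lc0l Y : vf Y -> lc 0 Y = 0.
Proof.
move=> HY.
have := lc_linl (@smooth_cst _ _ _ A (-1)) (is_vfield0 A) (is_vfield0 A) HY.
have -> : scale_vf (fun=> -1) 0 + 0 = 0 :> vfield R M.
  by apply/funext => p; rewrite /= /scale_vf addr0 scaler0.
move=> ->; apply/funext => p; rewrite /scale_vf.
by change (-1 *: lc 0 Y p + lc 0 Y p = 0); rewrite scaleN1r addNr.
Qed.

Lemma lc_scalel h X Y : smooth A h -> vf X -> vf Y ->
  lc (scale_vf h X) Y = scale_vf h (lc X Y).
Proof.
move=> Hh HX HY; have := lc_linl Hh HX (is_vfield0 A) HY.
by rewrite addr0 lc0l // addr0.
Qed.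

Lemma lcNl X Y : vf X -> vf Y -> lc (- X) Y = - lc X Y.
Proof.
have sN (Z : vfield R M) : - Z = scale_vf (fun=> -1) Z.
  by apply/funext => p; rewrite /scale_vf scaleN1r.
by move=> HX HY; rewrite sN lc_scalel // -?sN //; exact: smooth_cst.
Qed.

Lemma curvature_vfield X Y Z : vf X -> vf Y -> vf Z -> vf (curv X Y Z).
Proof.
move=> HX HY HZ; have HB := is_vfield_bracket HX HY.
by do 2?apply: is_vfieldB; do ?apply: lc_vfield.
Qed.

Lemma curvatureC X Y Z : vf X -> vf Y -> vf Z -> curv Y X Z = - curv X Y Z.
Proof.
move=> HX HY HZ; have HB := is_vfield_bracket HX HY.
rewrite /curvature /= (bracketC Y X) lcNl //.
by rewrite opprK !opprB addrC addrA.
Qed.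

(** Tensoriality: the term Y(h) lc X Z from differentiating h lc X Z cancels the one from the
    bracket of h X and Y. *)
Lemma curvature_linl h X X' Y Z : smooth A h -> vf X -> vf X' -> vf Y -> vf Z ->
  curv (scale_vf h X + X') Y Z = scale_vf h (curv X Y Z) + curv X' Y Z.
Proof.
move=> Hh HX HX' HY HZ; have HhX := is_vfield_scale Hh HX.
have HB := is_vfield_bracket HX HY; have HB' := is_vfield_bracket HX' HY.
have HYh := vfield_smooth HY Hh; have HNYh := smooth_opp HYh.
have HYZ := lc_vfield HY HZ; have HXZ := lc_vfield HX HZ.
have HX'Z := lc_vfield HX' HZ.
rewrite /curvature /= (bracketDl HhX HX' HY) (bracket_scalel Hh HX HY).
rewrite !lc_linl // lc_linr //.
have -> : scale_vf h (bracket X Y) - scale_vf (Y^~ h) X + bracket X' Y =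
    scale_vf h (bracket X Y) + (scale_vf (fun q => - Y q h) X + bracket X' Y).
  apply/funext => p; rewrite /scale_vf ?(vfieldDE, vfieldNE).
  by rewrite scaleNr -addrA.
have HS : vf (scale_vf (fun q => - Y q h) X + bracket X' Y).
  by apply: is_vfieldD => //; exact: is_vfield_scale.
rewrite !lc_linl //.
apply/funext => p; apply/funext => k; rewrite /scale_vf ?(vfieldDE, vfieldNE).
by rewrite ?(tvecDE, tvecZE, tvecNE); ring.
Qed.

Lemma curvature_linr h X Y Z Z' : smooth A h -> vf X -> vf Y -> vf Z -> vf Z' ->
  curv X Y (scale_vf h Z + Z') = scale_vf h (curv X Y Z) + curv X Y Z'.
Proof.
move=> Hh HX HY HZ HZ'.
have HB := is_vfield_bracket HX HY.
have HYh := vfield_smooth HY Hh; have HXh := vfield_smooth HX Hh.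
have HYZ := lc_vfield HY HZ; have HXZ := lc_vfield HX HZ.
have HYZ' := lc_vfield HY HZ'; have HXZ' := lc_vfield HX HZ'.
rewrite /curvature /= !lc_linr // -!addrA !lc_linr //; try
  by [apply: is_vfieldD => //; exact: is_vfield_scale|exact: is_vfield_scale].
apply/funext => p; apply/funext => k; rewrite /scale_vf ?(vfieldDE, vfieldNE).
by rewrite ?(tvecDE, tvecZE, tvecNE) /bracket; ring.
Qed.

(** Because the frame is global, an operator linear over smooth functions is seen to act pointwise
    without any cut-off. *)
Lemma vfield_linear_sum (F : vfield R M -> vfield R M) :
  F 0 = 0 ->
  (forall h X X', smooth A h -> vf X -> vf X' ->
    F (scale_vf h X + X') = scale_vf h (F X) + F X') ->
  forall X p, vf X -> F X p = \sum_i fcomp X i p *: F (E i) p.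
Proof.
move=> F0 FD X p HX.
have {1}-> : X = \sum_i scale_vf (fcomp X i) (E i).
  by apply/funext => q; rewrite vfield_sumE [LHS](fcompE frE q HX).
suff H (r : seq I) : F (\sum_(i <- r) scale_vf (fcomp X i) (E i)) p =
    \sum_(i <- r) fcomp X i p *: F (E i) p by [].
elim: r => [|i r IH]; first by rewrite !big_nil F0.
have fs j := fcomp_smooth frE j HX.
rewrite !big_cons FD //; first by rewrite vfieldDE IH.
by apply: is_vfield_sum => j; exact: is_vfield_scale.
Qed.

Lemma linear_zero (F : vfield R M -> vfield R M) :
  (forall h X X', smooth A h -> vf X -> vf X' ->
    F (scale_vf h X + X') = scale_vf h (F X) + F X') -> F 0 = 0.
Proof.
move=> FD; have := FD _ 0 0 (@smooth_cst _ _ _ A (-1)) (is_vfield0 A) (is_vfield0 A).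
have -> : scale_vf (fun=> -1) 0 + 0 = 0 :> vfield R M.
  by apply/funext => p; rewrite /= /scale_vf addr0 scaler0.
move=> ->; apply/funext => p; rewrite /scale_vf.
by change (-1 *: F 0 p + F 0 p = 0); rewrite scaleN1r addNr.
Qed.

Definition riemann_comp i j k l p := g p (curv (E i) (E j) (E k) p) (E l p).
Local Notation Rm := riemann_comp.

Lemma riemann_comp_vfield X Y Z W p : vf X -> vf Y -> vf Z -> vf W ->
  g p (curv X Y Z p) (W p) = \sum_i \sum_j \sum_k \sum_l
    fcomp X i p * fcomp Y j p * fcomp Z k p * fcomp W l p * Rm i j k l p.
Proof.
move=> HX HY HZ HW; have tW := vfield_tangent p HW.
have F1 h U U' : smooth A h -> vf U -> vf U' ->
    curv (scale_vf h U + U') Y Z = scale_vf h (curv U Y Z) + curv U' Y Z.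
  by move=> *; exact: curvature_linl.
rewrite (vfield_linear_sum (linear_zero F1) F1 p HX).
rewrite (metric_suml gr) //; last first.
  by move=> i; apply: vfield_tangent; exact: curvature_vfield.
apply: eq_bigr => i _.
have F2 h U U' : smooth A h -> vf U -> vf U' ->
    curv (E i) (scale_vf h U + U') Z = scale_vf h (curv (E i) U Z) + curv (E i) U' Z.
  move=> Hh HU HU'; rewrite curvatureC //; last first.
    by apply: is_vfieldD => //; exact: is_vfield_scale.
  rewrite curvature_linl // (curvatureC (Ev i) HU) // (curvatureC (Ev i) HU') //.
  apply/funext => q; rewrite /scale_vf ?(vfieldDE, vfieldNE).
  by rewrite scalerN -opprD opprK.
rewrite (vfield_linear_sum (linear_zero F2) F2 p HY).
rewrite (metric_suml gr) //; last first.
  by move=> j; apply: vfield_tangent; exact: curvature_vfield.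
rewrite mulr_sumr; apply: eq_bigr => j _.
have F3 h U U' : smooth A h -> vf U -> vf U' ->
    curv (E i) (E j) (scale_vf h U + U') =
    scale_vf h (curv (E i) (E j) U) + curv (E i) (E j) U'.
  by move=> *; exact: curvature_linr.
rewrite (vfield_linear_sum (linear_zero F3) F3 p HZ).
have tc k : tangent_at A p (curv (E i) (E j) (E k) p).
  by apply: vfield_tangent; exact: curvature_vfield.
rewrite (metric_suml gr) // !mulr_sumr; apply: eq_bigr => k _.
rewrite {1}(fcompE frE p HW) (metric_sumr gr) // !mulr_sumr; apply: eq_bigr => l _.
by rewrite /riemann_comp; ring.
Qed.

(** Metric compatibility turns g(nabla_a nabla_b E_c, E_l) into a derivative of a Christoffel symbol
    plus a product of two; skewness in the last indices fixes the sign of the product. *)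
Lemma riemann_compE i j k l p : Rm i j k l p =
  E i p (Gm j k l) - E j p (Gm i k l)
  + \sum_m (Gm j k m p * Gm i m l p - Gm i k m p * Gm j m l p
            - cc i j m p * Gm m k l p).
Proof.
have lv a b := lc_vfield (Ev a) (Ev b).
have lcE a b q : lc (E a) (E b) q = \sum_m Gm a b m q *: E m q.
  by rewrite (fcompE frE q (lv a b)); apply: eq_bigr => m _; rewrite -lc_frame.
have second a b c : g p (lc (E a) (lc (E b) (E c)) p) (E l p) =
    E a p (Gm b c l) + \sum_m Gm b c m p * Gm a m l p.
  have := @lc_metric (E a) (lc (E b) (E c)) (E l) p (Ev a) (lv b c) (Ev l).
  have -> : (fun q => g q (lc (E b) (E c) q) (E l q)) = Gm b c l.
    by apply/funext => q; exact: lc_frame.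
  move=> ->; rewrite (metric_fcomp frE (vfield_tangent p (lv b c)) (vfield_tangent p (lv a l))).
  under eq_bigr => m _ do rewrite !lc_frame.
  rewrite -addrA -big_split /= big1 ?addr0 // => m _.
  have := christoffel_metric frE a l m p => /eqP; rewrite addr_eq0 => /eqP ->.
  ring.
have third : g p (lc (bracket (E i) (E j)) (E k) p) (E l p) =
    \sum_m cc i j m p * Gm m k l p.
  have HB := is_vfield_bracket (Ev i) (Ev j).
  have F h U U' : smooth A h -> vf U -> vf U' ->
    lc (scale_vf h U + U') (E k) = scale_vf h (lc U (E k)) + lc U' (E k).
    by move=> *; exact: lc_linl.
  rewrite (vfield_linear_sum (F := fun U => lc U (E k)) (linear_zero F) F p HB).
  rewrite (metric_suml gr) //; last by move=> m; exact: vfield_tangent.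
  by apply: eq_bigr => m _; rewrite lc_frame.
have HB := is_vfield_bracket (Ev i) (Ev j).
have t1 := vfield_tangent p (lc_vfield (Ev i) (lv j k)).
have t2 := vfield_tangent p (lc_vfield (Ev j) (lv i k)).
have t3 := vfield_tangent p (lc_vfield HB (Ev k)).
rewrite /riemann_comp /curvature /=.
rewrite (metricBl gr) //; last by apply: tangent_atD => //; exact: tangent_atN.
rewrite (metricBl gr) // !second third !sumrB; ring.
Qed.

End LeviCivita.

(** * The mutual curvature in an orthonormal frame *)

Section ThreeBlocks.
Variables (R : realType) (I : finType) (mA mB : pred I) (nu : I).
Hypothesis blocks : forall i, (mA i + mB i + (i == nu) = 1)%N.

Lemma sum_blocks (F : I -> R) :
  \sum_i F i = \sum_(i | mA i) F i + \sum_(i | mB i) F i + F nu.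
Proof.
have -> : F nu = \sum_(i | i == nu) F i by rewrite big_pred1_eq.
rewrite (bigID mA) /= -addrA; congr (_ + _).
rewrite (bigID mB) /=; congr (_ + _); apply: eq_bigl => i;
  by have := blocks i; case: (mA i) (mB i) (i == nu) => [] [] [].
Qed.

Variable G : I -> I -> I -> R.
Hypothesis Gskew : forall i j k, G i j k = - G i k j.

Lemma skew_diag i j : G i j j = 0.
Proof. by have := Gskew i j j; lra. Qed.

Let thA b := \sum_(i | mB i) G i i b.
Let thB j := \sum_(a | mA a) G a a j.

(** The summation index of the curvature formula runs here through the block of a. Up to the
    products displayed, the summand is H a b - H b a, which disappears in the double sum over a and
    b. The next lemma is the mirror image, with the index in the block of i. *)
Lemma walczak_block (P Q : pred I) :
  \sum_(a | P a) \sum_(i | Q i) \sum_(b | P b)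
    (G i i b * G a b a - G a i b * G i b a - (G a i b - G i a b) * G b i a) =
  - \sum_(b | P b) (\sum_(i | Q i) G i i b) * \sum_(a | P a) G a a b
  - \sum_(a | P a) \sum_(b | P b) \sum_(i | Q i) G a b i * G b a i.
Proof.
under eq_bigr => a _ do rewrite exchange_big /=.
have -> : \sum_(b | P b) (\sum_(i | Q i) G i i b) * \sum_(a | P a) G a a b =
    \sum_(a | P a) \sum_(b | P b) \sum_(i | Q i) G i i b * G a a b.
  rewrite [RHS]exchange_big /=; apply: eq_bigr => b _.
  rewrite mulr_suml [RHS]exchange_big /=; apply: eq_bigr => i _.
  by rewrite mulr_sumr.
pose H a b := \sum_(i | Q i) G a b i * G i b a.
have HE a b : \sum_(i | Q i)
    (G i i b * G a b a - G a i b * G i b a - (G a i b - G i a b) * G b i a) =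
    - (\sum_(i | Q i) G i i b * G a a b) - \sum_(i | Q i) G a b i * G b a i
    + (H a b - H b a).
  rewrite /H -!sumrN -!big_split /=; apply: eq_bigr => i _.
  rewrite (Gskew a b a) (Gskew a i b) (Gskew b i a); ring.
under eq_bigr => a _ do under eq_bigr => b _ do rewrite HE.
under eq_bigr => a _ do rewrite !big_split /= !sumrN.
rewrite !big_split /= !sumrN.
by rewrite [X in _ + (_ - X)]exchange_big /= subrr addr0.
Qed.

Lemma walczak_blockB (P Q : pred I) :
  \sum_(a | P a) \sum_(i | Q i) \sum_(j | Q j)
    (G i i j * G a j a - G a i j * G i j a - (G a i j - G i a j) * G j i a) =
  - \sum_(j | Q j) (\sum_(a | P a) G a a j) * \sum_(i | Q i) G i i j
  - \sum_(i | Q i) \sum_(j | Q j) \sum_(a | P a) G i j a * G j i a.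
Proof.
rewrite exchange_big /=; under eq_bigr => i _ do rewrite exchange_big /=.
have -> : \sum_(j | Q j) (\sum_(a | P a) G a a j) * \sum_(i | Q i) G i i j =
    \sum_(i | Q i) \sum_(j | Q j) \sum_(a | P a) G a a j * G i i j.
  rewrite [RHS]exchange_big /=; apply: eq_bigr => b _.
  rewrite mulr_suml [RHS]exchange_big /=; apply: eq_bigr => i _.
  by rewrite mulr_sumr.
pose H i j := \sum_(a | P a) G a i j * G i j a.
have HE i j : \sum_(a | P a)
    (G i i j * G a j a - G a i j * G i j a - (G a i j - G i a j) * G j i a) =
    - (\sum_(a | P a) G a a j * G i i j) - \sum_(a | P a) G i j a * G j i a
    + (H j i - H i j).
  rewrite /H -!sumrN -!big_split /=; apply: eq_bigr => a _.
  rewrite (Gskew a j a) (Gskew i a j) (Gskew a j i); ring.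
under eq_bigr => a _ do under eq_bigr => b _ do rewrite HE.
under eq_bigr => a _ do rewrite !big_split /= !sumrN.
rewrite !big_split /= !sumrN.
by rewrite [X in _ + (X - _)]exchange_big /= subrr addr0.
Qed.

(* The part of Walczak's formula quadratic in the connection coefficients
   [G i j k] = g(nabla_{E_i} E_j, E_k), for the blocks [mA] and [mB] of a frame
   whose only other member is [nu]; [thA] and [thB] are mean curvature forms. *)
Definition walczak_quadratic : R :=
  \sum_(b | mA b) (thA b ^+ 2 + thA b * G nu nu b)
  + \sum_(j | mB j) (thB j ^+ 2 + thB j * G nu nu j)
  - \sum_(a | mA a) \sum_(b | mA b) \sum_(i | mB i) G a b i * G b a i
  - \sum_(i | mB i) \sum_(j | mB j) \sum_(a | mA a) G i j a * G j i a
  - thA nu * thB nu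
  + \sum_(a | mA a) \sum_(i | mB i)
      (G a i nu * G i a nu - (G a i nu - G i a nu) * G nu i a).

(** Split the inner sum by the block of m. The two trace terms subtracted on the right are exactly
    what completes derivatives of mean curvatures to divergences. *)
Lemma walczak_algebra :
  \sum_(a | mA a) \sum_(i | mB i) \sum_m
    (G i i m * G a m a - G a i m * G i m a - (G a i m - G i a m) * G m i a)
  = walczak_quadratic
    - \sum_(b | mA b) thA b * (\sum_k (G b k k - G k b k))
    - \sum_(j | mB j) thB j * (\sum_k (G j k k - G k j k)).
Proof.
under eq_bigr => a _ do under eq_bigr => i _ do rewrite sum_blocks.
under eq_bigr => a _ do rewrite 2!big_split /=.
rewrite 2!big_split /= walczak_block walczak_blockB.
have tr b : \sum_k (G b k k - G k b k) =
    \sum_(a | mA a) G a a b + \sum_(i | mB i) G i i b + G nu nu b.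
  rewrite -(sum_blocks (fun k => G k k b)); apply: eq_bigr => k _.
  by rewrite skew_diag sub0r -Gskew.
have -> : \sum_(a | mA a) \sum_(i | mB i)
    (G i i nu * G a nu a - G a i nu * G i nu a - (G a i nu - G i a nu) * G nu i a) =
    - (thA nu * thB nu) + \sum_(a | mA a) \sum_(i | mB i)
      (G a i nu * G i a nu - (G a i nu - G i a nu) * G nu i a).
  have -> : thA nu * thB nu = \sum_(a | mA a) \sum_(i | mB i) G i i nu * G a a nu.
    by rewrite mulrC mulr_suml; apply: eq_bigr => a _; rewrite mulr_sumr;
      apply: eq_bigr => i _; rewrite mulrC.
  rewrite -sumrN -big_split /=; apply: eq_bigr => a _.
  rewrite -sumrN -big_split /=; apply: eq_bigr => i _.
  rewrite (Gskew a nu a) (Gskew i nu a); ring.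
under [X in _ = _ - X - _]eq_bigr => b _ do rewrite tr.
under [X in _ = _ - _ - X]eq_bigr => b _ do rewrite tr.
rewrite /walczak_quadratic.
under [X in _ = _ - X - _]eq_bigr => b _ do rewrite !mulrDr.
under [X in _ = _ - _ - X]eq_bigr => b _ do rewrite !mulrDr.
under [X in _ = X + _ - _ - _ - _ + _ - _ - _]eq_bigr => b _ do rewrite expr2.
under [X in _ = _ + X - _ - _ - _ + _ - _ - _]eq_bigr => b _ do rewrite expr2.
by rewrite !big_split /= /thA /thB; ring.
Qed.

End ThreeBlocks.

Section MutualCurvature.
Variables (R : realType) (N : nat) (M : ptopologicalType) (A : manifold R N M).
Variables (I : finType) (g : metric R M) (E : I -> vfield R M).
Hypothesis frE : orthoframe A g E.

Let gr : riemannian_metric A g. Proof. by case: frE. Qed.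
Let Ev i : is_vfield A (E i). Proof. by case: frE. Qed.
Let Eo p i j : g p (E i p) (E j p) = (i == j)%:R. Proof. by case: frE. Qed.
Let Et i p : tangent_at A p (E i p). Proof. exact: vfield_tangent. Qed.
Local Notation cc := (structure_fun g E).
Local Notation Gm := (christoffel g E).
Local Notation fcomp := (fcomp g E).
Local Notation Rm := (riemann_comp A g E).

(** The span of the selected frame fields, given by the vanishing of the other components so that
    membership is tested by inner products. *)
Definition block (m : pred I) : tdistribution R M := fun q =>
  [set v | tangent_at A q v /\ forall i, ~~ m i -> g q v (E i q) = 0].

Lemma block_spanned (m : pred I) q :
  block m q = spanned (fun a : 'I_#|m| => E (enum_val a)) q.
Proof.
apply/seteqP; split => [v [tv v0]|v [a ->]].
  exists (fun a => g q v (E (enum_val a) q)).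
  case: frE => _ _ _ Es; rewrite {1}(Es q v tv) (bigID m) /=.
  rewrite [X in _ + X]big1 ?addr0; last by move=> i mi; rewrite v0 // scale0r.
  by rewrite -(big_enum_val (fun i => g q v (E i q) *: E i q)).
split; first by apply: tangent_at_sum => i; apply: tangent_atZ; exact: Et.
move=> i mi; rewrite (metric_suml gr) // big1 // => b _.
rewrite Eo; case: eqP => [bi|]; last by rewrite mulr0.
by move: mi; rewrite -bi -[m _]/(_ \in m) enum_valP.
Qed.

Lemma block_frame (m : pred I) : local_orthonormal_frame A g (block m) setT
  (fun a : 'I_#|m| => E (enum_val a)).
Proof.
split=> [a|q _]; first exact: Ev.
by split=> [a b|]; [rewrite Eo (inj_eq enum_val_inj)|exact: block_spanned].
Qed.

(** The sum over a of F_a tensor F_a is the orthogonal projector onto the block whatever the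
    orthonormal frame. This makes the mutual curvature independent of frames. *)
Lemma frame_gram (m : pred I) k U (F : 'I_k -> vfield R M) p i l :
  local_orthonormal_frame A g (block m) U F -> U p ->
  \sum_a fcomp (F a) i p * fcomp (F a) l p = (m i && (i == l))%:R.
Proof.
move=> [Fv HF] Up; have [Fo Fs] := HF p Up.
have Ft a := vfield_tangent p (Fv a).
have [mi|mi] := boolP (m i) => /=; last first.
  apply: big1 => a _.
  have : block m p (F a p).
    rewrite Fs; exists (fun b => (b == a)%:R).
    by rewrite (bigD1 a) //= eqxx scale1r big1 ?addr0 // => b /negbTE ->; rewrite scale0r.
  move=> [_ /(_ i mi) Fi0].
  by have -> : fcomp (F a) i p = 0 by []; rewrite mul0r.
have : block m p (E i p).
  split; first exact: Et.
  by move=> j mj; rewrite Eo; case: eqP => // ij; move: mj; rewrite -ij mi.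
rewrite Fs => -[x xE].
have xa a : x a = g p (E i p) (F a p).
  rewrite xE (metric_suml gr) // (bigD1 a) //= Fo eqxx mulr1 big1 ?addr0 //.
  by move=> b ba; rewrite Fo (negbTE ba) mulr0.
rewrite -(Eo p i l) [in RHS]xE (metric_suml gr) //; apply: eq_bigr => a _.
by rewrite xa (metric_sym gr (Et i p) (Ft a)).
Qed.

(** Expanding the curvature multilinearly in the global frame leaves the frames F1, F2 only in the
    two projectors of [frame_gram]. So every admissible value equals the right-hand side, and the
    global frame shows that one exists. *)
Lemma mutual_curvatureE (mA mB : pred I) p :
  mutual_curvature A g (block mA) (block mB) p =
  \sum_(i | mA i) \sum_(j | mB j) Rm i j j i p.
Proof.
rewrite /mutual_curvature; set P := [set s | _].
have HP s : P s -> s = \sum_(i | mA i) \sum_(j | mB j) Rm i j j i p.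
  move=> [k [l [U [F1 [F2 [Up HF1 HF2 ->]]]]]].
  have Up' : U p by case: Up.
  have v1 a := HF1.1 a; have v2 a := HF2.1 a.
  under eq_bigr => a _ do under eq_bigr => b _ do
    rewrite (riemann_comp_vfield frE p (v1 a) (v2 b) (v2 b) (v1 a)).
  rewrite pair_big /=; under eq_bigr => ab _ do rewrite pair_big /=.
  under eq_bigr => ab _ do under eq_bigr => ij _ do rewrite pair_big /=.
  rewrite exchange_big /=; under eq_bigr => ij _ do rewrite exchange_big /=.
  have -> : \sum_(i | mA i) \sum_(j | mB j) Rm i j j i p =
      \sum_(ij : I * I) \sum_(kl : I * I)
        (mA ij.1 && (ij.1 == kl.2))%:R * (mB ij.2 && (ij.2 == kl.1))%:R
        * Rm ij.1 ij.2 kl.1 kl.2 p.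
    rewrite pair_big_dep /= big_mkcond /=; apply: eq_bigr => -[i j] _ /=.
    rewrite (bigD1 (j, i)) //= !eqxx !andbT big1 ?addr0.
      by case: (mA i) (mB j) => [] []; rewrite /= ?mul0r ?mulr0 ?mul0r ?mul1r ?mul1r.
    move=> [k' l'] /=; rewrite xpair_eqE; case: (eqVneq i l') => [->|_ _].
      by rewrite andbT eq_sym => /negbTE ->; rewrite !andbF mulr0 mul0r.
    by rewrite andbF mul0r mul0r.
  apply: eq_bigr => -[i j] _; apply: eq_bigr => -[i' j'] _ /=.
  rewrite -(frame_gram i j' HF1 Up') -(frame_gram j i' HF2 Up').
  rewrite mulr_suml mulr_suml -(pair_big xpredT xpredT (fun a b =>
    fcomp (F1 a) i p * fcomp (F2 b) j p * fcomp (F2 b) i' p * fcomp (F1 a) j' p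
    * Rm i j i' j' p)) /=.
  apply: eq_bigr => a _; rewrite mulr_sumr mulr_suml; apply: eq_bigr => b _.
  ring.
apply: HP; apply: (@getPex _ P).
exists (\sum_(a : 'I_#|mA|) \sum_(i : 'I_#|mB|)
  g p (curvature A g (E (enum_val a)) (E (enum_val i)) (E (enum_val i)) p)
    (E (enum_val a) p)).
exists #|mA|, #|mB|, setT, (fun a => E (enum_val a)), (fun a => E (enum_val a)).
split => //; [exact: open_nbhsT|exact: block_frame|exact: block_frame].
Qed.

(* The divergence of the vector field [phi E_i]. *)
Definition frame_div (phi : M -> R) i p := E i p phi - phi p * \sum_k cc i k k p.

(** Walczak's formula. By skewness the derivative terms of the curvature are E_a and E_i applied to
    the mean curvatures of the opposite block, and the traces from [walczak_algebra] complete them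
    to divergences. *)
Lemma mutual_curvature_walczak (mA mB : pred I) nu p :
  (forall i, (mA i + mB i + (i == nu) = 1)%N) ->
  mutual_curvature A g (block mA) (block mB) p =
    \sum_(b | mA b) frame_div (fun q => \sum_(i | mB i) Gm i i b q) b p
    + \sum_(j | mB j) frame_div (fun q => \sum_(a | mA a) Gm a a j q) j p
    + walczak_quadratic mA mB nu (fun i j k => Gm i j k p).
Proof.
move=> blocks; rewrite mutual_curvatureE.
have skew q i j k : Gm i j k q = - Gm i k j q.
  by apply/eqP; rewrite -addr_eq0 (christoffel_metric frE).
have ccE i j k : cc i j k p = Gm i j k p - Gm j i k p.
  by rewrite (christoffel_torsion frE).
under eq_bigr => i _ do under eq_bigr => j _ do rewrite (riemann_compE frE).
under eq_bigr => a _ do under eq_bigr => i _ do under [X in _ + X]eq_bigr => m _ do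
  rewrite ccE.
under eq_bigr => a _ do rewrite big_split /=.
rewrite big_split /= (walczak_algebra blocks (skew p)).
have sG i j k := christoffel_smooth frE i j k.
have -> : \sum_(a | mA a) \sum_(i | mB i) (E a p (Gm i i a) - E i p (Gm a i a)) =
    \sum_(a | mA a) E a p (fun q => \sum_(i | mB i) Gm i i a q) +
    \sum_(i | mB i) E i p (fun q => \sum_(a | mA a) Gm a a i q).
  under eq_bigr => a _ do rewrite sumrB.
  rewrite sumrB; congr (_ + _).
    by apply: eq_bigr => a _; rewrite (tangent_sum (Et a p)).
  rewrite exchange_big /= -sumrN; apply: eq_bigr => i _.
  rewrite (tangent_sum (Et i p)) // -sumrN; apply: eq_bigr => a _.
  have -> : Gm a i a = fun q => - Gm a a i q by apply/funext => q; rewrite skew.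
  by rewrite (tangentN (Et i p)) // opprK.
rewrite /frame_div !sumrB.
under [X in _ = _ - X + _ + _]eq_bigr => b _ do under [X in _ * X]eq_bigr => k _ do rewrite ccE.
under [X in _ = _ + (_ - X) + _]eq_bigr => b _ do under [X in _ * X]eq_bigr => k _ do rewrite ccE.
ring.
Qed.

End MutualCurvature.

(** * Lebesgue measure on R^N *)

Section BorelSpace.
Variables (R : realType) (T : ptopologicalType).

Lemma open_borel (U : set (borel T)) : open (U : set T) -> measurable U.
Proof. by move=> oU; exact: sub_sigma_algebra. Qed.

Lemma continuous_on_borel (V : set (borel T)) (f : borel T -> R) :
  open (V : set T) -> (forall x : T, V x -> {for x, continuous (f : T -> R)}) ->
  measurable_fun V f.
Proof.
move=> oV cf; apply: (measurability _ (RGenOpens.measurableE R)).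
move=> _ [_ [a [b ->] <-]]; apply: open_borel.
rewrite openE => x [Vx fx]; apply: filterI.
  exact: open_nbhs_nbhs (conj oV Vx).
by apply: (cf x Vx); apply: open_nbhs_nbhs; split => //; exact: interval_open.
Qed.

Lemma continuous_borel (f : borel T -> R) : continuous (f : T -> R) ->
  measurable_fun setT f.
Proof. by move=> cf; apply: (@continuous_on_borel setT f (@openT T)) => x _; exact: cf. Qed.

End BorelSpace.

Section RowSpace.
Variables (R : realType) (N : nat).

(** The radius 1/(k+1) is taken below r/2, and the rational centre within that radius of x, so the
    box contains x and stays in the r-box around x. *)
Lemma open_rational_boxes (U : set 'rV[R]_N) : open U ->
  U = \bigcup_(qk in [set qk : 'rV[rat]_N * nat |
        box (map_mx ratr qk.1 : 'rV[R]_N) (qk.2.+1%:R^-1) `<=` U])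
      box (map_mx ratr qk.1 : 'rV[R]_N) (qk.2.+1%:R^-1).
Proof.
move=> oU; apply/seteqP; split => [x Ux|x [qk /= bU]]; last exact: bU.
have [r r0 bU] := nbhs_sub_box (open_nbhs_nbhs (conj oU Ux)).
have [k kr] : exists k : nat, (k.+1%:R^-1 : R) < r / 2.
  have [k H] := @ltr_add_invr R 0 (r / 2) (divr_gt0 r0 (ltr0Sn _ 1)).
  by exists k; rewrite add0r in H.
have k0 : 0 < (k.+1%:R^-1 : R) by rewrite invr_gt0.
have [e eE] : {e : R | e = k.+1%:R^-1} by exists (k.+1%:R^-1).
rewrite -eE in kr k0.
have Q j : {q : rat | `|x ord0 j - ratr q| <= e}.
  apply: cid; have H : x ord0 j - e < x ord0 j by rewrite ltrBlDr ltrDl.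
  have [q] := rat_in_itvoo H; rewrite in_itv /= => /andP[q1 q2].
  by exists q; rewrite ler_norml; apply/andP; split; lra.
pose q : 'rV[rat]_N := \row_j sval (Q j).
have xq : box (map_mx ratr q : 'rV[R]_N) e x.
  by move=> j; rewrite !mxE; exact: (svalP (Q j)).
exists (q, k); rewrite /= -eE // => y yq; apply: bU => j.
have := xq j; have := yq j; rewrite !ler_norml => /andP[? ?] /andP[? ?].
by apply/andP; split; lra.
Qed.

Lemma countable_rational_boxes : countable [set: 'rV[rat]_N * nat].
Proof. exact: countableP. Qed.

(** Open sets are countable unions of rational boxes, and the preimage of a box is a finite
    intersection of preimages of intervals under the coordinates. *)
Lemma measurable_fun_row d (T : measurableType d) (f : T -> borel 'rV[R]_N) :
  (forall j, measurable_fun setT (fun t => (f t : 'rV[R]_N) ord0 j : R)) ->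
  measurable_fun setT f.
Proof.
move=> mf; apply: (@measurability _ _ _ _ _ _
  (@open 'rV[R]_N : set (set (borel 'rV[R]_N))) erefl).
move=> _ [U oU <-]; rewrite setTI.
have -> : f @^-1` U = \bigcup_(qk : 'rV[rat]_N * nat)
    [set t | box (map_mx ratr qk.1 : 'rV[R]_N) (qk.2.+1%:R^-1) `<=` U /\
             box (map_mx ratr qk.1 : 'rV[R]_N) (qk.2.+1%:R^-1) (f t)].
  rewrite {1}(open_rational_boxes oU); apply/seteqP; split => [t [qk bU bx]|t [qk _ [bU bx]]].
    by exists qk.
  by exists qk.
apply: (countable_bigcupT_measurable countable_rational_boxes) => -[q k] /=.
have [bU|nbU] := pselect (box (map_mx ratr q : 'rV[R]_N) (k.+1%:R^-1) `<=` U); last first.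
  by rewrite (_ : [set _ | _] = set0) //; apply/seteqP; split => // t [].
have -> : [set t | box (map_mx ratr q : 'rV[R]_N) (k.+1%:R^-1) `<=` U /\
     box (map_mx ratr q : 'rV[R]_N) (k.+1%:R^-1) (f t)] =
   \big[setI/setT]_(j <- enum 'I_N)
     ((fun t => (f t : 'rV[R]_N) ord0 j : R) @^-1`
       [set` `[ratr (q ord0 j) - k.+1%:R^-1, ratr (q ord0 j) + k.+1%:R^-1]]).
  apply/seteqP; split=> [t [_ bx]|t].
    rewrite -bigcap_seq => j _ /=; have := bx j; rewrite in_itv /= ler_distl mxE.
    by [].
  rewrite -bigcap_seq => H; split=> // j; have := H j (mem_enum _ j).
  by rewrite /= in_itv /= ler_distl mxE.
apply: bigsetI_measurable => j _; rewrite -[X in measurable X]setTI.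
by apply: mf => //; exact: measurable_itv.
Qed.

Lemma measurable_coord (j : 'I_N) :
  measurable_fun setT (fun x : borel 'rV[R]_N => (x : 'rV[R]_N) ord0 j : R).
Proof. apply: continuous_borel => x; exact: coord_continuous. Qed.

End RowSpace.

Section LebesgueRow.
Variable R : realType.

Definition row_cons (N : nat) (z : R * 'rV[R]_N) : 'rV[R]_N.+1 :=
  row_mx (const_mx z.1 : 'rV_1) z.2.

Lemma row_cons0 N (z : R * 'rV[R]_N) : row_cons z ord0 ord0 = z.1.
Proof.
rewrite /row_cons; have -> : ord0 = lshift N (ord0 : 'I_1) :> 'I_(1 + N) by exact: val_inj.
transitivity ((const_mx z.1 : 'rV[R]_1) ord0 ord0); last by rewrite mxE.
exact: (row_mxEl (const_mx z.1 : 'rV[R]_1) z.2 ord0 ord0).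
Qed.

Lemma row_consS N (z : R * 'rV[R]_N) j : row_cons z ord0 (lift ord0 j) = z.2 ord0 j.
Proof.
rewrite /row_cons; have -> : lift ord0 j = rshift 1 j :> 'I_(1 + N) by exact: val_inj.
exact: (row_mxEr (const_mx z.1 : 'rV[R]_1) z.2 ord0 j).
Qed.

Lemma measurable_row_cons N :
  measurable_fun setT (@row_cons N : measurableTypeR R * borel 'rV[R]_N -> borel 'rV[R]_N.+1).
Proof.
apply: measurable_fun_row => j; case: (unliftP ord0 j) => [i ->|->].
  rewrite (_ : (fun t => _) = (fun x : borel 'rV[R]_N => (x : 'rV[R]_N) ord0 i : R) \o snd).
    by apply: measurableT_comp; [exact: measurable_coord|exact: measurable_snd].
  by apply/funext => z /=; rewrite row_consS.
rewrite (_ : (fun t => _) = fst); first exact: measurable_fst.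
by apply/funext => z /=; rewrite row_cons0.
Qed.

(** Tonelli's theorem asks for the bundled structure rather than the predicate. *)
Lemma sigma_finite_pack d (T : measurableType d) (m : {measure set T -> \bar R}) :
  sigma_finite setT m ->
  exists m' : {sigma_finite_measure set T -> \bar R}, forall B, m' B = m B.
Proof.
move=> sf.
pose H1 := isSigmaFinite.Build _ _ _ (Measure.sort m) sf.
pose H2 := isSFinite.Build _ _ _ (Measure.sort m) (sfinite_measure_sigma_finite sf).
pose m' := HB.pack_for (SigmaFiniteMeasure.type T R) (Measure.sort m) H1 H2.
by exists m'.
Qed.

Lemma measurable_box N (x0 : 'rV[R]_N) r : measurable (box x0 r : set (borel 'rV[R]_N)).
Proof.
have -> : box x0 r = \big[setI/setT]_(j <- enum 'I_N)
     ((fun t : borel 'rV[R]_N => (t : 'rV[R]_N) ord0 j : R) @^-1`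
       [set` `[x0 ord0 j - r, x0 ord0 j + r]]).
  apply/seteqP; split=> [t bx|t].
    by rewrite -bigcap_seq => j _ /=; have := bx j; rewrite in_itv /= ler_distl.
  rewrite -bigcap_seq => H j; have := H j (mem_enum _ j).
  by rewrite /= in_itv /= ler_distl.
apply: bigsetI_measurable => j _; rewrite -[X in measurable X]setTI.
by apply: measurable_coord => //; exact: measurable_itv.
Qed.

Lemma sigma_finite_boxes N (m : set (borel 'rV[R]_N) -> \bar R) :
  (forall r, (m (box 0%R r) < +oo)%E) -> sigma_finite setT m.
Proof.
move=> mb; exists (fun k => box (0 : 'rV[R]_N) k%:R : set (borel 'rV[R]_N)).
  apply/seteqP; split=> // x _.
  pose t := \sum_j `|(x : 'rV[R]_N) ord0 j|.
  have [k tk] : exists k : nat, t <= k%:R.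
    by exists (Num.truncn t).+1; rewrite ltW // truncnS_gt.
  exists k => //= j; rewrite mxE subr0 (le_trans _ tk) // /t (bigD1 j) //=.
  by rewrite lerDl sumr_ge0.
by move=> k; split; [exact: measurable_box|exact: mb].
Qed.

(** The iterated integral comes from a measure: a point mass for N = 0, then the image under
    [row_cons] of the product with one-dimensional Lebesgue measure, and Tonelli identifies the
    integrals. Finiteness on boxes is part of the induction because it yields the sigma-finiteness
    that Tonelli needs. *)
Theorem lebesgue_row_exists N :
  exists m : {sigma_finite_measure set (borel 'rV[R]_N) -> \bar R},
  (forall h : borel 'rV[R]_N -> \bar R, measurable_fun setT h ->
     (forall x, (0 <= h x)%E) -> (\int[m]_x h x = lebesgue_int h)%E) /\
  forall r, (m (box 0 r) < +oo)%E.
Proof.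
elim: N => [|N [m [mE mb]]].
  pose d0 := @dirac _ (borel 'rV[R]_0) 0 R.
  have db r : (d0 (box 0 r) < +oo)%E by rewrite (le_lt_trans (probability_le1 _ _)) ?ltry //;
    exact: measurable_box.
  have [m' Hm'] := @sigma_finite_pack _ _ d0 (sigma_finite_boxes db).
  exists m'; split=> [h mh h0|r]; last by rewrite Hm'.
  have -> : (\int[m']_x h x = \int[d0]_x h x)%E.
    by apply: eq_measure_integral => B _ _; exact: Hm'.
  by rewrite integral_dirac //= diracT mul1e.
pose phi : measurableTypeR R * borel 'rV[R]_N -> borel 'rV[R]_N.+1 := @row_cons N.
have mphi : measurable_fun setT phi by exact: measurable_row_cons.
pose m2 : {measure set (measurableTypeR R * borel 'rV[R]_N) -> \bar R} :=
  (@lebesgue_measure R \x m)%E.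
pose pm0 : {measure set (borel 'rV[R]_N.+1) -> \bar R} := pushforward m2 phi.
pose pm := pm0 mphi.
have pb r : (pm (box 0%R r) < +oo)%E.
  rewrite /pm /pm0 /= /pushforward.
  have -> : phi @^-1` box 0 r = [set` `[- r, r]] `*` box 0 r.
    apply/seteqP; split=> [[x v] H|[x v] [/= xr H] j].
      have {}H j : `|row_cons (x, v) ord0 j| <= r.
        by have := H j; rewrite [X in _ - X]mxE subr0.
      split; first by have := H ord0; rewrite row_cons0 /= in_itv /= ler_norml.
      by move=> j; have := H (lift ord0 j); rewrite row_consS /= mxE subr0.
    rewrite [X in _ - X]mxE subr0 /phi; case: (unliftP ord0 j) => [i ->|->].
      by rewrite row_consS; have := H i; rewrite [X in _ - X]mxE subr0.
    by rewrite row_cons0 /= ler_norml; rewrite in_itv /= in xr.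
  rewrite [m2 _]product_measure1E //; last exact: measurable_box.
  have LI : (lebesgue_measure ([set` `[(- r)%R, r]] : set R) < +oo)%E.
    by rewrite lebesgue_measure_itv /=; case: ifP; rewrite ?ltry.
  apply: lte_mul_pinfty => //.
  by rewrite ge0_fin_numE.
have [m' Hm'] := @sigma_finite_pack _ _ pm (sigma_finite_boxes pb).
exists m'; split=> [h mh h0|r]; last by rewrite Hm'.
have -> : (\int[m']_x h x = \int[pm]_x h x)%E.
  by apply: eq_measure_integral => B _ _; exact: Hm'.
rewrite /pm /pm0 (ge0_integral_pushforward mphi) //.
have mhp : measurable_fun setT (h \o phi) by exact: measurableT_comp.
rewrite preimage_setT /m2 fubini_tonelli1 //=.
apply: eq_integral => x _; rewrite /fubini_F.
rewrite (mE (fun v => h (phi (x, v)))) //.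
exact: measurable_fun_pair2 mhp.
Qed.

Definition lebesgue_row N : {sigma_finite_measure set (borel 'rV[R]_N) -> \bar R} :=
  projT1 (cid (lebesgue_row_exists N)).

Lemma lebesgue_rowE N (h : borel 'rV[R]_N -> \bar R) : measurable_fun setT h ->
  (forall x, (0 <= h x)%E) -> (\int[lebesgue_row N]_x h x = lebesgue_int h)%E.
Proof. by rewrite /lebesgue_row; case: cid => m [/= + _]; apply. Qed.

Lemma lebesgue_row_box N r : (lebesgue_row N (box 0 r) < +oo)%E.
Proof. by rewrite /lebesgue_row; case: cid => m [/= _ +]; apply. Qed.

(** The image of Lebesgue measure under the translation agrees with it on half-open intervals, hence
    everywhere. *)
Lemma lebesgue_translation (a : R) (f : R -> \bar R) : measurable_fun setT f ->
  (forall x, (0 <= f x)%E) ->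
  (\int[@lebesgue_measure R]_x f (x + a)%R = \int[@lebesgue_measure R]_x f x)%E.
Proof.
move=> mf f0.
pose phi : measurableTypeR R -> measurableTypeR R := fun x => x + a.
have mphi : measurable_fun setT phi by apply: measurable_funD.
pose pm0 : {measure set (measurableTypeR R) -> \bar R} :=
  pushforward (@lebesgue_measure R) phi.
pose pm := pm0 mphi.
have E B : measurable B -> lebesgue_measure B = pm B.
  apply: lebesgue_measure_unique => X [[x y] _ <-] /=.
  rewrite /pm /pm0 /= /pushforward.
  have -> : phi @^-1` [set` `]x, y]] = [set` `]x - a, y - a]].
    by apply/seteqP; split=> z /=; rewrite !in_itv /= ltrBlDr lerBrDr.
  rewrite !lebesgue_measure_itv /= !lte_fin ltrD2r; case: ifP => // _.
  by rewrite -!EFinB; congr (_%:E); ring.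
transitivity (\int[pm]_x f x)%E; last first.
  by apply: eq_measure_integral => B mB _; rewrite -(E B mB).
by rewrite /pm /pm0 (ge0_integral_pushforward mphi).
Qed.

Lemma lebesgue_row_translation N (a : 'rV[R]_N) (h : borel 'rV[R]_N -> \bar R) :
  measurable_fun setT h -> (forall x, (0 <= h x)%E) ->
  (\int[lebesgue_row N]_x h ((x : 'rV[R]_N) + a)%R = \int[lebesgue_row N]_x h x)%E.
Proof.
have shift_m K (b : 'rV[R]_K) : measurable_fun setT
    ((fun x => x + b) : borel 'rV[R]_K -> borel 'rV[R]_K).
  apply: measurable_fun_row => j.
  rewrite (_ : (fun t => _) = (fun t : borel 'rV[R]_K => (t : 'rV[R]_K) ord0 j + b ord0 j)).
    by apply: measurable_funD => //; exact: measurable_coord.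
  by apply/funext => t; rewrite mxE.
move=> mh h0; rewrite !lebesgue_rowE //; last first.
  by apply: (measurableT_comp mh); exact: shift_m.
elim: N a h mh h0 => [|N IH] a h mh h0.
  by rewrite /=; congr h; apply/rowP => -[].
pose a1 : 'rV[R]_N := \row_j a ord0 (lift ord0 j).
have row_add x v : (row_cons (x, v) + a)%R = row_cons ((x + a ord0 ord0)%R, (v + a1)%R).
  apply/rowP => j; rewrite mxE; case: (unliftP ord0 j) => [i ->|->].
    by rewrite !row_consS /= !mxE.
  by rewrite !row_cons0.
have ms x : measurable_fun setT (fun v : borel 'rV[R]_N => h (row_cons (x, v))).
  apply: (@measurable_fun_pair2 _ _ _ _ _ _ (h \o (@row_cons N
    : measurableTypeR R * borel 'rV[R]_N -> borel 'rV[R]_N.+1)) x).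
  by apply: measurableT_comp => //; exact: measurable_row_cons.
pose F x := lebesgue_int (fun v : 'rV[R]_N => h (row_cons (x, v))).
transitivity (\int[@lebesgue_measure R]_x F (x + a ord0 ord0)%R)%E.
  apply: eq_integral => x _; rewrite /F.
  rewrite -(IH a1 (fun v => h (row_cons ((x + a ord0 ord0)%R, v)))) //.
  congr lebesgue_int; apply/funext => v; congr h; exact: row_add.
apply: lebesgue_translation.
  have mh' : measurable_fun setT (h \o (@row_cons N
      : measurableTypeR R * borel 'rV[R]_N -> borel 'rV[R]_N.+1)).
    by apply: measurableT_comp => //; exact: measurable_row_cons.
  have := @measurable_fun_fubini_tonelli_F _ _ _ _ _ (lebesgue_row N) _ mh' (fun z => h0 _).
  by apply: eq_measurable_fun => x _; exact: (lebesgue_rowE (ms x) (fun v => h0 _)).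
by move=> x; rewrite /F -(lebesgue_rowE (ms x)) //; exact: integral_ge0.
Qed.

End LebesgueRow.

(** * The Riemannian volume *)

Section DensityTransfer.
Local Open Scope ereal_scope.
Context d d' (T : measurableType d) (T' : measurableType d') (R : realType).
Variables (mu : {measure set T -> \bar R}) (lam : {measure set T' -> \bar R}).
Variables (D : set T) (V : set T') (P : T' -> T) (w : T' -> R).
Hypotheses (mD : measurable D) (mV : measurable V) (mP : measurable_fun V P).
Hypotheses (mw : measurable_fun V w) (w0 : forall x, V x -> (0 <= w x)%R).
Hypothesis VD : forall x, V x -> D (P x).
Hypothesis muE : forall B, measurable B -> B `<=` D ->
  mu B = \int[lam]_(x in V) (\1_B (P x) * w x)%:E.

Import HBNNSimple.

Lemma measurable_comp_on d2 (T2 : measurableType d2) (f : T -> T2) :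
  measurable_fun D f -> measurable_fun V (f \o P).
Proof. by move=> mf; apply: (measurable_comp mD) => // _ [x Vx <-]; exact: VD. Qed.

(** The hypothesis on sets is the case of indicators; simple functions follow by linearity and the
    rest by monotone convergence. *)
Lemma ge0_density_transfer (f : T -> \bar R) : measurable_fun D f ->
  (forall x, D x -> 0 <= f x) ->
  \int[mu]_(x in D) f x = \int[lam]_(x in V) (f (P x) * (w x)%:E).
Proof.
move=> mf f0; pose f_ := nnsfun_approx mD mf.
have mfP n : measurable_fun V (fun x => f_ n (P x) * w x)%R.
  apply: measurable_funM => //; apply: (@measurable_comp_on _ _ (f_ n)).
  exact: measurable_funTS.
transitivity (limn (fun n => \int[mu]_(x in D) (f_ n x)%:E)).
  rewrite -monotone_convergence//.
  - apply: eq_integral => y /[!inE] yD; apply/esym/cvg_lim => //.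
    by apply: cvg_nnsfun_approx.
  - by move=> n; apply/measurable_EFinP; exact: measurable_funTS.
  - by move=> n y _; rewrite lee_fin.
  - by move=> y _ m n mn; rewrite lee_fin; exact/lefP/nd_nnsfun_approx.
have -> : \int[lam]_(x in V) (f (P x) * (w x)%:E) =
    limn (fun n => \int[lam]_(x in V) (f_ n (P x) * w x)%:E).
  rewrite -monotone_convergence//.
  - apply: eq_integral => y /[!inE] yV; apply/esym/cvg_lim => //.
    under eq_fun do rewrite EFinM.
    apply: cvgeZr => //; apply: cvg_nnsfun_approx => //; exact: VD.
  - by move=> n; exact/measurable_EFinP.
  - by move=> n y Vy; rewrite lee_fin mulr_ge0 // w0.
  - move=> y Vy m n mn; rewrite lee_fin ler_wpM2r ?w0 //.
    exact/lefP/nd_nnsfun_approx.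
congr (limn _); apply/funext => n.
have mpre k : measurable (f_ n @^-1` [set k]) by [].
have mk k : measurable_fun V (fun x => k * (\1_(f_ n @^-1` [set k]) (P x) * w x))%R.
  apply: measurable_funM => //; apply: measurable_funM => //.
  by apply: (@measurable_comp_on _ _ (\1_(f_ n @^-1` [set k]) : T -> R)).
transitivity (\sum_(k \in range (f_ n))
    \int[lam]_(x in V) (k * (\1_(f_ n @^-1` [set k]) (P x) * w x))%:E).
  under eq_integral do rewrite fimfunE -fsumEFin//.
  rewrite ge0_integral_fsum//; last 2 first.
  - by move=> y; exact/measurable_EFinP/measurable_funM.
  - by move=> y x _; rewrite nnfun_muleindic_ge0.
  apply: eq_fsbigr => r _.
  rewrite integralZl_indic_nnsfun// integral_indic//=.
  rewrite muE; [|exact: measurableI|by move=> x []].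
  have [r0|r0] := leP 0%R r; last first.
    rewrite preimage_nnfun0 // set0I.
    rewrite integral0_eq ?mule0; last by move=> x _; rewrite indicE in_set0 mul0r.
    by rewrite integral0_eq // => x _; rewrite indicE in_set0 mul0r mulr0.
  under [RHS]eq_integral do rewrite EFinM.
  rewrite ge0_integralZl_EFin //; last 2 first.
  - move=> x Vx; rewrite lee_fin mulr_ge0 ?w0 // indicE; case: (_ \in _) => //=.
  - apply/measurable_EFinP; apply: measurable_funM => //.
    by apply: (@measurable_comp_on _ _ (\1_(f_ n @^-1` [set r]) : T -> R)).
  congr (_ * _); apply: eq_integral => x /[!inE] Vx; congr ((_ * _)%:E).
  rewrite !indicE in_setI; have -> : P x \in D by rewrite inE; exact: VD.
  by rewrite andbT.
rewrite -ge0_integral_fsum//.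
- apply: eq_integral => x _; rewrite fsumEFin// fimfunE.
  by rewrite mulr_fsuml; congr (_%:E); apply: eq_fsbigr => k _; rewrite mulrA.
- by move=> k; exact/measurable_EFinP.
- move=> k x Vx; rewrite lee_fin mulrA mulr_ge0 ?w0 //.
  by have := nnfun_muleindic_ge0 (f_ n) k (P x); rewrite -EFinM lee_fin.
Qed.

Lemma density_transfer (f : T -> R) : measurable_fun D f ->
  \int[mu]_(x in D) (f x)%:E = \int[lam]_(x in V) (f (P x) * w x)%:E.
Proof.
move=> mf; have mf' : measurable_fun D (EFin \o f) by exact/measurable_EFinP.
rewrite integralE [RHS]integralE.
have mfpos := measurable_funepos mf'; have mfneg := measurable_funeneg mf'.
rewrite !ge0_density_transfer //.
congr (_ - _); apply: eq_integral => x /[!inE] Vx;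
  rewrite ?funeposE ?funenegE /= -?EFinN -!EFin_max -EFinM; congr EFin.
- by rewrite maxr_pMl ?w0 // mul0r.
- by rewrite -mulNr maxr_pMl ?w0 // mul0r.
Qed.

End DensityTransfer.

Section Volume.
Variables (R : realType) (N : nat) (M : ptopologicalType) (A : manifold R N M).
Local Notation cdom c := (coord A c @` dom A c).

Definition chart_density (g : metric R M) (c : chart A) (x : 'rV[R]_N) : R :=
  Num.sqrt (\det (\matrix_(i, j)
    g (param A c x) (coord_vec c i (param A c x)) (coord_vec c j (param A c x)))).

Lemma smooth_det (b : 'I_N -> 'I_N -> M -> R) : (forall i j, smooth A (b i j)) ->
  smooth A (fun p => \det (\matrix_(i, j) b i j p)).
Proof.
move=> Hb; apply: (@eq_smooth _ _ _ _ (fun p => \sum_(s : 'S_N) (-1) ^+ s *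
   \prod_i b i (s i) p)).
  move=> p; apply: eq_bigr => s _; congr (_ * _).
  by apply: eq_bigr => i _; rewrite mxE.
apply: smooth_sum => s; apply: smooth_mul; first exact: smooth_cst.
exact: smooth_prod.
Qed.

Variables (g : metric R M) (E : 'I_N -> vfield R M).
Hypothesis frE : orthoframe A g E.
Let gr : riemannian_metric A g. Proof. by case: frE. Qed.
Let Ev i : is_vfield A (E i). Proof. by case: frE. Qed.
Let Et i p : tangent_at A p (E i p). Proof. exact: vfield_tangent. Qed.

Lemma chart_gram (h : metric R M) c p : riemannian_metric A h -> dom A c p ->
  \matrix_(i, j) h p (coord_vec c i p) (coord_vec c j p) =
  (\matrix_(i, j) g p (coord_vec c i p) (E j p)) *m
  (\matrix_(i, j) h p (E i p) (E j p)) *m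
  (\matrix_(i, j) g p (coord_vec c i p) (E j p))^T.
Proof.
move=> hr cp; apply/matrixP => i j; rewrite !mxE.
case: frE => _ _ _ Es.
have tc k : tangent_at A p (coord_vec c k p) by exact: coord_vec_tangent.
rewrite {1}(Es p _ (tc j)) (metric_sumr hr) //; apply: eq_bigr => k _.
rewrite !mxE [in RHS]mulrC; congr (_ * _).
rewrite {1}(Es p _ (tc i)) (metric_suml hr) //.
by apply: eq_bigr => l _; rewrite !mxE.
Qed.

Lemma gram_orthonormal p :
  \matrix_(i, j) g p (E i p) (E j p) = 1%:M.
Proof. by case: frE => _ _ Eo _; apply/matrixP => i j; rewrite !mxE Eo. Qed.

Lemma chart_density_frame (h : metric R M) c p : riemannian_metric A h -> dom A c p ->
  chart_density h c (coord A c p) =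
  Num.sqrt (\det (\matrix_(i, j) h p (E i p) (E j p))) *
  chart_density g c (coord A c p).
Proof.
move=> hr cp; rewrite /chart_density coordK // chart_gram // (chart_gram gr) //.
rewrite gram_orthonormal mulmx1 !det_mulmx det_tr.
by rewrite -expr2 mulrAC -expr2 sqrtrM ?sqr_ge0 // mulrC.
Qed.

(** The density is 1 / |det b| for b the matrix of the orthonormal frame in coordinates. Writing the
    absolute value as the root of a square makes its smoothness evident. *)
Lemma chart_density_local c p : dom A c p ->
  exists (b : 'I_N -> 'I_N -> M -> R) (W : set M),
  [/\ open W, W p, W `<=` dom A c, (forall i j, smooth A (b i j)) &
   forall q, W q -> [/\ (\matrix_(i, j) b i j q) \in unitmx,
    (forall i, E i q = \sum_j b i j q *: coord_vec c j q) &
    chart_density g c (coord A c q) =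
      Num.sqrt ((\det (\matrix_(i, j) b i j q) * \det (\matrix_(i, j) b i j q))^-1)]].
Proof.
move=> cp; have [zeta [W [oW Wp Wd zs H]]] := frame_coordinates frE cp.
pose b i j q := E i q (zeta j).
exists b, W; split => // [i j|q Wq]; first exact: vfield_smooth.
have [_ bE _ ab] := H q Wq.
have [bu _] := mulmx1_unit ab; have [_ bu'] := mulmx1_unit ab.
split => //; rewrite /chart_density coordK; last exact: Wd.
rewrite (chart_gram gr); last exact: Wd.
rewrite gram_orthonormal mulmx1 det_mulmx det_tr invfM.
have ab1 : \det (\matrix_(i, j) g q (coord_vec c i q) (E j q)) *
    \det (\matrix_(i, j) b i j q) = 1 by rewrite -det_mulmx ab det1.
have b0 : \det (\matrix_(i, j) b i j q) != 0.
  by move: bu'; rewrite unitmxE unitfE.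
have -> : \det (\matrix_(i, j) g q (coord_vec c i q) (E j q)) =
    (\det (\matrix_(i, j) b i j q))^-1.
  by apply: (mulIf b0); rewrite ab1 mulVf.
by [].
Qed.

Lemma smooth_chart_density c : smooth_on (cdom c) (chart_density g c).
Proof.
apply: smooth_on_near => x cx; have cp := cdom_param cx.
have [b [W [oW Wp Wd bs H]]] := chart_density_local cp.
pose dt q := \det (\matrix_(i, j) b i j q).
have dts : smooth A dt by exact: smooth_det.
exists (coord A c @` (dom A c `&` W)),
  (fun y => Num.sqrt (((dt \o param A c) y * (dt \o param A c) y)^-1)).
have oU : open (coord A c @` (dom A c `&` W)) by exact: open_coord_image.
have dt0 q : W q -> dt q != 0.
  by move=> Wq; have [+ _ _] := H q Wq; rewrite unitmxE unitfE.
have sd : smooth_on (coord A c @` (dom A c `&` W)) (dt \o param A c).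
  by apply: smooth_on_sub (dts c) => y [q [cq _] <-]; exists q.
split => //.
- by exists (param A c x) => //; rewrite cdom_paramK.
- have pos y : (coord A c @` (dom A c `&` W)) y ->
      0 < (dt \o param A c) y * (dt \o param A c) y.
    move=> [q [cq Wq] <-]; rewrite /= coordK // -expr2 lt_neqAle sqr_ge0 andbT.
    by rewrite eq_sym sqrf_eq0 dt0.
  apply: smooth_on_sqrt => //; first by move=> y /pos; rewrite invr_gt0.
  apply: smooth_on_inv => //; last exact: smooth_on_mul.
  by move=> y /pos /gt_eqF ->.
- move=> y [q [cq Wq] <-] /=; have [_ _ ->] := H q Wq.
  by rewrite coordK.
Qed.

Lemma chart_density_ge0 (h : metric R M) c x : 0 <= chart_density h c x.
Proof. exact: sqrtr_ge0. Qed.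

Lemma measurable_chart_density c :
  measurable_fun (cdom c : set (borel 'rV[R]_N)) (chart_density g c).
Proof.
apply: continuous_on_borel; first exact: coord_open.
by move=> x cx; exact: smooth_on_continuous (smooth_chart_density c) cx.
Qed.

Lemma measurable_cdom c : measurable (cdom c : set (borel 'rV[R]_N)).
Proof. by apply: open_borel; exact: coord_open. Qed.

Lemma measurable_dom c : measurable (dom A c : set (borel M)).
Proof. by apply: open_borel; exact: dom_open. Qed.

Lemma measurable_param c :
  measurable_fun (cdom c : set (borel 'rV[R]_N)) (param A c : _ -> borel M).
Proof.
apply: (@measurability _ _ _ _ _ _ (@open M : set (set (borel M))) erefl).
move=> _ [U oU <-]; apply: open_borel.
have -> : cdom c `&` param A c @^-1` U = coord A c @` (dom A c `&` U).
  apply/seteqP; split=> [x [cx Ux]|x [p [cp Up] <-]].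
    by exists (param A c x); [split=> //; exact: cdom_param|exact: cdom_paramK].
  by split; [exact: cdomE|rewrite /= coordK].
exact: open_coord_image.
Qed.

(** The indicator of the coordinate image of B is replaced by the indicator of B composed with
    [param], which is measurable as a composition and has the shape wanted by [density_transfer]. *)
Lemma is_volume_measureP (mu : {measure set (borel M) -> \bar R}) :
  is_volume_measure A g mu <->
  forall c (B : set (borel M)), measurable B -> B `<=` dom A c ->
  (mu B = \int[lebesgue_row R N]_(x in cdom c)
    (\1_B (param A c x) * chart_density g c x)%:E)%E.
Proof.
have intE c (B : set (borel M)) : measurable B -> B `<=` dom A c ->
    (lebesgue_int (fun x => (\1_(coord A c @` B) x * chart_density g c x)%:E) =
    \int[lebesgue_row R N]_(x in cdom c)
      (\1_B (param A c x) * chart_density g c x)%:E)%E.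
  move=> mB Bd.
  have eqf : (fun x => (\1_(coord A c @` B) x * chart_density g c x)%:E) =
      (EFin \o (fun x => \1_B (param A c x) * chart_density g c x)%R) \_ (cdom c).
    apply/funext => x; rewrite patchE; case: ifPn => [/set_mem cx|ncx].
      rewrite /=; congr (_ * _)%:E; rewrite !indicE; congr (_%:R); congr nat_of_bool.
      apply/idP/idP => [/set_mem[p Bp <-]|/set_mem Bx]; rewrite inE.
        by rewrite coordK //; exact: Bd.
      by exists (param A c x) => //; exact: cdom_paramK.
    rewrite indicE (_ : _ \in _ = false) ?mul0r //.
    apply/negbTE; apply: contra ncx => /set_mem[p Bp <-]; rewrite inE.
    exact/cdomE/Bd.
  rewrite [RHS]integral_mkcond -eqf lebesgue_rowE //; last first.
    by move=> x; rewrite lee_fin mulr_ge0 // chart_density_ge0.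
  rewrite eqf; apply/(measurable_restrictT _ (measurable_cdom c)).
  apply/measurable_EFinP; apply: measurable_funM; last exact: measurable_chart_density.
  apply: (measurable_comp (measurable_dom c)); last exact: measurable_param.
    by move=> _ [x cx <-]; exact: cdom_param.
  exact: measurable_funTS.
by split=> H c B mB Bd; have := H c B mB Bd; rewrite intE.
Qed.

Lemma volume_transfer (mu : {measure set (borel M) -> \bar R}) c (f : borel M -> R) :
  is_volume_measure A g mu -> measurable_fun (dom A c : set (borel M)) f ->
  (\int[mu]_(p in dom A c) (f p)%:E =
   \int[lebesgue_row R N]_(x in cdom c) (f (param A c x) * chart_density g c x)%:E)%E.
Proof.
move=> /is_volume_measureP H mf.
apply: density_transfer => //; [exact: measurable_dom|exact: measurable_cdom
  |exact: measurable_param|exact: measurable_chart_density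
  |by move=> x _; exact: chart_density_ge0|exact: cdom_param|exact: H].
Qed.

End Volume.

Lemma density_measure_exists d (T : measurableType d) (R : realType)
    (mu : {measure set T -> \bar R}) (w : T -> R) :
  measurable_fun setT w -> (forall x, 0 <= w x) ->
  exists nu : {measure set T -> \bar R}, forall B, measurable B ->
    (nu B = \int[mu]_(x in B) (w x)%:E)%E.
Proof.
move=> mw w0; pose nu B := (\int[mu]_(x in B) (w x)%:E)%E.
have nu0 : nu set0 = 0%E by exact: integral_set0.
have nu_ge0 B : (0 <= nu B)%E by apply: integral_ge0 => x _; rewrite lee_fin.
have nu_sig : semi_sigma_additive nu.
  move=> F mF tF mUF; rewrite /nu ge0_integral_bigcup //.
  - by apply: is_cvg_ereal_nneg_natsum_cond => n _ _; exact: nu_ge0.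
  - by apply/measurable_EFinP; exact: measurable_funTS.
  - by move=> x _; rewrite lee_fin.
pose mix := isMeasure.Build _ _ _ nu nu0 nu_ge0 nu_sig.
pose nu' : {measure set T -> \bar R} := HB.pack nu mix.
by exists nu'.
Qed.

Lemma density_integral d (T : measurableType d) (R : realType)
    (mu nu : {measure set T -> \bar R}) (w : T -> R) (D : set T) (f : T -> R) :
  measurable_fun setT w -> (forall x, 0 <= w x) ->
  (forall B, measurable B -> (nu B = \int[mu]_(x in B) (w x)%:E)%E) ->
  measurable D -> measurable_fun D f ->
  (\int[nu]_(x in D) (f x)%:E = \int[mu]_(x in D) (f x * w x)%:E)%E.
Proof.
move=> mw w0 nuE mD mf.
apply: (@density_transfer _ _ _ _ _ nu mu D D id w) => //.
- exact: measurable_funTS.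
- move=> B mB BD; rewrite nuE // -{1}(setIidr BD) integral_mkcondr.
  apply: eq_integral => x _; rewrite patchE indicE.
  by case: ifP => _; rewrite ?mul1r ?mul0r.
Qed.

Section VolumeMeasure.
Variables (R : realType) (N : nat) (M : ptopologicalType) (A : manifold R N M).
Local Notation cdom c := (coord A c @` dom A c).

Lemma chart_at_exists : exists ch : M -> chart A, forall p, dom A (ch p) p.
Proof.
by exists (fun p => projT1 (cid (dom_cover A p))) => p; exact: (projT2 (cid (dom_cover A p))).
Qed.

Lemma compact_seq_cover (K : set M) (W : M -> set M) : compact K ->
  (forall p, K p -> open (W p) /\ W p p) ->
  exists s : seq M, (forall p, p \in s -> K p) /\
    forall q, K q -> exists2 p, p \in s & W p q.
Proof.
rewrite compact_cover => /(_ M K W) H HW.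
have [] := H (fun p Kp => (HW p Kp).1).
  by move=> p Kp; exists p => //; exact: (HW p Kp).2.
move=> D' D'K cov; exists (finmap.enum_fset D'); split=> [p pD|q Kq].
  by have := D'K p pD; rewrite inE.
by have [p pD Wq] := cov q Kq; exists p.
Qed.

(** The definition fixes the measure inside each chart domain. Finitely many of these cover K, and B
    is cut along them one at a time. *)
Lemma volume_unique (g : metric R M) (mu1 mu2 : {measure set (borel M) -> \bar R})
    (K : set M) (B : set (borel M)) :
  is_volume_measure A g mu1 -> is_volume_measure A g mu2 -> compact K ->
  measurable B -> B `<=` K -> mu1 B = mu2 B.
Proof.
move=> H1 H2 cK mB BK.
have [ch chP] := chart_at_exists.
have [s [_ scov]] : exists s : seq M, (forall p, p \in s -> K p) /\
    forall q, K q -> exists2 p, p \in s & dom A (ch p) q.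
  by apply: compact_seq_cover => // p _; split; [exact: dom_open|exact: chP].
have {scov} : forall q, B q -> exists2 p, p \in s & dom A (ch p) q.
  by move=> q /BK; exact: scov.
elim: s B mB {BK} => [|p s IH] B mB Bs.
  have -> : B = set0 by apply/seteqP; split => // q /Bs[].
  by rewrite !measure0.
have md := measurable_dom (ch p).
rewrite (measureDI mu1 mB md) (measureDI mu2 mB md); congr (_ + _)%E.
  apply: IH; first exact: measurableD.
  move=> q [/Bs[p']]; rewrite in_cons => /orP[/eqP ->|p's] // dq _.
  by exists p'.
have mI := measurableI _ _ mB md.
exact: etrans (H1 (ch p) _ mI (@subIsetr _ _ _)) (esym (H2 (ch p) _ mI (@subIsetr _ _ _))).
Qed.

Lemma volumeP (g : metric R M) : (exists mu, is_volume_measure A g mu) ->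
  is_volume_measure A g (volume A g).
Proof. by rewrite /volume; case: pselect => // ex _; case: cid. Qed.

Lemma volume0 (g : metric R M) : ~ (exists mu, is_volume_measure A g mu) ->
  volume A g = mzero.
Proof. by rewrite /volume; case: pselect. Qed.

Variables (g h : metric R M) (E F : 'I_N -> vfield R M).
Hypotheses (frE : orthoframe A g E) (frF : orthoframe A h F).
Let gr : riemannian_metric A g. Proof. by case: frE. Qed.
Let hr : riemannian_metric A h. Proof. by case: frF. Qed.
Let Ev i : is_vfield A (E i). Proof. by case: frE. Qed.

(* The density of the volume of [h] with respect to that of [g]. *)
Definition rel_density p : R := Num.sqrt (\det (\matrix_(i, j) h p (E i p) (E j p))).

Lemma rel_gram p :
  \matrix_(i, j) h p (E i p) (E j p) =
  (\matrix_(i, j) h p (E i p) (F j p)) *m (\matrix_(i, j) h p (E i p) (F j p))^T.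
Proof.
apply/matrixP => i j; rewrite !mxE (metric_fcomp frF) //; try exact: vfield_tangent.
by apply: eq_bigr => k _; rewrite !mxE.
Qed.

Lemma rel_det_gt0 p : 0 < \det (\matrix_(i, j) h p (E i p) (E j p)).
Proof.
rewrite rel_gram det_mulmx det_tr -expr2 lt_neqAle sqr_ge0 andbT eq_sym sqrf_eq0.
have tE i : tangent_at A p (E i p) by exact: vfield_tangent.
have tF i : tangent_at A p (F i p) by case: frF => _ Fv _ _; exact: vfield_tangent.
have e1 : (\matrix_(i, j) h p (E i p) (F j p)) *m (\matrix_(i, j) g p (F i p) (E j p))
    = 1%:M.
  apply/matrixP => i j; rewrite !mxE.
  case: frE => _ _ Eo _; rewrite -(Eo p i j).
  case: frF => _ _ _ Fs; rewrite [in RHS](Fs p _ (tE i)) (metric_suml gr) //.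
  by apply: eq_bigr => k _; rewrite !mxE.
by have [+ _] := mulmx1_unit e1; rewrite unitmxE unitfE.
Qed.

Lemma rel_density_gt0 p : 0 < rel_density p.
Proof. by rewrite sqrtr_gt0 rel_det_gt0. Qed.

Lemma rel_density_smooth : smooth A rel_density.
Proof.
apply: smooth_sqrt; first exact: rel_det_gt0.
by apply: smooth_det => i j; exact: smooth_metric.
Qed.

Lemma smooth_measurable (f : M -> R) : smooth A f -> measurable_fun setT (f : borel M -> R).
Proof. by move=> sf; apply: continuous_borel => p; exact: smooth_continuous. Qed.

Lemma volume_density (mu nu : {measure set (borel M) -> \bar R}) :
  is_volume_measure A g mu ->
  (forall B, measurable B -> (nu B = \int[mu]_(x in B) (rel_density x)%:E)%E) ->
  is_volume_measure A h nu.
Proof.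
move=> Hmu nuE; apply/(is_volume_measureP frF) => c B mB Bd.
have md := measurable_dom c.
have mr := smooth_measurable rel_density_smooth.
rewrite nuE //.
have -> : (\int[mu]_(x in B) (rel_density x)%:E =
    \int[mu]_(x in dom A c) (\1_B x * rel_density x)%:E)%E.
  rewrite -{1}(setIidr Bd) integral_mkcondr.
  apply: eq_integral => x _; rewrite patchE indicE.
  by case: ifP => _; rewrite ?mul1r ?mul0r.
rewrite (volume_transfer frE Hmu); last first.
  apply: measurable_funM; last exact: measurable_funTS.
  exact: measurable_funTS.
apply: eq_integral => x /[!inE] cx; congr (_%:E).
have cp := cdom_param cx.
have := chart_density_frame frE hr cp; rewrite cdom_paramK // => ->.
by rewrite mulrA.
Qed.

(** Existence of the volume is only compared between metrics, in whichever direction the frames are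
    supplied; the final proof splits on it. *)
Lemma volume_exists_density :
  (exists mu, is_volume_measure A g mu) -> exists mu, is_volume_measure A h mu.
Proof.
move=> [mu Hmu].
have [nu Hnu] := density_measure_exists mu (smooth_measurable rel_density_smooth)
  (fun p => ltW (rel_density_gt0 p)).
by exists nu; exact: volume_density Hmu Hnu.
Qed.

Lemma integral_volume_density (K Om : set M) (f : borel M -> R) :
  (exists mu, is_volume_measure A g mu) -> compact K -> open Om -> Om `<=` K ->
  measurable_fun (Om : set (borel M)) f ->
  (\int[volume A h]_(p in (Om : set (borel M))) (f p)%:E =
   \int[volume A g]_(p in (Om : set (borel M))) (f p * rel_density p)%:E)%E.
Proof.
move=> ex cK oO OK mf.
have Hg := volumeP ex; have Hh := volumeP (volume_exists_density ex).
have mr := smooth_measurable rel_density_smooth.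
have r0 p : 0 <= rel_density p by exact/ltW/rel_density_gt0.
have [nu Hnu] := density_measure_exists (volume A g) mr r0.
have Hn := volume_density Hg Hnu.
have mO : measurable (Om : set (borel M)) by exact: open_borel.
transitivity (\int[nu]_(p in (Om : set (borel M))) (f p)%:E)%E.
  apply: eq_measure_integral => B mB BO.
  by apply: (volume_unique Hh Hn cK mB) => p /BO/OK.
exact: density_integral.
Qed.

(** The volume is locally finite, since near each point the density is at most its value there plus
    1 on a box of finite Lebesgue measure. Compactness of K does the rest. *)
Lemma volume_finite (K : set M) (Om : set (borel M)) (mu : {measure set (borel M) -> \bar R}) :
  is_volume_measure A g mu ->
  compact K -> measurable Om -> Om `<=` K -> (mu Om < +oo)%E.
Proof.
move=> Hmu cK mO OK.
have loc p : exists W : set M, [/\ open W, W p & (mu W < +oo)%E].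
  have [c cp] := dom_cover A p; set x := coord A c p.
  have cx : cdom c x by exact: cdomE.
  have cd := smooth_on_continuous (smooth_chart_density frE c) cx.
  have nV : nbhs x (cdom c) by apply: open_nbhs_nbhs; split => //; exact: coord_open.
  have nC : nbhs x [set y | chart_density g c y <= chart_density g c x + 1].
    have : nbhs (chart_density g c x) [set z | z <= chart_density g c x + 1].
        have H : chart_density g c x < chart_density g c x + 1 by rewrite ltrDl.
      by apply: filterS (lt_nbhsl H) => z /ltW.
    by move=> /cd.
  have [r r0 bU] := nbhs_sub_box (filterI nV nC).
  pose W := dom A c `&` (coord A c @^-1` (box x r)°).
  have oW : open W.
    rewrite openE => q [cq bq]; apply: nbhs_coord => //.
    by apply: open_nbhs_nbhs; split => //; exact: open_interior.
  exists W; split => //; first by split => //; exact: nbhs_box.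
  have mW : measurable (W : set (borel M)) by exact: open_borel.
  rewrite ((is_volume_measureP frE mu).1 Hmu c W mW); last by move=> q [].
  have mbx : measurable (box x r : set (borel 'rV[R]_N)) by exact: measurable_box.
  have [k xk] : exists k : R, box x r `<=` box 0 k.
    exists (r + \sum_j `|x ord0 j|) => y by_ j; rewrite mxE subr0.
    have -> : y ord0 j = (y ord0 j - x ord0 j) + x ord0 j by rewrite subrK.
    rewrite (le_trans (ler_normD _ _)) // lerD ?by_ // (bigD1 j) //=.
    by rewrite lerDl sumr_ge0.
  set C := chart_density g c x + 1.
  have C0 : 0 <= C by rewrite addr_ge0 ?chart_density_ge0.
  apply: (@le_lt_trans _ _ (\int[lebesgue_row R N]_(y in cdom c)
      (C * \1_(box x r) y)%:E)%E).
    apply: ge0_le_integral => //.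
    - exact: measurable_cdom.
    - by move=> y _; rewrite lee_fin mulr_ge0 ?chart_density_ge0.
    - apply/measurable_EFinP; apply: measurable_funM; last exact: (measurable_chart_density frE).
      apply: (measurable_comp (measurable_dom c)); last exact: measurable_param.
        by move=> _ [y cy <-]; exact: cdom_param.
      exact: measurable_funTS.
    - by apply/measurable_EFinP; apply: measurable_funM.
    - move=> y cy; rewrite lee_fin !indicE.
      case: (boolP (_ \in W)) => [/set_mem[_ bW]|_]; last by rewrite mul0r mulr_ge0.
      have by_ : box x r y.
        by move: bW; rewrite /= cdom_paramK // => /interior_subset.
      rewrite mul1r (_ : _ \in box x r) ?mulr1 ?inE //.
      by have [_] := bU y by_.
  rewrite integral_mkcond.
  apply: (@le_lt_trans _ _ (\int[lebesgue_row R N]_y (C * \1_(box x r) y)%:E)%E).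
    apply: ge0_le_integral => //.
    - by move=> y _; rewrite patchE; case: ifP => // _; rewrite lee_fin mulr_ge0.
    - apply/(measurable_restrictT _ (measurable_cdom c)); apply/measurable_EFinP.
      exact: measurable_funM.
    - by apply/measurable_EFinP; apply: measurable_funM.
    - by move=> y _; rewrite patchE; case: ifP => // _; rewrite lee_fin mulr_ge0.
  under eq_integral do rewrite EFinM.
  rewrite ge0_integralZl_EFin //; last first.
    by apply/measurable_EFinP; exact: measurable_indic.
  rewrite integral_indic // setIT.
  apply: lte_mul_pinfty => //.
  apply: le_lt_trans (lebesgue_row_box N k).
  by apply: le_measure; rewrite ?inE //; exact: measurable_box.
pose W p := projT1 (cid (loc p)).
have HW p : [/\ open (W p), W p p & (mu (W p) < +oo)%E] by exact: (projT2 (cid (loc p))).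
have [s [_ scov]] : exists s : seq M, (forall p, p \in s -> K p) /\
    forall q, K q -> exists2 p, p \in s & W p q.
  by apply: compact_seq_cover => // p _; have [? ? _] := HW p.
have {scov} : forall q, Om q -> exists2 p, p \in s & W p q.
  by move=> q /OK; exact: scov.
elim: s Om mO {OK} => [|p s IH] B mB Bs.
  have -> : B = set0 by apply/seteqP; split => // q /Bs[].
  by rewrite measure0 ltry.
have [oW _ fW] := HW p; have mW : measurable (W p : set (borel M)) by exact: open_borel.
rewrite (measureDI mu mB mW) lte_add_pinfty //.
  apply: IH; first exact: measurableD.
  move=> q [/Bs[p']]; rewrite in_cons => /orP[/eqP ->|p's] // dq _.
  by exists p'.
by apply: le_lt_trans fW; apply: le_measure; rewrite ?inE //; exact: measurableI.
Qed.

End VolumeMeasure.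

(** * The divergence theorem *)

Section MeanValue.
Variable R : realType.

Lemma mean_value_bound (f df : R -> R) (K s : R) :
  (forall r, `|r| <= `|s| -> is_derive r (1 : R) f (df r)) ->
  (forall r, `|r| <= `|s| -> `|df r| <= K) -> `|f s - f 0| <= K * `|s|.
Proof.
move=> H HK.
have cont a b : (forall r, a <= r <= b -> `|r| <= `|s|) ->
    {within `[a, b], continuous f}.
  move=> ab; apply: derivable_within_continuous => r; rewrite in_itv /= => rab.
  by have [] := H r (ab r rab).
have [s0|s0] := leP 0 s.
  have sub r : 0 <= r <= s -> `|r| <= `|s|.
    by move=> /andP[r0 rs]; rewrite !ger0_norm.
  have [r|c|c] := @MVT_segment R f df 0 s s0.
  - by rewrite in_itv /= => /andP[r0 rs]; apply/H/sub; rewrite !ltW.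
  - exact: cont.
  - rewrite in_itv /= subr0 => cs ->; rewrite normrM ler_wpM2r //.
    exact/HK/sub.
have sub r : s <= r <= 0 -> `|r| <= `|s|.
  by move=> /andP[rs r0]; rewrite (ler0_norm r0) (ltr0_norm s0) lerN2.
have [r|c|c] := @MVT_segment R f df s 0 (ltW s0).
- by rewrite in_itv /= => /andP[r0 rs]; apply/H/sub; rewrite !ltW.
- exact: cont.
- rewrite in_itv /= sub0r => cs E; rewrite distrC E normrM normrN ler_wpM2r //.
  exact/HK/sub.
Qed.

(** The mean value bound used twice: for f' and for r -> f r - r f'(0). *)
Lemma taylor_bound (f df ddf : R -> R) (K s : R) :
  (forall r, `|r| <= `|s| -> is_derive r (1 : R) f (df r)) ->
  (forall r, `|r| <= `|s| -> is_derive r (1 : R) df (ddf r)) ->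
  (forall r, `|r| <= `|s| -> `|ddf r| <= K) ->
  `|f s - f 0 - s * df 0| <= K * s ^+ 2.
Proof.
move=> H1 H2 HK; pose h r := f r - r * df 0.
have -> : f s - f 0 - s * df 0 = h s - h 0 by rewrite /h mul0r subr0; ring.
rewrite -real_normK ?num_real // expr2 mulrA.
apply: (@mean_value_bound h (fun r => df r - df 0)) => r rs.
  have -> : h = f - (fun r => r * df 0) by [].
  apply: is_deriveB; first exact: H1.
  have -> : (fun r : R => r * df 0) = df 0 \*: id.
    by apply/funext => u; rewrite /= mulrC.
  apply: (is_derive_eq (is_deriveZ (df 0) (is_derive_id r (1 : R)))).
  by rewrite -[LHS]/(df 0 * 1) mulr1.
have K0 : 0 <= K by apply: le_trans (HK 0 _); rewrite ?normr0.
apply: le_trans (_ : K * `|r| <= _); last by rewrite ler_wpM2l.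
apply: (@mean_value_bound df ddf) => u ur; [apply: H2|apply: HK]; exact: le_trans rs.
Qed.

End MeanValue.

Section BoundedSupport.
Context d (T : measurableType d) (R : realType) (mu : {measure set T -> \bar R}).
Variables (f : T -> R) (B : set T) (C : R).
Hypotheses (mB : measurable B) (fB : (mu B < +oo)%E) (mf : measurable_fun setT f).
Hypotheses (fC : forall x, B x -> `|f x| <= C) (f0 : forall x, ~ B x -> f x = 0).

Let g x := `|C| * \1_B x.

Let gE : (\int[mu]_x (g x)%:E = `|C|%:E * mu B)%E.
Proof.
under eq_integral => x _ do rewrite /g EFinM.
rewrite ge0_integralZl_EFin //; last first.
  by apply/measurable_EFinP; exact: measurable_indic.
by rewrite integral_indic // setIT.
Qed.

Let g_int : mu.-integrable setT (EFin \o g).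
Proof.
apply/integrableP; split.
  by apply/measurable_EFinP; apply: measurable_funM => //; exact: measurable_indic.
under eq_integral => x _ do rewrite /= ger0_norm ?mulr_ge0 //.
by rewrite gE; apply: lte_mul_pinfty.
Qed.

Let fg x : `|f x| <= g x.
Proof.
rewrite /g indicE; have [Bx|nBx] := pselect (B x).
  by rewrite mem_set // mulr1 (le_trans (fC Bx)) // ler_norm.
by rewrite memNset // mulr0 f0 // normr0.
Qed.

Lemma bounded_support_integrable : mu.-integrable setT (EFin \o f).
Proof.
apply: (le_integrable _ _ _ g_int) => //; first exact/measurable_EFinP.
move=> x _; rewrite /= lee_fin (le_trans (fg x)) // ler_norm //.
Qed.

Lemma bounded_support_bound : `|\int[mu]_x f x| <= `|C| * fine (mu B).
Proof.
have fi := bounded_support_integrable.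
apply: (le_trans (le_normr_Rintegral _ fi)) => //.
have -> : `|C| * fine (mu B) = \int[mu]_x g x.
  by rewrite /Rintegral gE fineM // ge0_fin_numE.
apply: le_Rintegral => //.
apply: (le_integrable _ _ _ g_int) => //.
  by apply/measurable_EFinP; exact: measurableT_comp.
by move=> x _; rewrite /= lee_fin normr_id (le_trans (fg x)) // ler_norm.
Qed.

End BoundedSupport.

Lemma compact_continuous_bound (R : realType) (T : topologicalType) (K : set T)
    (f : T -> R) : compact K -> (forall x, K x -> {for x, continuous f}) ->
  exists C : R, forall x, K x -> `|f x| <= C.
Proof.
move=> cK cf.
have : compact (f @` K).
  apply: continuous_compact cK; apply: continuous_in_subspaceT => x /set_mem.
  exact: cf.
move=> /compact_bounded [C [_ HC]]; exists (C + 1) => x Kx.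
by apply: HC; [rewrite ltrDl|exists x].
Qed.

Section DerivativeIntegral.
Variables (R : realType) (N : nat).
Local Notation lam := (lebesgue_row R N).
Local Notation dlt j := (delta_mx ord0 j : 'rV[R]_N).

Lemma smooth_row_measurable (f : 'rV[R]_N -> R) : smooth_on setT f ->
  measurable_fun setT (f : borel 'rV[R]_N -> R).
Proof. by move=> sf; apply: continuous_borel => x; exact: smooth_on_continuous sf I. Qed.

Lemma derive_off_box (f : 'rV[R]_N -> R) x0 r v : (forall x, ~ box x0 r x -> f x = 0) ->
  forall x, ~ box x0 r x -> 'D_v f x = 0.
Proof.
move=> f0 x nx; have cb : closed (box x0 r).
  by apply: compact_closed; [exact: norm_hausdorff|exact: box_compact].
rewrite (@near_eq_derive _ _ _ _ (fun=> 0)); first exact: derive_cst.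
have : nbhs x (~` box x0 r) by apply: open_nbhs_nbhs; split => //; rewrite openC.
by apply: filterS => y /f0.
Qed.

Lemma derive_box_bound (f : 'rV[R]_N -> R) x0 r v : smooth_on setT f ->
  (forall x, ~ box x0 r x -> f x = 0) ->
  exists C, forall x, `|'D_v f x| <= C.
Proof.
move=> sf f0; have sd := smooth_on_derive v sf.
have [C HC] := @compact_continuous_bound R _ (box x0 r) (fun x => 'D_v f x)
  (@box_compact _ _ x0 r) (fun x _ => smooth_on_continuous sd I).
exists `|C| => x; have [bx|nbx] := pselect (box x0 r x).
  by rewrite (le_trans (HC x bx)) // ler_norm.
by rewrite (derive_off_box v f0) // normr0.
Qed.

(** By translation invariance the integral of f(x + s v) - f(x) - s D_v f(x) is -s times the
    integral of D_v f. The integrand is O(s^2) uniformly with fixed compact support, so the latter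
    integral is O(s) for every small s > 0. *)
Theorem integral_derive0 (f : 'rV[R]_N -> R) r j : smooth_on setT f ->
  (forall x, ~ box 0 r x -> f x = 0) ->
  \int[lam]_x 'D_(dlt j) f x = 0.
Proof.
move=> sf f0; set v := dlt j; pose df x := 'D_v f x.
have sd : smooth_on setT df := smooth_on_derive v sf.
have df0 := derive_off_box v f0.
have [C HC] := derive_box_bound v sd df0.
have [C1 HC1] := derive_box_bound v sf f0.
have C0 : 0 <= C by apply: le_trans (HC 0).
(* The extra 1 leaves room for the supports of all translates with |s| <= 1. *)
pose B := box (0 : 'rV[R]_N) (r + 1).
have mB : measurable (B : set (borel 'rV[R]_N)) by exact: measurable_box.
have fB : (lam B < +oo)%E := lebesgue_row_box N (r + 1).
have BP x : ~ B x -> ~ box 0 r x.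
  by move=> nB bx; apply: nB => k; rewrite (le_trans (bx k)) // lerDl.
have shiftB x s : `|s| <= 1 -> ~ B x -> ~ box 0 r (x + s *: v).
  move=> s1 nB bx; apply: nB => k; have := bx k; rewrite !mxE !subr0 => H.
  have -> : x ord0 k = (x ord0 k + s * ((ord0 == ord0 :> 'I_1) && (k == j))%:R)
      - s * ((ord0 == ord0 :> 'I_1) && (k == j))%:R by rewrite addrK.
  rewrite (le_trans (ler_normB _ _)) // lerD // normrM.
  by case: (_ && _); rewrite ?normr0 ?normr1 ?mulr0 ?mulr1.
have [C2 HC2] := @compact_continuous_bound R _ (box (0 : 'rV[R]_N) (r + 1)) f
  (@box_compact _ _ _ _) (fun x _ => smooth_on_continuous sf I).
have C2' x : `|f x| <= `|C2|.
  have [bx|nbx] := pselect (B x); first by rewrite (le_trans (HC2 x bx)) // ler_norm.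
  by rewrite f0 ?normr0 //; exact: BP.
have mf := smooth_row_measurable sf; have mdf := smooth_row_measurable sd.
have shift_m s : measurable_fun setT
    ((fun x => x + s *: v) : borel 'rV[R]_N -> borel 'rV[R]_N).
  apply: measurable_fun_row => k.
  rewrite (_ : (fun t => _) = (fun t : borel 'rV[R]_N =>
      (t : 'rV[R]_N) ord0 k + (s *: v) ord0 k)).
    by apply: measurable_funD => //; exact: measurable_coord.
  by apply/funext => t; rewrite mxE.
have mfs s : measurable_fun setT (fun x : borel 'rV[R]_N => f ((x : 'rV[R]_N) + s *: v)).
  exact: (measurableT_comp mf (shift_m s)).
have fi := bounded_support_integrable mB fB mf (fun x _ => C2' x) (fun x nB => f0 x (BP x nB)).
have dfi := bounded_support_integrable mB fB mdf (fun x _ => HC1 x) (fun x nB => df0 x (BP x nB)).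
have fsi s : `|s| <= 1 -> lam.-integrable setT
    (EFin \o (fun x : borel 'rV[R]_N => f ((x : 'rV[R]_N) + s *: v))).
  move=> s1; apply: (bounded_support_integrable mB fB (mfs s) (C := `|C2|)).
    by move=> x _; exact: C2'.
  by move=> x nB; apply: f0; exact: shiftB.
have trans s : \int[lam]_x f (x + s *: v) = \int[lam]_x f x.
  rewrite /Rintegral integralE [in RHS]integralE; congr fine; congr (_ - _)%E.
    have mp := measurable_funepos ((measurable_EFinP _ _).2 mf).
    rewrite -(lebesgue_row_translation (s *: v) mp) //.
    by apply: eq_integral => x _; rewrite !funeposE.
  have mp := measurable_funeneg ((measurable_EFinP _ _).2 mf).
  rewrite -(lebesgue_row_translation (s *: v) mp) //.
  by apply: eq_integral => x _; rewrite !funenegE.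
have key s : `|s| <= 1 -> `|s| * `|\int[lam]_x df x| <= C * fine (lam B) * s ^+ 2.
  move=> s1.
  have tay x : `|f (x + s *: v) - f x - s * df x| <= C * s ^+ 2.
    have H1 u : is_derive u (1 : R) (fun s : R => f (s *: v + x)) (df (u *: v + x)).
      apply/(@is_derive_line R _ f x v u).
      exact: (derivableP (@smooth_on_derivable R N setT f (u *: v + x) v sf I)).
    have H2 u : is_derive u (1 : R) (fun s : R => df (s *: v + x)) ('D_v df (u *: v + x)).
      apply/(@is_derive_line R _ df x v u).
      exact: (derivableP (@smooth_on_derivable R N setT df (u *: v + x) v sd I)).
    have := @taylor_bound R _ _ _ C s (fun u _ => H1 u) (fun u _ => H2 u) (fun u _ => HC _).
    by rewrite scale0r !add0r [s *: v + x]addrC.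
  have off x : ~ B x -> f (x + s *: v) - f x - s * df x = 0.
    by move=> nB; rewrite !f0 ?(BP x nB) //;
      [rewrite /df df0 ?mulr0 ?subr0 //; exact: BP|exact: BP|exact: shiftB].
  have mr : measurable_fun setT
      (fun x : borel 'rV[R]_N => f ((x : 'rV[R]_N) + s *: v) - f x - s * df x).
    by apply: measurable_funB; [apply: measurable_funB|apply: measurable_funM].
  have := bounded_support_bound mB fB mr (fun x _ => tay x) off.
  rewrite RintegralB //; last 2 first.
  - exact: (integrableB measurableT (fsi s s1) fi).
  - exact: (integrableZl measurableT s dfi).
  rewrite RintegralB //; last exact: fsi.
  rewrite trans subrr sub0r normrN RintegralZl // normrM.
  rewrite (ger0_norm (mulr_ge0 C0 (sqr_ge0 s))) => H.
  by rewrite (le_trans H) // mulrAC.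
apply/eqP; rewrite -normr_le0; apply/ler_addgt0Pr => e e0; rewrite add0r.
set L := C * fine (lam B) in key.
have L0 : 0 <= L by rewrite mulr_ge0 // fine_ge0.
(* The bound 1 makes [key] applicable; the other one makes L s at most e. *)
pose s := Num.min 1 (e / (L + 1)).
have s0 : 0 < s by rewrite lt_min ltr01 divr_gt0 // ltr_wpDl.
have s1 : `|s| <= 1 by rewrite gtr0_norm // ge_min lexx.
have := key s s1; rewrite (gtr0_norm s0) expr2 mulrCA (ler_pM2l s0) => H.
apply: le_trans H _; apply: (@le_trans _ _ (L * (e / (L + 1)))).
  by rewrite ler_wpM2l // ge_min lexx orbT.
rewrite mulrCA ler_piMr ?(ltW e0) // ler_pdivrMr ?mul1r ?lerDl // ltr_wpDl //.
Qed.

End DerivativeIntegral.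

Section Jacobi.
Variables (R : realType) (N : nat) (M : ptopologicalType) (A : manifold R N M).
Variables (p : M) (v : tvec R M).
Hypothesis tv : tangent_at A p v.

Lemma tangent_prod (I : eqType) (r : seq I) (F : I -> M -> R) : uniq r ->
  (forall i, smooth A (F i)) ->
  v (fun q => \prod_(i <- r) F i q) =
    \sum_(k <- r) v (F k) * \prod_(i <- r | i != k) F i p.
Proof.
move=> + HF; elim: r => [_|i r IH /= /andP[ir ur]].
  rewrite big_nil -(tangent_cst tv 1); congr v.
  by apply/funext => q; rewrite big_nil.
have -> : (fun q => \prod_(j <- i :: r) F j q) =
    (fun q => F i q * \prod_(j <- r) F j q).
  by apply/funext => q; rewrite big_cons.
rewrite (tangentM tv) //; last exact: smooth_prod.
rewrite IH // !big_cons eqxx /=; congr (_ * _ + _).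
  rewrite [RHS]big_seq_cond [LHS]big_seq_cond; apply: eq_bigl => j.
  by case: (boolP (j \in r)) => //= jr; apply/esym; apply: contraNneq ir => <-.
rewrite mulr_sumr [LHS]big_seq [RHS]big_seq; apply: eq_bigr => k kr.
rewrite big_cons ifT; first by rewrite mulrCA.
by apply: contraNneq ir => ->.
Qed.

(** Jacobi's formula: the product rule differentiates one row at a time, and the determinant with
    row k differentiated is expanded along that row. *)
Lemma tangent_det (N' : nat) (b : 'I_N' -> 'I_N' -> M -> R) :
  (forall i j, smooth A (b i j)) ->
  v (fun q => \det (\matrix_(i, j) b i j q)) =
    \sum_k \sum_j v (b k j) * cofactor (\matrix_(i, j) b i j p) k j.
Proof.
move=> Hb.
have -> : (fun q => \det (\matrix_(i, j) b i j q)) =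
    (fun q => \sum_(s : 'S_N') (-1) ^+ s * \prod_i b i (s i) q).
  apply/funext => q; apply: eq_bigr => s _; congr (_ * _).
  by apply: eq_bigr => i _; rewrite mxE.
rewrite (tangent_sum tv); last first.
  by move=> s; apply: smooth_mul; [exact: smooth_cst|exact: smooth_prod].
under eq_bigr => s _.
  rewrite (tangentZ tv); last exact: smooth_prod.
  rewrite tangent_prod ?index_enum_uniq // mulr_sumr.
  over.
rewrite exchange_big /=; apply: eq_bigr => k _.
pose B : 'M[R]_N' := \matrix_(i, j) if i == k then v (b k j) else b i j p.
transitivity (\det B).
  apply: eq_bigr => s _; congr (_ * _); rewrite [RHS](bigD1 k) //= mxE eqxx.
  by congr (_ * _); apply: eq_bigr => i ik; rewrite mxE (negbTE ik).
rewrite (expand_det_row B k); apply: eq_bigr => j _; rewrite mxE eqxx; congr (_ * _).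
rewrite /cofactor; congr (_ * \det _); apply/matrixP => i l.
by rewrite !mxE eq_sym (negbTE (neq_lift _ _)).
Qed.

End Jacobi.

(** * Divergence in a chart and over the manifold *)

Section Divergence.
Variables (R : realType) (N : nat) (M : ptopologicalType) (A : manifold R N M).
Variables (g : metric R M) (E : 'I_N -> vfield R M).
Hypothesis frE : orthoframe A g E.
Let gr : riemannian_metric A g. Proof. by case: frE. Qed.
Let Ev i : is_vfield A (E i). Proof. by case: frE. Qed.
Let Et i p : tangent_at A p (E i p). Proof. exact: vfield_tangent. Qed.
Local Notation cdom c := (coord A c @` dom A c).
Local Notation dlt j := (delta_mx ord0 j : 'rV[R]_N).
Local Notation cc := (structure_fun g E).

Lemma frame_local i q (phi : M -> R) : smooth A phi ->
  (\forall q' \near q, phi q' = 0) -> E i q phi = 0.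
Proof.
move=> sphi phi0; have [c cq] := dom_cover A q.
have [zeta [W [oW Wq Wd zs H]]] := frame_coordinates frE cq.
have [_ -> _ _] := H q Wq; rewrite tvec_sumE big1 // => j _.
rewrite tvecZE coord_vecE //.
rewrite (@near_eq_derive _ _ _ _ (fun=> 0)) ?derive_cst ?mulr0 //.
have cx : cdom c (coord A c q) by exact: cdomE.
have H1 : {for coord A c q, continuous (param A c)} by exact: param_continuous.
have := H1 [set q' | phi q' = 0]; rewrite coordK // => /(_ phi0).
by [].
Qed.

Lemma frame_div_local i q (phi : M -> R) : smooth A phi ->
  (\forall q' \near q, phi q' = 0) -> frame_div g E phi i q = 0.
Proof.
move=> sphi phi0; rewrite /frame_div frame_local //.
by rewrite (nbhs_singleton phi0) mul0r subr0.
Qed.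

Lemma frame_div_smooth i (phi : M -> R) : smooth A phi ->
  smooth A (frame_div g E phi i).
Proof.
move=> sphi; apply: smooth_sub; first exact: vfield_smooth.
apply: smooth_mul => //; apply: smooth_sum => k; exact: (structure_smooth frE).
Qed.

Lemma frame_divD i p (phi psi : M -> R) : smooth A phi -> smooth A psi ->
  frame_div g E (fun q => phi q + psi q) i p =
  frame_div g E phi i p + frame_div g E psi i p.
Proof. by move=> s1 s2; rewrite /frame_div (tangentD (Et i p)) //; ring. Qed.

(** The coordinate components of the frame, written as an inverse matrix so that they are defined on
    the whole chart and do not refer to cut-off coordinates. *)
Definition chart_coef (c : chart A) i j q : R :=
  (invmx (\matrix_(i, j) g q (coord_vec c i q) (E j q))) i j.

(** The classical formula div X = r^-1 sum_j d_j (r X^j), with r the volume density. The trace of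
    the structure functions supplies the derivatives of r and of the components of E_i. *)
Lemma frame_div_chart c i x (phi : M -> R) : smooth A phi -> cdom c x ->
  frame_div g E phi i (param A c x) * chart_density g c x =
  \sum_j 'D_(dlt j) (fun y => phi (param A c y) *
     (chart_density g c y * chart_coef c i j (param A c y))) x.
Proof.
move=> sphi cx; set p := param A c x.
have cp : dom A c p by exact: cdom_param.
have xE : coord A c p = x by exact: cdom_paramK.
have [zeta [W [oW Wp Wd zs H]]] := frame_coordinates frE cp.
pose b i j q := E i q (zeta j).
have bs k j : smooth A (b k j) by exact: vfield_smooth.
pose dt q := \det (\matrix_(i, j) b i j q).
have dts : smooth A dt by exact: smooth_det.
have oU : open (coord A c @` (dom A c `&` W)) by exact: open_coord_image.
have nU : nbhs x (coord A c @` (dom A c `&` W)).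
  by apply: open_nbhs_nbhs; split => //; exists p.
have cbE k j q : W q -> chart_coef c k j q = b k j q.
  move=> Wq; rewrite /chart_coef; have [_ _ _ ab] := H q Wq.
  have [au _] := mulmx1_unit ab.
  have -> : invmx (\matrix_(i, j) g q (coord_vec c i q) (E j q)) =
      \matrix_(i, j) b i j q.
    by rewrite -[LHS]mulmx1 -ab mulmxA mulVmx // mul1mx.
  by rewrite mxE.
have dens q : W q -> chart_density g c (coord A c q) ^+ 2 * dt q ^+ 2 = 1.
  move=> Wq; have [_ _ _ ab] := H q Wq.
  have ab1 : \det (\matrix_(i, j) g q (coord_vec c i q) (E j q)) * dt q = 1.
    by rewrite -det_mulmx ab det1.
  rewrite /chart_density coordK; last exact: Wd.
  rewrite (chart_gram frE gr); last exact: Wd.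
  rewrite (gram_orthonormal frE) mulmx1 det_mulmx det_tr -expr2 sqr_sqrtr ?sqr_ge0 //.
  by rewrite -exprMn ab1 expr1n.
set r := chart_density g c x.
have dt0 : dt p != 0.
  by apply/eqP => d0; have := dens p Wp; rewrite d0 expr0n mulr0 => /eqP; rewrite eq_sym oner_eq0.
have rd1 : r ^+ 2 * dt p ^+ 2 = 1 by rewrite -(dens p Wp) xE.
have r0 : r != 0.
  by apply/eqP => d0; have := rd1; rewrite d0 expr0n mul0r => /eqP; rewrite eq_sym oner_eq0.
have dsm (h : M -> R) j : smooth A h ->
    is_derive x (dlt j) (h \o param A c) (coord_vec c j p h).
  move=> hs; rewrite coord_vecE // xE; apply: derivableP.
  exact: (@smooth_on_derivable _ _ (cdom c)).
(* Differentiating r^2 dt^2 = 1 gives r' / r = - dt' / dt, whatever the sign of dt. *)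
have dr j : is_derive x (dlt j) (chart_density g c) (- r * coord_vec c j p dt / dt p).
  have dd : derivable (chart_density g c) x (dlt j).
    exact: (@smooth_on_derivable _ _ (cdom c) _ _ _ (smooth_chart_density frE c) cx).
  have dd' := derivableP dd.
  suff -> : - r * coord_vec c j p dt / dt p = 'D_(dlt j) (chart_density g c) x by [].
  have prod := is_deriveM (is_deriveM dd' dd') (is_deriveM (dsm dt j dts) (dsm dt j dts)).
  have cst1 : is_derive x (dlt j) (chart_density g c * chart_density g c *
      ((dt \o param A c) * (dt \o param A c))) 0.
    apply: near_is_derive (is_derive_cst (1 : R) x (dlt j)).
    apply: filterS nU => y [q [cq Wq] <-].
    by rewrite /cst !fctE /= coordK // -!expr2 dens.
  have := @derive_val _ _ _ _ _ _ _ prod; rewrite (@derive_val _ _ _ _ _ _ _ cst1).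
  rewrite !fctE /= -/p -![_ *: _]/(_ * _) -/r => e.
  set r' := 'D_(dlt j) _ _ in e *; set d' := coord_vec _ _ _ _ in e *.
  have e2 : (2 * r * dt p) * (r' * dt p + r * d') = 0.
    by rewrite [RHS]e; ring.
  have : r' * dt p + r * d' = 0.
    by move/eqP: e2; rewrite !mulf_eq0 pnatr_eq0 (negbTE r0) (negbTE dt0) /= => /eqP.
  move=> /eqP; rewrite addr_eq0 => /eqP e3.
  by apply: (mulIf dt0); rewrite divfK // e3 mulNr.
have dF j : is_derive x (dlt j) (fun y => phi (param A c y) *
     (chart_density g c y * chart_coef c i j (param A c y)))
   (phi p * (r * coord_vec c j p (b i j) + b i j p * (- r * coord_vec c j p dt / dt p))
    + r * b i j p * coord_vec c j p phi).
  have := is_deriveM (dsm phi j sphi) (is_deriveM (dr j) (dsm (b i j) j (bs i j))).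
  apply: near_is_derive; apply: filterS nU => y [q [cq Wq] <-].
  by rewrite !fctE /= coordK // cbE.
under eq_bigr => j _ do rewrite (@derive_val _ _ _ _ _ _ _ (dF j)).
have [dz bE aE ab] := H p Wp.
have Eb (h : M -> R) : E i p h = \sum_j b i j p * coord_vec c j p h.
  by rewrite {1}bE tvec_sumE.
pose a := \matrix_(i, j) g p (coord_vec c i p) (E j p).
pose Bm := \matrix_(i, j) b i j p.
have ba : Bm *m a = 1%:M by exact: mulmx1C ab.
(* The inverse of the matrix b is a, so its adjugate is dt a and Jacobi's formula gives the
   logarithmic derivative of dt. *)
have aadj j k : cofactor Bm k j = dt p * a j k.
  have : \adj Bm = dt p *: a.
    by rewrite -[LHS]mul1mx -ab -mulmxA mul_mx_adj mul_mx_scalar.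
  by move=> /matrixP/(_ j k); rewrite [X in X = _ -> _]mxE [X in _ = X -> _]mxE.
have Edt : E i p dt = dt p * \sum_k \sum_j E i p (b k j) * a j k.
  rewrite (tangent_det (Et i p)) // mulr_sumr; apply: eq_bigr => k _.
  rewrite mulr_sumr; apply: eq_bigr => j _.
  by rewrite -/Bm aadj mulrCA.
have cc_a k : cc i k k p = \sum_j (E i p (b k j) - E k p (b i j)) * a j k.
  have tu : tangent_at A p (bracket (E i) (E k) p).
    by apply: vfield_tangent; exact: is_vfield_bracket.
  set u := bracket (E i) (E k) p in tu *.
  have uz j : E i p (b k j) - E k p (b i j) = \sum_l g p u (E l p) * Bm l j.
    rewrite -[LHS]/(u (zeta j)); case: frE => _ _ _ Es.
    rewrite {1}(Es p u tu) tvec_sumE; apply: eq_bigr => l _.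
    by rewrite tvecZE mxE.
  under eq_bigr => j _ do rewrite uz mulr_suml.
  rewrite exchange_big /=.
  transitivity (\sum_l g p u (E l p) * (Bm *m a) l k).
    rewrite ba (bigD1 k) //= mxE eqxx mulr1 big1 ?addr0 // => l lk.
    by rewrite mxE (negbTE lk) mulr0.
  apply: eq_bigr => l _; rewrite mxE mulr_sumr.
  by apply: eq_bigr => j _; rewrite mulrA.
have sum_cc : \sum_k cc i k k p = E i p dt / dt p - \sum_j coord_vec c j p (b i j).
  under eq_bigr => k _ do rewrite cc_a.
  under eq_bigr => k _ do under eq_bigr => j _ do rewrite mulrBl.
  under eq_bigr => k _ do rewrite sumrB.
  rewrite sumrB Edt mulrAC divff // mul1r; congr (_ - _).
  rewrite exchange_big /=; apply: eq_bigr => j _.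
  rewrite {1}(aE j) tvec_sumE; apply: eq_bigr => k _.
  by rewrite tvecZE mxE mulrC.
rewrite /frame_div sum_cc Eb (Eb dt) -/p.
under [RHS]eq_bigr => j _.
  rewrite (_ : _ + _ = r * (b i j p * coord_vec c j p phi)
     + phi p * (r * coord_vec c j p (b i j))
     - (phi p * r / dt p) * (b i j p * coord_vec c j p dt)); last by field.
  over.
rewrite sumrB big_split /= -!mulr_sumr.
by field.
Qed.

Variables (mu : {measure set (borel M) -> \bar R}).
Hypothesis Hmu : is_volume_measure A g mu.

Lemma chart_coef_smooth c i j : smooth_on (cdom c) (chart_coef c i j \o param A c).
Proof.
apply: smooth_on_near => x cx; have cp := cdom_param cx; set p := param A c x in cp.
have [zeta [W [oW Wp Wd zs H]]] := frame_coordinates frE cp.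
exists (coord A c @` (dom A c `&` W)), ((fun q => E i q (zeta j)) \o param A c).
split => //.
- exact: open_coord_image.
- by exists p => //; exact: cdom_paramK.
- have bs : smooth A (fun q => E i q (zeta j)) by exact: vfield_smooth.
  by apply: smooth_on_sub (bs c) => y [q [cq _] <-]; exists q.
- move=> y [q [cq Wq] <-] /=; rewrite coordK //.
  rewrite /chart_coef; have [_ _ _ ab] := H q Wq.
  have [au _] := mulmx1_unit ab.
  have -> : invmx (\matrix_(i, j) g q (coord_vec c i q) (E j q)) =
      \matrix_(i, j) E i q (zeta j).
    by rewrite -[LHS]mulmx1 -ab mulmxA mulVmx // mul1mx.
  by rewrite mxE.
Qed.

Lemma integral_frame_div_chart c x0 r i (phi : M -> R) :
  box x0 r `<=` cdom c -> smooth A phi ->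
  (forall q, ~ (param A c @` box x0 r) q -> phi q = 0) ->
  \int[mu]_(p in [set: borel M]) frame_div g E phi i p = 0.
Proof.
move=> bV sphi phi0; pose K := param A c @` box x0 r.
have cK : closed K.
  by apply: compact_closed; [exact: hausdorff_carrier A|exact: param_box_compact].
have Kd : K `<=` dom A c by move=> q [y by_ <-]; exact/cdom_param/bV.
have off q : ~ K q -> frame_div g E phi i q = 0.
  move=> nK; apply: frame_div_local => //.
  have : nbhs q (~` K) by apply: open_nbhs_nbhs; split => //; rewrite openC.
  by apply: filterS => q' /phi0.
(* Extension by 0 is smooth on all of R^N because the support lies in a compact box inside the
   chart. *)
pose F j y := if y \in cdom c then phi (param A c y) *
     (chart_density g c y * chart_coef c i j (param A c y)) else 0.
have F0 j y : ~ box x0 r y -> F j y = 0.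
  rewrite /F; case: ifP => // /set_mem cy nby; rewrite phi0 ?mul0r // => -[z bz zE].
  apply: nby; suff -> : y = z by [].
  by rewrite -(cdom_paramK cy) -zE cdom_paramK //; exact: bV.
have cb : closed (box x0 r).
  by apply: compact_closed; [exact: norm_hausdorff|exact: box_compact].
have sF j : smooth_on setT (F j).
  apply: smooth_on_near => y _; have [cy|ncy] := pselect (cdom c y).
    exists (cdom c), (fun y => (phi \o param A c) y *
     (chart_density g c y * (chart_coef c i j \o param A c) y)).
    have oV : open (cdom c) by exact: coord_open.
    split => //; last by move=> z cz; rewrite /F mem_set.
    apply: smooth_on_mul => //; apply: smooth_on_mul => //.
      exact: (smooth_chart_density frE).
    exact: chart_coef_smooth.
  exists (~` box x0 r), (fun=> 0); split => //.
  - by rewrite openC.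
  - by move=> by_; apply/ncy/bV.
  - by apply: smooth_on_cst; rewrite openC.
  - exact: F0.
have [k xk] : exists k : R, box x0 r `<=` box 0 k.
  exists (r + \sum_j `|x0 ord0 j|) => y by_ j; rewrite mxE subr0.
  have -> : y ord0 j = (y ord0 j - x0 ord0 j) + x0 ord0 j by rewrite subrK.
  rewrite (le_trans (ler_normD _ _)) // lerD ?by_ // (bigD1 j) //=.
  by rewrite lerDl sumr_ge0.
have F0k j y : ~ box 0 k y -> F j y = 0 by move=> nb; apply: F0 => /xk.
have fE : (\int[mu]_(p in [set: borel M]) (frame_div g E phi i p)%:E =
   \int[lebesgue_row R N]_x (\sum_j 'D_(dlt j) (F j) x)%:E)%E.
  transitivity (\int[mu]_(p in (dom A c : set (borel M))) (frame_div g E phi i p)%:E)%E.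
    rewrite [RHS]integral_mkcond; apply: eq_integral => p _; rewrite patchE.
    case: ifPn => // /negP np; rewrite off // => /Kd dp; apply: np; exact: mem_set.
  rewrite (volume_transfer frE Hmu); last first.
    by apply: measurable_funTS; apply: smooth_measurable; exact: frame_div_smooth.
  rewrite [LHS]integral_mkcond; apply: eq_integral => x _; rewrite patchE.
  case: ifPn => [/set_mem cx|/negP ncx].
    rewrite frame_div_chart //; congr (_%:E); apply: eq_bigr => j _.
    apply: near_eq_derive.
    have nV : nbhs x (cdom c) by apply: open_nbhs_nbhs; split => //; exact: coord_open.
    by apply: filterS nV => y cy; rewrite /F mem_set.
  rewrite big1 // => j _; apply: (derive_off_box _ (F0 j)).
  by move=> bx; apply: ncx; apply/mem_set/bV.
rewrite /Rintegral fE.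
have dB : measurable (box (0 : 'rV[R]_N) k : set (borel 'rV[R]_N)) by exact: measurable_box.
have dFi j : (lebesgue_row R N).-integrable setT (EFin \o 'D_(dlt j) (F j)).
  have [C HC] := derive_box_bound (dlt j) (sF j) (F0k j).
  apply: (bounded_support_integrable dB (lebesgue_row_box N k) (C := C)) => //.
    by apply: smooth_row_measurable; exact: smooth_on_derive.
  exact: (derive_off_box (dlt j) (F0k j)).
under eq_integral => x _ do rewrite -sumEFin.
rewrite integral_sum //.
rewrite big1 // => j _.
have fin : (\int[lebesgue_row R N]_x ('D_(dlt j) (F j) x)%:E)%E \is a fin_num.
  exact: (integrable_fin_num measurableT (dFi j)).
rewrite -(fineK fin); congr (_%:E).
exact: (integral_derive0 j (sF j) (F0k j)).
Qed.

(** Instead of a partition of unity, patches are peeled off one by one: phi = phi chi + phi (1 -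
    chi), with chi = 1 on a patch. The first term lives in a chart; the second vanishes on that
    patch and is left to the induction. *)
Theorem divergence_theorem (K : set M) i (phi : M -> R) : compact K ->
  smooth A phi -> (forall q, ~ K q -> phi q = 0) ->
  mu.-integrable [set: borel M] (EFin \o frame_div g E phi i) /\
  \int[mu]_(p in [set: borel M]) frame_div g E phi i p = 0.
Proof.
move=> cK.
have clK : closed K by apply: compact_closed cK; exact: hausdorff_carrier A.
have mK : measurable (K : set (borel M)).
  by rewrite -(setCK K); apply: measurableC; apply: open_borel; rewrite openC.
have fK : (mu K < +oo)%E by apply: (volume_finite frE Hmu cK mK).
have Kint (psi : M -> R) : smooth A psi -> (forall q, ~ K q -> psi q = 0) ->
    mu.-integrable [set: borel M] (EFin \o frame_div g E psi i).
  move=> spsi psi0; have sd := frame_div_smooth i spsi.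
  have [C HC] := @compact_continuous_bound R _ K (frame_div g E psi i) cK
    (fun x _ => smooth_continuous sd (x := x)).
  apply: (bounded_support_integrable mK fK _ HC); first exact: smooth_measurable.
  move=> q nK; apply: frame_div_local => //.
  have : nbhs q (~` K) by apply: open_nbhs_nbhs; split => //; rewrite openC.
  by apply: filterS => q' /psi0.
move=> sphi phi0; split; first exact: Kint.
have loc p : exists (U : set M) (chi : M -> R), [/\ open U, U p, smooth A chi,
    (forall q, U q -> chi q = 1) &
    exists c x0 r, box x0 r `<=` cdom c /\
      forall q, ~ (param A c @` box x0 r) q -> chi q = 0].
  have [c cp] := dom_cover A p; set x := coord A c p.
  have cx : cdom c x by exact: cdomE.
  have nV : nbhs x (cdom c) by apply: open_nbhs_nbhs; split => //; exact: coord_open.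
  have [r r0 bV] := nbhs_sub_box nV.
  have [chi [chis chi0 chi1]] := exists_bump cp r0 bV.
  exists (dom A c `&` (coord A c @^-1` (box x (r / 2))°)), chi; split => //.
  - rewrite openE => q [cq bq]; apply: nbhs_coord => //.
    by apply: open_nbhs_nbhs; split => //; exact: open_interior.
  - by split => //; apply: nbhs_box; rewrite divr_gt0.
  - by move=> q [cq /interior_subset bq]; exact: chi1.
  - by exists c, x, r.
pose U p := projT1 (cid (loc p)).
have HU p := projT2 (cid (loc p)); rewrite -/(U _) in HU.
have [s [_ scov]] : exists s : seq M, (forall p, p \in s -> K p) /\
    forall q, K q -> exists2 p, p \in s & U p q.
  by apply: compact_seq_cover => // p _; have [chi [? ? _ _ _]] := HU p.
(* The invariant is that the remaining patches cover the points where phi is nonzero; covering K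
   itself would be lost when a patch is removed. *)
have : forall q, phi q != 0 -> exists2 p, p \in s & U p q.
  move=> q nz; apply: scov; apply: contrapT => /phi0 z; by rewrite z eqxx in nz.
elim: s phi sphi phi0 {scov} => [|p s IH] phi sphi phi0 cov.
  have z q : phi q = 0 by apply/eqP; apply/negPn/negP => /cov[].
  have -> : frame_div g E phi i = fun=> 0.
    apply/funext => q; apply: frame_div_local => //.
    by near=> q'; exact: z.
  by rewrite Rintegral_cst // mul0r.
have [chi [oU Up chis chi1 [c [x0 [r [bV chi0]]]]]] := HU p.
pose phi1 q := phi q * chi q; pose phi2 q := phi q * (1 - chi q).
have s1 : smooth A phi1 by exact: smooth_mul.
have s2 : smooth A phi2.
  by apply: smooth_mul => //; apply: smooth_sub => //; exact: smooth_cst.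
have z1 q : ~ K q -> phi1 q = 0 by move=> /phi0 z; rewrite /phi1 z mul0r.
have z2 q : ~ K q -> phi2 q = 0 by move=> /phi0 z; rewrite /phi2 z mul0r.
have -> : frame_div g E phi i = fun q => frame_div g E phi1 i q + frame_div g E phi2 i q.
  apply/funext => q; rewrite -frame_divD //; congr frame_div.
  by apply/funext => q'; rewrite /phi1 /phi2; ring.
rewrite RintegralD //; [|exact: Kint|exact: Kint].
rewrite (integral_frame_div_chart i bV s1) ?add0r; last first.
  by move=> q /chi0 z; rewrite /phi1 z mulr0.
apply: IH => // q nz.
have [|p'] := cov q; first by apply: contraNneq nz => z; rewrite /phi2 z mul0r.
rewrite in_cons => /orP[/eqP ->|p's Uq]; last by exists p'.
by move=> /chi1 one; rewrite /phi2 one subrr mulr0 eqxx in nz.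
Unshelve. all: by end_near. Qed.

End Divergence.

(** * Families depending on a parameter *)

Section BigO.
Variables (R : realType) (M : Type) (K : set M).
Implicit Types (u v w : R -> M -> R).

(* O(|t|^k) uniformly on [K]; off [K] nothing depends on t, hence the last
   clause. *)
Definition bigO (k : nat) u : Prop :=
  (exists C d : R, 0 < d /\
     forall t p, `|t| < d -> K p -> `|u t p| <= C * `|t| ^+ k) /\
  ((0 < k)%N -> forall t p, ~ K p -> u t p = 0).

Lemma eq_bigO k u v : (forall t p, u t p = v t p) -> bigO k u -> bigO k v.
Proof. by move=> uv; have -> : v = u by apply/funext => t; apply/funext => p. Qed.

Lemma bigO_zero k : bigO k (fun=> fun=> 0).
Proof.
split=> //; exists 0, 1; split => // t p _ _.
by rewrite normr0 mul0r.
Qed.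

Lemma bigO_add k u v : bigO k u -> bigO k v -> bigO k (fun t p => u t p + v t p).
Proof.
move=> [[C [d [d0 Hu]]] zu] [[C' [d' [d0' Hv]]] zv]; split; last first.
  by move=> k0 t p nK; rewrite zu // zv // addr0.
exists (C + C'), (Num.min d d'); split; first by rewrite lt_min d0.
move=> t p; rewrite lt_min => /andP[td td'] Kp.
by rewrite mulrDl (le_trans (ler_normD _ _)) // lerD // ?Hu ?Hv.
Qed.

Lemma bigO_mul j k u v : bigO j u -> bigO k v -> bigO (j + k) (fun t p => u t p * v t p).
Proof.
move=> [[C [d [d0 Hu]]] zu] [[C' [d' [d0' Hv]]] zv]; split; last first.
  rewrite addn_gt0 => /orP[j0|k0] t p nK; first by rewrite zu // mul0r.
  by rewrite zv // mulr0.
exists (C * C'), (Num.min d d'); split; first by rewrite lt_min d0.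
move=> t p; rewrite lt_min => /andP[td td'] Kp.
rewrite exprD mulrACA normrM ler_pM //; [exact: Hu|exact: Hv].
Qed.

Lemma bigO_cst a : bigO 0 (fun=> fun=> a).
Proof.
by split=> //; exists `|a|, 1; split => // t p _ _; rewrite expr0 mulr1.
Qed.

Lemma bigOMl k u v : bigO 0 u -> bigO k v -> bigO k (fun t p => u t p * v t p).
Proof. exact: bigO_mul. Qed.

Lemma bigOMr k u v : bigO k u -> bigO 0 v -> bigO k (fun t p => u t p * v t p).
Proof. by rewrite -{2}(addn0 k); exact: bigO_mul. Qed.

Lemma bigO_scale k a u : bigO k u -> bigO k (fun t p => a * u t p).
Proof. by move=> Hu; apply: bigOMl => //; exact: bigO_cst. Qed.

Lemma bigO_opp k u : bigO k u -> bigO k (fun t p => - u t p).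
Proof.
by move=> Hu; apply: eq_bigO (bigO_scale (-1) Hu) => t p; rewrite mulN1r.
Qed.

Lemma bigO_sub k u v : bigO k u -> bigO k v -> bigO k (fun t p => u t p - v t p).
Proof. by move=> Hu Hv; apply: bigO_add => //; exact: bigO_opp. Qed.

Lemma bigOW j k u : (j <= k)%N -> bigO k u -> bigO j u.
Proof.
move=> jk [[C [d [d0 Hu]]] zu]; split; last by move=> j0; apply: zu; exact: leq_trans jk.
exists `|C|, (Num.min d 1); split; first by rewrite lt_min d0 ltr01.
move=> t p; rewrite lt_min => /andP[td t1] Kp; rewrite (le_trans (Hu t p td Kp)) //.
apply: (@le_trans _ _ (`|C| * `|t| ^+ k)); first by rewrite ler_wpM2r ?ler_norm // exprn_ge0.
by rewrite ler_wpM2l // ler_wiXn2l // ltW.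
Qed.

Lemma bigO_sum k (I : Type) (r : seq I) (P : pred I) (F : I -> R -> M -> R) :
  (forall i, P i -> bigO k (F i)) -> bigO k (fun t p => \sum_(i <- r | P i) F i t p).
Proof.
move=> HF; elim: r => [|i r IH].
  by apply: eq_bigO (bigO_zero k) => t p; rewrite big_nil.
case: (boolP (P i)) => Pi; last first.
  by apply: eq_bigO IH => t p; rewrite big_cons (negbTE Pi).
apply: eq_bigO (bigO_add (HF i Pi) IH) => t p.
by rewrite big_cons Pi.
Qed.

Definition eqO k u v := bigO k (fun t p => u t p - v t p).

Lemma eqO_eq k u v : (forall t p, u t p = v t p) -> eqO k u v.
Proof. by move=> H; apply: eq_bigO (bigO_zero k) => t p; rewrite H subrr. Qed.

Lemma eqO_trans k v u w : eqO k u v -> eqO k v w -> eqO k u w.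
Proof.
move=> H1 H2; apply: eq_bigO (bigO_add H1 H2) => t p; ring.
Qed.

Lemma eqO_sym k u v : eqO k u v -> eqO k v u.
Proof. by move=> H; apply: eq_bigO (bigO_opp H) => t p; ring. Qed.

Lemma eqO_add k u u' v v' : eqO k u u' -> eqO k v v' ->
  eqO k (fun t p => u t p + v t p) (fun t p => u' t p + v' t p).
Proof. by move=> H1 H2; apply: eq_bigO (bigO_add H1 H2) => t p; ring. Qed.

Lemma eqO_opp k u u' : eqO k u u' -> eqO k (fun t p => - u t p) (fun t p => - u' t p).
Proof. by move=> H1; apply: eq_bigO (bigO_opp H1) => t p; ring. Qed.

Lemma eqO_sub k u u' v v' : eqO k u u' -> eqO k v v' ->
  eqO k (fun t p => u t p - v t p) (fun t p => u' t p - v' t p).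
Proof. by move=> H1 H2; apply: eqO_add => //; exact: eqO_opp. Qed.

Lemma eqO_bigO k u v : eqO k u v -> bigO k v -> bigO k u.
Proof. by move=> H1 H2; apply: eq_bigO (bigO_add H1 H2) => t p; ring. Qed.

Lemma eqO0_bigO k u : eqO k u (fun=> fun=> 0) -> bigO k u.
Proof. by move=> H; apply: eq_bigO H => t p; rewrite subr0. Qed.

Lemma eqO_sum k (I : Type) (r : seq I) (P : pred I) (F F' : I -> R -> M -> R) :
  (forall i, P i -> eqO k (F i) (F' i)) ->
  eqO k (fun t p => \sum_(i <- r | P i) F i t p) (fun t p => \sum_(i <- r | P i) F' i t p).
Proof.
by move=> H; apply: eq_bigO (bigO_sum r H) => t p; rewrite sumrB.
Qed.

Lemma eqO_mul k u u' v v' : bigO 0 u -> bigO 0 v' -> eqO k u u' -> eqO k v v' ->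
  eqO k (fun t p => u t p * v t p) (fun t p => u' t p * v' t p).
Proof.
move=> bu bv H1 H2; apply: eq_bigO (bigO_add (bigOMl bu H2) (bigOMr H1 bv)) => t p.
ring.
Qed.

Lemma eqO_mul_small j k u u' v : eqO j u u' -> bigO k v ->
  eqO (j + k) (fun t p => u t p * v t p) (fun t p => u' t p * v t p).
Proof. by move=> H1 H2; apply: eq_bigO (bigO_mul H1 H2) => t p; ring. Qed.

(** The range of t is cut down until u differs from a by at most a/2, whence the bound 2/a for the
    inverse. *)
Lemma bigO0_inv u a : 0 < a -> eqO 1 u (fun=> fun=> a) -> bigO 0 (fun t p => (u t p)^-1).
Proof.
move=> a0 [[C [d [d0 Hu]]] zu]; split => //.
exists (2 / a), (Num.min d (a / (2 * (`|C| + 1)))); split.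
  by rewrite lt_min d0 divr_gt0 // mulr_gt0 // ltr_wpDl.
move=> t p; rewrite lt_min => /andP[td ta] Kp; rewrite expr0 mulr1.
have := Hu t p td Kp; rewrite expr1 => H.
have C1 : 0 < `|C| + 1 by rewrite ltr_wpDl.
have H2 : `|u t p - a| <= a / 2.
  apply: (le_trans H); apply: (@le_trans _ _ ((`|C| + 1) * `|t|)).
    by rewrite ler_wpM2r // (le_trans (ler_norm C)) // lerDl.
  rewrite (le_trans (ler_wpM2l (ltW C1) (ltW ta))) //.
  have -> : (`|C| + 1) * (a / (2 * (`|C| + 1))) = a / 2 by field; rewrite gt_eqF.
  by [].
have upos : a / 2 <= u t p.
  by move: H2; rewrite ler_norml => /andP[+ _]; lra.
have a2 : 0 < a / 2 by rewrite divr_gt0.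
have u0 : 0 < u t p by exact: lt_le_trans upos.
rewrite ger0_norm ?invr_ge0 ?(ltW u0) // -[2 / a]invrK invf_div lef_pV2 //.
Qed.

End BigO.

Lemma bigO_local (R : realType) (N : nat) (M : ptopologicalType) (A : manifold R N M)
    (K : set M) k (u : R -> M -> R) : compact K ->
  (forall p, K p -> exists W (C d : R), [/\ open W, W p, 0 < d &
    forall t q, `|t| < d -> W q -> `|u t q| <= C * `|t| ^+ k]) ->
  ((0 < k)%N -> forall t p, ~ K p -> u t p = 0) -> bigO K k u.
Proof.
move=> cK loc z; split => //.
have loc' p : exists W, (K p -> open W /\ W p) /\
    exists C d : R, 0 < d /\ forall t q, `|t| < d -> W q -> `|u t q| <= C * `|t| ^+ k.
  have [Kp|nK] := pselect (K p).
    by have [W [C [d [oW Wp d0 H]]]] := loc p Kp; exists W; split => //; exists C, d.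
  by exists set0; split => //; exists 0, 1; split.
pose W p := projT1 (cid (loc' p)).
have HW p := projT2 (cid (loc' p)); rewrite -/(W _) in HW.
have [s [_ scov]] : exists s : seq M, (forall p, p \in s -> K p) /\
    forall q, K q -> exists2 p, p \in s & W p q.
  by apply: compact_seq_cover => // p Kp; exact: (HW p).1.
suff [C [d [d0 H]]] : exists C d : R, 0 < d /\ forall t q, `|t| < d ->
    (exists2 p, p \in s & W p q) -> `|u t q| <= C * `|t| ^+ k.
  by exists C, d; split => // t p td /scov; exact: H.
elim: s {scov} => [|p s [C [d [d0 H]]]]; first by exists 0, 1; split => // t q _ [].
have [_ [C' [d' [d0' H']]]] := HW p.
exists (`|C| + `|C'|), (Num.min d d'); split; first by rewrite lt_min d0.
move=> t q; rewrite lt_min => /andP[td td'] [p'].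
have tk : 0 <= `|t| ^+ k by exact: exprn_ge0.
rewrite in_cons => /orP[/eqP ->|p's] Wq.
  rewrite (le_trans (H' t q td' Wq)) // ler_wpM2r // (le_trans (ler_norm _)) //.
  by rewrite lerDr.
have Hq : `|u t q| <= C * `|t| ^+ k by apply: H => //; exists p'.
rewrite (le_trans Hq) // ler_wpM2r // (le_trans (ler_norm _)) //.
by rewrite lerDl.
Qed.

(** * Families close to constants, and Cholesky factors within them *)

Section Admissible.
Variables (R : realType) (N : nat) (M : ptopologicalType) (A : manifold R N M).
Variables (g : metric R M) (E : 'I_N -> vfield R M) (K : set M).
Hypotheses (frE : orthoframe A g E) (cK : compact K).
Let Ev i : is_vfield A (E i). Proof. by case: frE. Qed.
Let Et i p : tangent_at A p (E i p). Proof. exact: vfield_tangent. Qed.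
Implicit Types (u v : R -> M -> R).

Lemma bigO_static (f : M -> R) : smooth A f -> bigO K 0 (fun=> f).
Proof.
move=> sf; split => //.
have [C HC] := @compact_continuous_bound R _ K f cK (fun x _ => smooth_continuous sf (x := x)).
by exists C, 1; split => // t p _ Kp; rewrite expr0 mulr1; exact: HC.
Qed.

(* Together with its derivatives along the frame, [u t] is O(t)-close to the
   constant [a]; this survives division and square roots. *)
Definition adm (a : R) u := [/\ forall t, smooth A (u t),
  eqO K 1 u (fun=> fun=> a) & forall i, bigO K 1 (fun t p => E i p (u t))].

Lemma adm_bigO0 a u : adm a u -> bigO K 0 u.
Proof.
move=> [_ H _]; apply: eqO_bigO (bigO_cst K a).
by apply: bigOW H.
Qed.

Lemma adm_eq a u v : (forall t p, u t p = v t p) -> adm a u -> adm a v.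
Proof.
by move=> uv; have -> : v = u by apply/funext => t; apply/funext => p.
Qed.

Lemma adm_cst a : adm a (fun=> fun=> a).
Proof.
split=> [t||i]; [exact: smooth_cst|exact: eqO_eq|].
apply: (@eq_bigO _ _ K 1 (fun=> fun=> 0)); last exact: bigO_zero.
  by move=> t p; rewrite (tangent_cst (Et i p)).
Qed.

Lemma adm_add a b u v : adm a u -> adm b v -> adm (a + b) (fun t p => u t p + v t p).
Proof.
move=> [su eu du] [sv ev dv]; split=> [t||i].
- exact: smooth_add.
- exact: eqO_add.
- apply: eq_bigO (bigO_add (du i) (dv i)) => t p.
  by rewrite (tangentD (Et i p)).
Qed.

Lemma adm_mul a b u v : adm a u -> adm b v -> adm (a * b) (fun t p => u t p * v t p).
Proof.
move=> Hu Hv; have bu := adm_bigO0 Hu; have bv := adm_bigO0 Hv.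
case: Hu => su eu du; case: Hv => sv ev dv; split=> [t||i].
- exact: smooth_mul.
- by apply: eqO_mul => //; exact: bigO_cst.
- apply: eq_bigO (bigO_add (bigOMr (du i) bv) (bigOMl bu (dv i))) => t p.
  by rewrite (tangentM (Et i p)).
Qed.

Lemma adm_opp a u : adm a u -> adm (- a) (fun t p => - u t p).
Proof.
move=> Hu; rewrite -mulN1r; apply: adm_eq (adm_mul (adm_cst (-1)) Hu) => t p.
by rewrite mulN1r.
Qed.

Lemma adm_sub a b u v : adm a u -> adm b v -> adm (a - b) (fun t p => u t p - v t p).
Proof. by move=> Hu Hv; apply: adm_add => //; exact: adm_opp. Qed.

Lemma adm_sum (I : Type) (r : seq I) (a : I -> R) (F : I -> R -> M -> R) :
  (forall i, adm (a i) (F i)) ->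
  adm (\sum_(i <- r) a i) (fun t p => \sum_(i <- r) F i t p).
Proof.
move=> HF; elim: r => [|i r IH].
  rewrite big_nil; apply: adm_eq (adm_cst 0) => t p; by rewrite big_nil.
rewrite big_cons; apply: adm_eq (adm_add (HF i) IH) => t p.
by rewrite big_cons.
Qed.

(** The O(t) bound is exact at t = 0. In particular a inherits positivity from u, which inverses and
    square roots require. *)
Lemma adm_value0 a u p : adm a u -> u 0 p = a.
Proof.
move=> [_ [[C [d [d0 H]]] z] _]; have [Kp|nK] := pselect (K p).
  have := H 0 p; rewrite normr0 expr1 mulr0 => /(_ d0 Kp).
  by rewrite normr_le0 subr_eq0 => /eqP.
by have := z isT 0 p nK => /eqP; rewrite subr_eq0 => /eqP.
Qed.

Lemma adm_inv a u : (forall t p, 0 < u t p) -> adm a u -> adm a^-1 (fun t p => (u t p)^-1).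
Proof.
move=> u0 Hu; have a0 : 0 < a by rewrite -(adm_value0 point Hu).
have u0' t p : u t p != 0 by rewrite gt_eqF.
case: Hu => su eu du; have bi := bigO0_inv a0 eu; split=> [t||i].
- exact: smooth_inv.
- apply: eq_bigO (bigO_scale (- a^-1) (bigOMl bi eu)) => t p.
  by field; rewrite gt_eqF //= u0'.
- apply: eq_bigO (bigO_opp (bigOMl (bigO_mul bi bi) (du i))) => t p.
  rewrite (tangentV (Et i p)) //; field; exact: u0'.
Qed.

Lemma adm_sqrt a u : (forall t p, 0 < u t p) -> adm a u ->
  adm (Num.sqrt a) (fun t p => Num.sqrt (u t p)).
Proof.
move=> u0 Hu; have a0 : 0 < a by rewrite -(adm_value0 point Hu).
have sa0 : 0 < Num.sqrt a by rewrite sqrtr_gt0.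
have su0 t p : 0 < Num.sqrt (u t p) by rewrite sqrtr_gt0.
case: Hu => su eu du.
have e1 : eqO K 1 (fun t p => Num.sqrt (u t p)) (fun=> fun=> Num.sqrt a).
  have b : bigO K 0 (fun t p => (Num.sqrt (u t p) + Num.sqrt a)^-1).
    split=> //; exists (Num.sqrt a)^-1, 1; split => // t p _ _; rewrite expr0 mulr1.
    rewrite ger0_norm ?invr_ge0 ?addr_ge0 ?sqrtr_ge0 // lef_pV2 ?posrE ?addr_gt0 //.
    by rewrite lerDr sqrtr_ge0.
  apply: eq_bigO (bigOMl b eu) => t p.
  have -> : u t p - a = (Num.sqrt (u t p) - Num.sqrt a) * (Num.sqrt (u t p) + Num.sqrt a).
    by rewrite -subr_sqr !sqr_sqrtr ?ltW.
  by rewrite mulrCA mulVf ?mulr1 // gt_eqF // addr_gt0.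
split=> [t||i]; [exact: smooth_sqrt|exact: e1|].
have bi := bigO0_inv sa0 e1.
apply: eq_bigO (bigO_scale 2^-1 (bigOMl bi (du i))) => t p.
by rewrite (tangent_sqrt (Et i p)) //; field; rewrite gt_eqF.
Qed.

(** Gram-Schmidt in matrix form: a lower triangular L taking the Gram matrix to 1, by induction
    through the Schur complement. Only field operations and square roots of positive functions
    occur, so entries stay admissible. *)
Lemma adm_cholesky m (G : R -> M -> 'M[R]_m) :
  (forall i j, adm (i == j)%:R (fun t p => G t p i j)) ->
  (forall t p i j, G t p i j = G t p j i) ->
  (forall t p (x : 'rV[R]_m), x != 0 -> 0 < (x *m G t p *m x^T) ord0 ord0) ->
  exists L : R -> M -> 'M[R]_m, (forall i j, adm (i == j)%:R (fun t p => L t p i j)) /\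
    forall t p, L t p *m G t p *m (L t p)^T = 1%:M.
Proof.
elim: m G => [|m IH] G aG sG pG.
  by exists (fun _ _ => 1%:M); split=> [[]|t p] //; apply/matrixP => -[].
pose a t p := G t p ord0 ord0.
have a0 t p : 0 < a t p.
  have := pG t p (delta_mx ord0 ord0); rewrite -rowE trmx_delta mxE.
  rewrite (bigD1 ord0) //= big1 ?addr0 => [|j j0].
    rewrite !mxE eqxx mulr1; apply; apply/eqP => /matrixP/(_ ord0 ord0).
    by rewrite !mxE eqxx => /eqP; rewrite oner_eq0.
  by rewrite !mxE (negbTE j0) mulr0.
have aa : adm 1 a by have := aG ord0 ord0.
have ai := adm_inv a0 aa.
pose s t p := (Num.sqrt (a t p))^-1.
have sq0 t p : 0 < Num.sqrt (a t p) by rewrite sqrtr_gt0.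
have as_ : adm 1 s by have := adm_inv sq0 (adm_sqrt a0 aa); rewrite sqrtr1 invr1.
pose b t p i := G t p (lift ord0 i) ord0.
have ab i : adm 0 (fun t p => b t p i) by have := aG (lift ord0 i) ord0.
pose S t p : 'M[R]_m := \matrix_(i, j)
  (G t p (lift ord0 i) (lift ord0 j) - b t p i * b t p j * (a t p)^-1).
have aS i j : adm (i == j)%:R (fun t p => S t p i j).
  have := adm_sub (aG (lift ord0 i) (lift ord0 j)) (adm_mul (adm_mul (ab i) (ab j)) ai).
  rewrite !mul0r subr0 (inj_eq (@lift_inj _ ord0)); apply: adm_eq => t p.
  by rewrite mxE.
have sS t p i j : S t p i j = S t p j i by rewrite !mxE sG [b _ _ i * _]mulrC.
have quad k (Q : 'M[R]_k) (x : 'rV[R]_k) :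
    (x *m Q *m x^T) ord0 ord0 = \sum_i \sum_j x ord0 i * Q i j * x ord0 j.
  rewrite mxE exchange_big /=; apply: eq_bigr => j _.
  by rewrite !mxE mulr_suml.
have pS t p (x : 'rV[R]_m) : x != 0 -> 0 < (x *m S t p *m x^T) ord0 ord0.
  (* Completing the square: with this first coordinate the quadratic form of G at y equals that of
     the Schur complement at x. *)
  move=> x0; pose c := - (\sum_i x ord0 i * b t p i) / a t p.
  pose y : 'rV[R]_m.+1 := \row_i if unlift ord0 i is Some k then x ord0 k else c.
  have y0 : y != 0.
    apply: contraNneq x0 => y0; apply/eqP/rowP => i; rewrite mxE.
    by have := congr1 (fun z : 'rV[R]_m.+1 => z ord0 (lift ord0 i)) y0; rewrite !mxE liftK.
  have := pG t p y y0; rewrite !quad.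
  rewrite big_ord_recl (big_ord_recl m).
  have yS i : y ord0 (lift ord0 i) = x ord0 i by rewrite mxE liftK.
  have yc : y ord0 ord0 = c by rewrite mxE unlift_none.
  rewrite yc -/(a t p).
  under [X in _ + X + _]eq_bigr => j _ do rewrite yS sG -/(b t p j).
  under [X in _ + _ + X]eq_bigr => i _.
    rewrite big_ord_recl yc yS -/(b t p i).
    under eq_bigr => j _ do rewrite yS.
    over.
  rewrite big_split /=.
  set T := \sum_(i < m) \sum_(j < m) _.
  have -> : \sum_i \sum_j x ord0 i * S t p i j * x ord0 j =
      T - (\sum_i x ord0 i * b t p i) * (\sum_i x ord0 i * b t p i) * (a t p)^-1.
    rewrite -mulrA mulr_suml -sumrB; apply: eq_bigr => i _.
    rewrite mulr_suml mulr_sumr -sumrB; apply: eq_bigr => j _.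
    by rewrite mxE; ring.
  have -> : \sum_(i < m) c * b t p i * x ord0 i = c * \sum_i x ord0 i * b t p i.
    by rewrite mulr_sumr; apply: eq_bigr => i _; ring.
  have -> : \sum_(i < m) x ord0 i * b t p i * c = c * \sum_i x ord0 i * b t p i.
    by rewrite mulr_sumr; apply: eq_bigr => i _; ring.
  rewrite /c; set B := \sum_i _.
  rewrite (_ : _ + _ = T - B * B * (a t p)^-1) //; field.
  by rewrite gt_eqF.
have [L' [aL' HL']] := IH S aS sS pS.
(* Chosen to make the later rows of L orthogonal, with respect to G, to the first basis vector. *)
pose w t p i := - (\sum_k L' t p i k * b t p k) * (a t p)^-1.
have aw i : adm 0 (fun t p => w t p i).
  have := adm_sum (index_enum 'I_m) (fun k => adm_mul (aL' i k) (ab k)) => H.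
  have := adm_mul (adm_opp H) ai; rewrite big1 ?oppr0 ?mul0r // => k _.
  by rewrite mulr0.
pose L t p : 'M[R]_m.+1 := \matrix_(i, j)
  match unlift ord0 i, unlift ord0 j with
  | None, None => s t p | None, Some _ => 0
  | Some i', None => w t p i' | Some i', Some j' => L' t p i' j' end.
have L00 t p : L t p ord0 ord0 = s t p by rewrite mxE unlift_none.
have L0S t p j : L t p ord0 (lift ord0 j) = 0 by rewrite mxE unlift_none liftK.
have LS0 t p i : L t p (lift ord0 i) ord0 = w t p i by rewrite mxE unlift_none liftK.
have LSS t p i j : L t p (lift ord0 i) (lift ord0 j) = L' t p i j by rewrite mxE !liftK.
exists L; split.
  move=> i j; case: (unliftP ord0 i) => [i' ->|->]; case: (unliftP ord0 j) => [j' ->|->].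
  - by rewrite (inj_eq (@lift_inj _ ord0)); apply: adm_eq (aL' i' j') => t p; rewrite LSS.
  - by apply: adm_eq (aw i') => t p; rewrite LS0.
  - by apply: adm_eq (adm_cst 0) => t p; rewrite L0S.
  - by rewrite eqxx; apply: adm_eq as_ => t p; rewrite L00.
move=> t p.
have LG i j : (L t p *m G t p *m (L t p)^T) i j =
    \sum_k \sum_l L t p i k * G t p k l * L t p j l.
  by rewrite mxE exchange_big /=; apply: eq_bigr => l _; rewrite !mxE mulr_suml.
have an : a t p != 0 by rewrite gt_eqF.
have row0 j : (L t p *m G t p *m (L t p)^T) ord0 j = \sum_l s t p * G t p ord0 l * L t p j l.
  rewrite LG big_ord_recl [X in _ + X]big1 ?addr0 => [|k _].
    by apply: eq_bigr => l _; rewrite L00.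
  by rewrite big1 // => l _; rewrite L0S !mul0r.
have wb i : w t p i * a t p + \sum_k L' t p i k * b t p k = 0.
  by rewrite /w mulrVK ?unitfE // addNr.
have e0S j : \sum_l s t p * G t p ord0 l * L t p (lift ord0 j) l = 0.
  rewrite big_ord_recl LS0 -/(a t p).
  under eq_bigr => l _ do rewrite LSS sG -/(b t p l).
  transitivity (s t p * (w t p j * a t p + \sum_k L' t p j k * b t p k)).
    rewrite mulrDr mulr_sumr; congr (_ + _); first by ring.
    by apply: eq_bigr => l _; ring.
  by rewrite wb mulr0.
apply/matrixP => i j; rewrite [RHS]mxE.
case: (unliftP ord0 i) => [i' ->|->]; last first.
  rewrite row0; case: (unliftP ord0 j) => [j' ->|->]; first by rewrite e0S.
  rewrite big_ord_recl big1 ?addr0 => [|l _]; last by rewrite L0S mulr0.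
  rewrite L00 -/(a t p) eqxx /s.
  have := sqr_sqrtr (ltW (a0 t p)); have := sq0 t p.
  by rewrite mulr1n; move: (Num.sqrt _) => q q0 <-; field; rewrite gt_eqF.
case: (unliftP ord0 j) => [j' ->|->]; last first.
  rewrite LG exchange_big /= -[RHS](e0S i') big_ord_recl.
  rewrite [X in _ + X = _]big1 ?addr0 => [|l _]; last first.
    by rewrite big1 // => k _; rewrite L0S mulr0.
  by apply: eq_bigr => k _; rewrite L00 sG; ring.
rewrite (inj_eq (@lift_inj _ ord0)).
have := HL' t p => /matrixP/(_ i' j'); rewrite [RHS]mxE => <-.
have -> : (L' t p *m S t p *m (L' t p)^T) i' j' =
    \sum_k \sum_l L' t p i' k * S t p k l * L' t p j' l.
  by rewrite mxE exchange_big /=; apply: eq_bigr => l _; rewrite !mxE mulr_suml.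
rewrite LG big_ord_recl big_ord_recl -/(a t p) !LS0.
under [X in _ + X + _]eq_bigr => l _ do rewrite LSS sG -/(b t p l).
under [X in _ + _ + X]eq_bigr => k _.
  rewrite big_ord_recl LS0 LSS -/(b t p k).
  under eq_bigr => l _ do rewrite !LSS.
  over.
rewrite big_split /=.
set T := \sum_(k < m) \sum_(l < m) _.
pose X i := \sum_k L' t p i k * b t p k.
have -> : \sum_(k < m) \sum_(l < m) L' t p i' k * S t p k l * L' t p j' l =
    T - X i' * X j' * (a t p)^-1.
  rewrite -mulrA mulr_suml -sumrB; apply: eq_bigr => k _.
  rewrite mulr_suml mulr_sumr -sumrB; apply: eq_bigr => l _.
  by rewrite mxE; ring.
have -> : \sum_(l < m) w t p i' * b t p l * L' t p j' l = w t p i' * X j'.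
  by rewrite mulr_sumr; apply: eq_bigr => l _; ring.
have -> : \sum_(k < m) L' t p i' k * b t p k * w t p j' = X i' * w t p j'.
  by rewrite mulr_suml.
by rewrite /w -/(X i') -/(X j'); field.
Qed.

End Admissible.

(** * Variations of the metric *)

Section TimeFamilies.
Variables (R : realType) (N : nat).
Implicit Types (F : 'rV[R]_N.+1 -> R) (U : set 'rV[R]_N.+1) (x : 'rV[R]_N) (t : R).
Local Notation e0 := (delta_mx ord0 ord0 : 'rV[R]_N.+1).

Lemma row_cons_time t x : row_cons (t, x) = t *: e0 + row_cons (0, x).
Proof.
apply/rowP => j; rewrite [RHS]mxE [X in X + _]mxE [X in _ * X + _]mxE.
case: (unliftP ord0 j) => [i ->|->].
  by rewrite !row_consS /= mulr0 add0r.
by rewrite !row_cons0 /= mulr1 addr0.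
Qed.

Lemma row_cons_space t s j x : row_cons (t, s *: delta_mx ord0 j + x) =
  s *: delta_mx ord0 (lift ord0 j) + row_cons (t, x).
Proof.
apply/rowP => i; rewrite [RHS]mxE [X in _ = X + _]mxE [X in _ = _ * X + _]mxE.
case: (unliftP ord0 i) => [k ->|->].
  by rewrite !row_consS (inj_eq (@lift_inj _ ord0)) !mxE.
by rewrite !row_cons0 /= mulr0 add0r.
Qed.

Lemma is_derive_time F t x : derivable F (row_cons (t, x)) e0 ->
  is_derive t (1 : R) (fun r => F (row_cons (r, x))) ('D_e0 F (row_cons (t, x))).
Proof.
move=> dF.
have -> : (fun r => F (row_cons (r, x))) = (fun r => F (r *: e0 + row_cons (0, x))).
  by apply/funext => r; rewrite row_cons_time.
apply: (iffLR (is_derive_line F (row_cons (0, x)) e0 t _)).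
rewrite -row_cons_time; exact: DeriveDef.
Qed.

Lemma derive_space F t x j : derivable F (row_cons (t, x)) (delta_mx ord0 (lift ord0 j)) ->
  'D_(delta_mx ord0 j) (fun y => F (row_cons (t, y))) x =
  'D_(delta_mx ord0 (lift ord0 j)) F (row_cons (t, x)).
Proof.
move=> dF; apply: (@derive_val _ _ _ _ _ _ _ _).
apply: (iffRL (is_derive_line0 (fun y => F (row_cons (t, y))) x (delta_mx ord0 j) _)).
have -> : (fun s : R => F (row_cons (t, s *: delta_mx ord0 j + x))) =
    (fun s : R => F (s *: delta_mx ord0 (lift ord0 j) + row_cons (t, x))).
  by apply/funext => s; rewrite row_cons_space.
apply: (iffLR (is_derive_line0 F _ _ _)); exact: DeriveDef.
Qed.

Lemma time_box F U x0 : nbhs (row_cons (0, x0)) U ->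
  {for row_cons (0, x0), continuous F} ->
  exists C d, [/\ 0 < d, 0 <= C & forall t x, `|t| <= d -> box x0 d x ->
    U (row_cons (t, x)) /\ `|F (row_cons (t, x))| <= C].
Proof.
move=> nU cF; set z0 := row_cons (0, x0).
have nF : nbhs z0 [set z | `|F z| <= `|F z0| + 1].
  have : nbhs z0 (F @^-1` [set y | `|F z0 - y| < 1]) by apply: cF; exact: nbhsx_ballx.
  apply: filterS => z /= Hz; rewrite -[F z](subrKC (F z0)) (le_trans (ler_normD _ _)) //.
  by rewrite lerD2l distrC ltW // distrC.
have [d d0 Hd] := nbhs_sub_box (filterI nU nF).
exists (`|F z0| + 1), d; split=> // t x td bx; apply: Hd => j.
case: (unliftP ord0 j) => [i ->|->]; rewrite ?row_consS ?row_cons0 /=; first exact: bx.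
by rewrite subr0.
Qed.

Lemma time_lipschitz F U x0 : nbhs (row_cons (0, x0)) U -> smooth_on U F ->
  exists C d, [/\ 0 < d, 0 <= C & forall t x, `|t| < d -> box x0 d x ->
    `|F (row_cons (t, x)) - F (row_cons (0, x))| <= C * `|t|].
Proof.
move=> nU sF; have Uz := nbhs_singleton nU.
have [C [d [d0 C0 H]]] := time_box nU (smooth_on_continuous (smooth_on_derive e0 sF) Uz).
exists C, d; split=> // t x td bx.
apply: (@mean_value_bound _ (fun t => F (row_cons (t, x)))
  (fun t => 'D_e0 F (row_cons (t, x)))) => r rt.
  apply: is_derive_time; apply: (@smooth_on_derivable _ _ _ _ _ _ sF).
  by have [] := H r x (le_trans rt (ltW td)) bx.
by have [] := H r x (le_trans rt (ltW td)) bx.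
Qed.

(** The constant is a local bound of the second time derivative, so it serves all x near x0 at which
    the first one vanishes. *)
Lemma time_quadratic F U x0 : nbhs (row_cons (0, x0)) U -> smooth_on U F ->
  exists C d, [/\ 0 < d, 0 <= C & forall t x, `|t| < d -> box x0 d x ->
    'D_e0 F (row_cons (0, x)) = 0 ->
    `|F (row_cons (t, x)) - F (row_cons (0, x))| <= C * `|t| ^+ 2].
Proof.
move=> nU sF; have Uz := nbhs_singleton nU.
have sF' := smooth_on_derive e0 sF.
have [C [d [d0 C0 H]]] := time_box nU (smooth_on_continuous (smooth_on_derive e0 sF') Uz).
exists C, d; split=> // t x td bx z.
have := @taylor_bound _ (fun t => F (row_cons (t, x))) (fun t => 'D_e0 F (row_cons (t, x)))
  (fun t => 'D_e0 (fun y => 'D_e0 F y) (row_cons (t, x))) C t.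
rewrite z mulr0 subr0 real_normK ?num_real //; apply=> r rt; first last.
- by have [] := H r x (le_trans rt (ltW td)) bx.
- apply: (@is_derive_time (fun y => 'D_e0 F y)); apply: (@smooth_on_derivable _ _ _ _ _ _ sF').
  by have [] := H r x (le_trans rt (ltW td)) bx.
apply: is_derive_time; apply: (@smooth_on_derivable _ _ _ _ _ _ sF).
by have [] := H r x (le_trans rt (ltW td)) bx.
Qed.

End TimeFamilies.

Section VariationEstimates.
Variables (R : realType) (N : nat) (M : ptopologicalType) (A : manifold R N M).
Variables (g : metric R M) (E : 'I_N -> vfield R M).
Variables (Omega : set M) (eps : R) (gt : R -> metric R M).
Hypotheses (frE : orthoframe A g E) (aO : admissible_domain Omega).
Hypothesis var : metric_variation A Omega eps g gt.
Let gr : riemannian_metric A g. Proof. by case: frE. Qed.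
Let Ev i : is_vfield A (E i). Proof. by case: frE. Qed.
Let Et i p : tangent_at A p (E i p). Proof. exact: vfield_tangent. Qed.
Let eps0 : 0 < eps. Proof. by case: var. Qed.
Local Notation cdom c := (coord A c @` dom A c).

Let K : set M := variation_support A eps g gt.

Lemma variation_support_compact : compact K.
Proof.
have [_ cO _] := aO; have [_ _ _ _ KO] := var.
apply: (subclosed_compact _ cO); first exact: closed_closure.
exact: subset_trans KO (@subset_closure _ _).
Qed.

(* Freezing the family at [g] for |t| >= eps turns all statements on it into
   statements for every t. *)
Definition extended_family t : metric R M := if `|t| < eps then gt t else g.
Local Notation h := extended_family.

Lemma extended_metric t : riemannian_metric A (h t).
Proof. by rewrite /h; case: ifP => // te; have [_ H _ _ _] := var; exact: H. Qed.

Lemma extended_off t p : ~ K p -> same_metric_at A g (h t) p.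
Proof.
move=> nK; rewrite /h; case: ifP => te; last by move=> u v.
by apply: contrapT => nS; apply: nK; apply: subset_closure; exists t.
Qed.

Lemma extended0 p : same_metric_at A g (h 0) p.
Proof. by rewrite /h normr0 eps0; have [_ _ H _ _] := var; exact: H. Qed.

Let H i j t p := h t p (E i p) (E j p).

Lemma extended_component_off i j t p : ~ K p -> H i j t p = (i == j)%:R.
Proof. by move=> nK; have [_ _ Eo _] := frE; rewrite -(Eo p) (extended_off t nK). Qed.

Lemma extended_component0 i j p : H i j 0 p = (i == j)%:R.
Proof. by have [_ _ Eo _] := frE; rewrite -(Eo p) (extended0 (p := p)). Qed.

Lemma extended_smooth i j t : smooth A (H i j t).
Proof. exact: smooth_metric (extended_metric t) (Ev i) (Ev j). Qed.

Let time_dom c : set 'rV[R]_(1 + N) :=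
  [set z : 'rV[R]_(1 + N) | `|z ord0 ord0| < eps /\ cdom c (rsubmx z)].

Let time_dom_nbhs c x : cdom c x -> nbhs (row_cons (0, x)) (time_dom c).
Proof.
move=> cx; have [r r0 Hr] := nbhs_sub_box (open_nbhs_nbhs (conj (coord_open (c := c)) cx)).
apply: (@filterS _ (nbhs (row_cons (0, x))) _ (box (row_cons (0, x)) (Num.min r (eps / 2)))).
  move=> z Hz; split.
    have := Hz ord0; rewrite row_cons0 subr0 le_min => /andP[_].
    by move=> H1; apply: (le_lt_trans H1); rewrite ltr_pdivrMr // ltr_pMr // ltr1n.
  apply: Hr => j; have := Hz (lift ord0 j); rewrite row_consS le_min => /andP[+ _].
  by rewrite mxE; congr (`| z _ _ - _| <= _); exact: val_inj.
by apply: nbhs_box; rewrite lt_min r0 divr_gt0.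
Qed.

Let F c i j (z : 'rV[R]_(1 + N)) := let q := param A c (rsubmx z) in
  gt (z ord0 ord0) q (E i q) (E j q).

Let F_smooth c i j : smooth_on (time_dom c) (F c i j).
Proof. by have [_ _ _ + _] := var => /(_ (E i) (E j) c (Ev i) (Ev j)). Qed.

Let FE c i j t : `|t| < eps -> H i j t \o param A c = (fun y => F c i j (row_cons (t, y))).
Proof.
move=> te; apply/funext => y; rewrite /H /h te /F row_cons0 /=.
by rewrite /row_cons row_mxKr.
Qed.

Let box_nbhs c p d : dom A c p -> 0 < d ->
  nbhs p (dom A c `&` (coord A c @^-1` box (coord A c p) d)).
Proof. by move=> cp d0; apply: nbhs_coord => //; exact: nbhs_box. Qed.

Lemma extended_component_bigO i j : eqO K 1 (H i j) (fun=> fun=> (i == j)%:R).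
Proof.
apply: (bigO_local A variation_support_compact) => [p Kp|_ t p nK]; last first.
  by rewrite extended_component_off // subrr.
have [c cp] := dom_cover A p.
have [C [d [d0 C0 HC]]] := time_lipschitz (time_dom_nbhs (cdomE cp)) (@F_smooth c i j).
exists (dom A c `&` (coord A c @^-1` box (coord A c p) d))°, C, (Num.min d eps); split.
- exact: open_interior.
- exact: box_nbhs.
- by rewrite lt_min d0.
move=> t q; rewrite lt_min => /andP[td te] /interior_subset[cq bq].
have HF s : `|s| < eps -> F c i j (row_cons (s, coord A c q)) = H i j s q.
  by move=> se; have := congr1 (@^~ (coord A c q)) (FE c i j se) => /= <-; rewrite coordK.
have := HC t _ td bq; rewrite !HF ?normr0 // extended_component0.
by rewrite expr1.
Qed.

(** Joint smoothness in t and x makes each coordinate derivative of the component Lipschitz in t,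
    and at t = 0 it is the derivative of a constant. Along E_k these are combined with bounded
    coefficients. *)
Lemma extended_component_adm i j : adm A E K (i == j)%:R (H i j).
Proof.
split=> [t||k]; [exact: extended_smooth|exact: extended_component_bigO|].
apply: (bigO_local A variation_support_compact) => [p Kp|_ t p nK]; last first.
  have oK : open (~` K) by apply: closed_openC; exact: closed_closure.
  have := @frame_local _ _ _ _ _ _ frE k p (fun q => H i j t q - (i == j)%:R).
  rewrite (tangentB (Et k p)) ?(tangent_cst (Et k p)) ?subr0; last 2 first.
  - exact: extended_smooth.
  - exact: smooth_cst.
  apply; first by apply: smooth_sub; [exact: extended_smooth|exact: smooth_cst].
  have : nbhs p (~` K) by exact: open_nbhs_nbhs.
  by apply: filterS => q nKq; rewrite extended_component_off // subrr.
have [c cp] := dom_cover A p.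
have [zeta [W [oW Wp Wd zs HW]]] := frame_coordinates frE cp.
have loc l : exists C d (V : set M), [/\ 0 < d, nbhs p V & forall t q, `|t| < d -> V q ->
    `|E k q (zeta l) * coord_vec c l q (H i j t)| <= C * `|t|].
  have sF := smooth_on_derive (delta_mx ord0 (lift ord0 l)) (@F_smooth c i j).
  have [C [d [d0 C0 HC]]] := time_lipschitz (time_dom_nbhs (cdomE cp)) sF.
  have cz : {for p, continuous (fun q => E k q (zeta l))}.
    by apply: smooth_continuous; exact: vfield_smooth.
  have nz : nbhs p [set q | `|E k q (zeta l)| <= `|E k p (zeta l)| + 1].
    have : nbhs p ((fun q => E k q (zeta l)) @^-1` [set y | `|E k p (zeta l) - y| < 1]).
      by apply: cz; exact: nbhsx_ballx.
    apply: filterS => q /= Hq.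
    rewrite -[E k q (zeta l)](subrKC (E k p (zeta l))) (le_trans (ler_normD _ _)) //.
    by rewrite lerD2l distrC ltW // distrC.
  exists ((`|E k p (zeta l)| + 1) * C), (Num.min d eps),
    ((dom A c `&` (coord A c @^-1` box (coord A c p) d)) `&`
     [set q | `|E k q (zeta l)| <= `|E k p (zeta l)| + 1]); split.
  - by rewrite lt_min d0.
  - exact: filterI (box_nbhs cp d0) nz.
  move=> t q; rewrite lt_min => /andP[td te] [[cq bq] zq].
  have HF s : `|s| < eps -> 'D_(delta_mx ord0 (lift ord0 l)) (F c i j)
      (row_cons (s, coord A c q)) = coord_vec c l q (H i j s).
    move=> se; rewrite coord_vecE; last exact: extended_smooth.
    rewrite (FE c i j se) derive_space //.
    apply: (@smooth_on_derivable _ _ _ _ _ _ (@F_smooth c i j)).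
    split; first by rewrite row_cons0.
    by rewrite /row_cons row_mxKr; exact: cdomE.
  have := HC t _ td bq; rewrite !HF ?normr0 //.
  have -> : coord_vec c l q (H i j 0) = 0.
    rewrite (_ : H i j 0 = fun=> (i == j)%:R).
      exact: (tangent_cst (coord_vec_tangent l cq)).
    by apply/funext => q'; rewrite extended_component0.
  by rewrite subr0 => Hb; rewrite normrM -mulrA ler_pM.
pose C l := projT1 (cid (loc l)).
have loc2 l := projT2 (cid (loc l)); rewrite -/(C _) in loc2.
pose d l := projT1 (cid (loc2 l)).
have loc3 l := projT2 (cid (loc2 l)); rewrite -/(d _) in loc3.
pose V l := projT1 (cid (loc3 l)).
have loc4 l := projT2 (cid (loc3 l)); rewrite -/(V _) in loc4.
pose VV := [set q | forall l, V l q].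
have nVV : nbhs p VV by apply: filter_forall => l; have [] := loc4 l.
exists (W `&` VV)°, (\sum_l C l), (\big[Num.min/1]_l d l); split.
- exact: open_interior.
- by apply: filterI => //; exact: open_nbhs_nbhs.
- by apply: lt_bigmin => // l _; have [] := loc4 l.
move=> t q td /interior_subset[Wq Vq].
have [_ -> _ _] := HW q Wq; rewrite tvec_sumE expr1 mulr_suml.
rewrite (le_trans (ler_norm_sum _ _ _)) //; apply: ler_sum => l _.
have [_ _ Hl] := loc4 l; rewrite tvecZE; apply: Hl; last exact: (Vq l).
by apply: (lt_le_trans td); exact: bigmin_le.
Qed.

(** This turns the condition on the first derivative of g_t(xi, xi) into a uniform O(t^2)
    estimate. *)
Lemma extended_component_flat i : (forall p, is_derive (0 : R) (1 : R)
    (fun t => gt t p (E i p) (E i p)) 0) -> eqO K 2 (H i i) (fun=> fun=> 1).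
Proof.
move=> D0; apply: (bigO_local A variation_support_compact) => [p Kp|_ t p nK]; last first.
  by rewrite extended_component_off // eqxx subrr.
have [c cp] := dom_cover A p.
have [C [d [d0 C0 HC]]] := time_quadratic (time_dom_nbhs (cdomE cp)) (@F_smooth c i i).
exists (dom A c `&` (coord A c @^-1` box (coord A c p) d))°, C, (Num.min d eps); split.
- exact: open_interior.
- exact: box_nbhs.
- by rewrite lt_min d0.
move=> t q; rewrite lt_min => /andP[td te] /interior_subset[cq bq].
have HF s : `|s| < eps -> F c i i (row_cons (s, coord A c q)) = H i i s q.
  by move=> se; have := congr1 (@^~ (coord A c q)) (FE c i i se) => /= <-; rewrite coordK.
have := HC t _ td bq; rewrite !HF ?normr0 // extended_component0 eqxx; apply.
have dF : derivable (F c i i) (row_cons (0, coord A c q)) (delta_mx ord0 ord0).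
  apply: (@smooth_on_derivable _ _ _ _ _ _ (@F_smooth c i i)).
  split; first by rewrite row_cons0 normr0.
  by rewrite /row_cons row_mxKr; exact: cdomE.
have D1 := @is_derive_time _ _ _ _ _ dF; rewrite -(@derive_val _ _ _ _ _ _ _ D1).
have -> : (fun r => F c i i (row_cons (r, coord A c q))) = (fun t => gt t q (E i q) (E i q)).
  by apply/funext => r; rewrite /F row_cons0 /row_cons row_mxKr coordK.
exact: (@derive_val _ _ _ _ _ _ _ (D0 q)).
Qed.

End VariationEstimates.

(** * First-order expansion of the structure functions *)

Section FrameChange.
Variables (R : realType) (N : nat) (M : ptopologicalType) (A : manifold R N M).
Variables (I : finType) (g h : metric R M) (F E : I -> vfield R M).
Hypotheses (frF : orthoframe A g F) (frE : orthoframe A h E).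
Let Ev i : is_vfield A (E i). Proof. by case: frE. Qed.
Let Fv i : is_vfield A (F i). Proof. by case: frF. Qed.
Local Notation L i j := (fcomp g F (E i) j).

Lemma frame_change_derive i p u : E i p u = \sum_j L i j p * F j p u.
Proof.
by rewrite [in LHS](fcompE frF p (Ev i)) tvec_sumE; apply: eq_bigr => j _; rewrite tvecZE.
Qed.

Lemma frame_change_metric i j p : h p (F i p) (E j p) = \sum_k L j k p * h p (F i p) (F k p).
Proof.
have [hr _ _ _] := frE; rewrite [in LHS](fcompE frF p (Ev j)).
by rewrite (metric_sumr hr) // => [k|]; exact: vfield_tangent.
Qed.

Lemma structure_change i j k p : structure_fun h E i j k p =
  \sum_l (E i p (L j l) - E j p (L i l) + \sum_c \sum_d L i c p * L j d p *
    structure_fun g F c d l p) * h p (F l p) (E k p).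
Proof.
have [hr _ _ _] := frE; have bv : is_vfield A (bracket (E i) (E j)).
  exact: is_vfield_bracket.
rewrite /structure_fun [in LHS](fcompE frF p bv).
rewrite (metric_suml hr); [|by move=> l; exact: vfield_tangent|exact: vfield_tangent].
by apply: eq_bigr => l _; rewrite (fcomp_bracket frF).
Qed.

End FrameChange.

(** * Determinants near the identity *)

Section DeterminantExpansion.
Variables (R : realType) (M : Type) (K : set M) (N : nat).
Variable u : 'I_N -> 'I_N -> R -> M -> R.
Hypothesis Hu : forall i j, eqO K 1 (u i j) (fun=> fun=> (i == j)%:R).

Lemma bigO_prod (I : Type) (r : seq I) (P : pred I) (F : I -> R -> M -> R) :
  (forall i, bigO K 0 (F i)) -> bigO K 0 (fun t p => \prod_(i <- r | P i) F i t p).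
Proof.
move=> HF; elim: r => [|i r IH].
  by apply: eq_bigO (bigO_cst K 1) => t p; rewrite big_nil.
case: (boolP (P i)) => Pi; last first.
  by apply: eq_bigO IH => t p; rewrite big_cons (negbTE Pi).
by apply: eq_bigO (bigOMl (HF i) IH) => t p; rewrite big_cons Pi.
Qed.

Lemma eqO_prod1 (I : Type) (r : seq I) (F : I -> R -> M -> R) :
  (forall i, eqO K 1 (F i) (fun=> fun=> 1)) ->
  eqO K 2 (fun t p => \prod_(i <- r) F i t p)
    (fun t p => 1 + \sum_(i <- r) (F i t p - 1)).
Proof.
move=> HF; elim: r => [|i r IH].
  by apply: eqO_eq => t p; rewrite !big_nil addr0.
have b1 : bigO K 0 (F i) by apply: eqO_bigO (bigO_cst K 1); exact: bigOW (HF i).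
have s1 : bigO K 1 (fun t p => \sum_(i <- r) (F i t p - 1)).
  by apply: bigO_sum => j _; exact: HF.
apply: eq_bigO (bigO_add (bigOMl b1 IH) (bigO_mul (HF i) s1)) => t p.
by rewrite !big_cons; ring.
Qed.

(** A permutation other than 1 moves some i and then also s(i), so its product has at least two
    off-diagonal factors, each O(t). The diagonal product is expanded to first order. *)
Lemma det_expansion : eqO K 2 (fun t p => \det (\matrix_(i, j) u i j t p))
  (fun t p => 1 + \sum_i (u i i t p - 1)).
Proof.
have b0 i j : bigO K 0 (u i j).
  by apply: eqO_bigO (bigO_cst K (i == j)%:R); exact: bigOW (Hu i j).
have off i j : i != j -> bigO K 1 (u i j).
  move=> ij; have := Hu i j; rewrite (negbTE ij); exact: eqO0_bigO.
have H1 := @eqO_prod1 _ (index_enum 'I_N) (fun i => u i i) (fun i => _).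
have {H1} : eqO K 2 (fun t p => \prod_i u i i t p) (fun t p => 1 + \sum_i (u i i t p - 1)).
  by apply: H1 => i; have := Hu i i; rewrite eqxx.
apply: eqO_trans.
have small (s : 'S_N) : s != 1%g -> bigO K 2 (fun t p => (-1) ^+ s * \prod_i u i (s i) t p).
  move=> s1; apply: bigO_scale.
  have [i si] : exists i, s i != i.
    apply: contrapT => nH; move/negP: s1; apply; apply/eqP/permP => i; rewrite perm1.
    by apply/eqP; apply: contrapT => /negP si; apply: nH; exists i.
  have sj : s (s i) != s i by rewrite (inj_eq perm_inj).
  have := bigO_mul (off i (s i) _) (bigO_mul (off (s i) (s (s i)) _)
    (bigO_prod (index_enum 'I_N) (fun k => (k != i) && (k != s i)) (fun k => b0 k (s k)))).
  rewrite eq_sym => /(_ si); rewrite eq_sym => /(_ sj); apply: eq_bigO => t p.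
  by rewrite [in RHS](bigD1 i) //= [in RHS](bigD1 (s i)) //=.
apply: eq_bigO (@bigO_sum _ _ _ 2 _ (index_enum {perm 'I_N}) (fun s => s != 1%g) _ small).
move=> t p; rewrite /determinant [X in _ = X - _](bigD1 (1%g : 'S_N)) //= odd_perm1 expr0 mul1r.
under [X in _ = X + _ - _]eq_bigr do rewrite mxE perm1.
rewrite addrAC subrr add0r; apply: eq_bigr => s _; congr (_ * _).
by apply: eq_bigr => i _; rewrite mxE.
Qed.

End DeterminantExpansion.

(** * Structure equations of a contact frame adapted to two foliations *)

Section ContactFrames.
Variables (R : realType) (N n : nat) (M : ptopologicalType).
Implicit Types (g : metric R M) (ja jb : 'I_n -> 'I_N) (nu : 'I_N).

(* [ja] and [jb] enumerate the frames of the two complementary foliations, [nu]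
   is the index of the Reeb field. *)
Record contact_leaf g (E : 'I_N -> vfield R M) ja jb nu (kap : R) : Prop := ContactLeaf {
  leaf_sum : forall F : 'I_N -> R,
    \sum_k F k = \sum_a F (ja a) + \sum_a F (jb a) + F nu;
  leaf_inj : forall a b, (ja a == ja b) = (a == b);
  leaf_neq : forall a b, (ja a == jb b) = false;
  leaf_neq0 : forall a, (ja a == nu) = false;
  leaf_integrable : forall a b d p, structure_fun g E (ja a) (ja b) (jb d) p = 0;
  leaf_integrable0 : forall a b p, structure_fun g E (ja a) (ja b) nu p = 0;
  leaf_geodesic : forall d a b p, structure_fun g E (jb d) (ja a) (ja b) p =
    - structure_fun g E (jb d) (ja b) (ja a) p;
  leaf_geodesic0 : forall a b p, structure_fun g E nu (ja a) (ja b) p =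
    - structure_fun g E nu (ja b) (ja a) p;
  leaf_contact : forall a b p,
    structure_fun g E (ja a) (jb b) nu p = kap * (a == b)%:R;
  leaf_reeb : forall a p, structure_fun g E nu (ja a) nu p = 0;
  leaf_mix : forall a b p, structure_fun g E nu (ja a) (jb b) p = 0 }.

(** Interchanging the leaves reverses the sign of the bracket, hence of kap; every estimate for one
    leaf thus applies to the other. *)
Definition contact_pair g E ja jb nu kap :=
  contact_leaf g E ja jb nu kap /\ contact_leaf g E jb ja nu (- kap).

Lemma contact_pairC g E ja jb nu kap :
  contact_pair g E ja jb nu kap -> contact_pair g E jb ja nu (- kap).
Proof. by move=> [H1 H2]; split => //; rewrite opprK. Qed.

Lemma leaf_case g E ja jb nu kap k : contact_leaf g E ja jb nu kap ->
  [\/ exists a, k = ja a, exists b, k = jb b | k = nu].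
Proof.
move=> H; apply: contrapT => nH; have := leaf_sum H (fun l => (l == k)%:R).
rewrite (bigD1 k) //= eqxx big1 ?addr0 => [|l /negbTE->//].
rewrite !big1 => [||a _].
- rewrite !add0r; case: eqP => [nk|_ /eqP]; last by rewrite oner_eq0.
  by case: nH; apply: Or33.
- move=> b _; case: eqP => // bk; case: nH; apply: Or32; by exists b.
- case: eqP => // ak; case: nH; apply: Or31; by exists a.
Qed.

End ContactFrames.

Section FrameJacobi.
Variables (R : realType) (N n : nat) (M : ptopologicalType) (A : manifold R N M).
Variables (g : metric R M) (E : 'I_N -> vfield R M).
Hypothesis frE : orthoframe A g E.
Let gr : riemannian_metric A g. Proof. by case: frE. Qed.
Let Ev i : is_vfield A (E i). Proof. by case: frE. Qed.
Let Et i p : tangent_at A p (E i p). Proof. exact: vfield_tangent. Qed.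
Local Notation cc := (structure_fun g E).

Lemma structure_jacobi x y z k p :
  (\sum_i cc x y i p * cc i z k p - E z p (cc x y k)) +
  (\sum_i cc y z i p * cc i x k p - E x p (cc y z k)) +
  (\sum_i cc z x i p * cc i y k p - E y p (cc z x k)) = 0.
Proof.
have bv i j : is_vfield A (bracket (E i) (E j)) by exact: is_vfield_bracket.
have bbv i j l : is_vfield A (bracket (bracket (E i) (E j)) (E l)).
  exact: is_vfield_bracket.
have H i j l : fcomp g E (bracket (bracket (E i) (E j)) (E l)) k p =
    \sum_m cc i j m p * cc m l k p - E l p (cc i j k).
  have Ec s m q : fcomp g E (E s) m q = (s == m)%:R by case: frE => _ _ Eo _; exact: Eo.
  rewrite (fcomp_bracket frE) //.
  have -> : fcomp g E (E l) k = fun=> (l == k)%:R by apply/funext => q; rewrite Ec.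
  rewrite (tangent_cst (vfield_tangent p (bv i j))) sub0r addrC; congr (_ - _).
  apply: eq_bigr => m _; rewrite (bigD1 l) //= big1 ?addr0 => [|s /negbTE sl].
    by rewrite Ec eqxx mulr1.
  by rewrite Ec eq_sym sl mulr0 mul0r.
rewrite -!H -!(fcompD frE) //; last by exact: is_vfieldD.
have -> : bracket (bracket (E x) (E y)) (E z) + bracket (bracket (E y) (E z)) (E x)
    + bracket (bracket (E z) (E x)) (E y) = 0.
  apply/funext => q; apply: (@tangent_ext _ _ _ A q).
  - by apply: vfield_tangent; apply: is_vfieldD => //; exact: is_vfieldD.
  - exact: tangent_at0.
  - by move=> u su; exact: (@bracket_jacobi _ _ _ A).
exact: (metric0l gr).
Qed.

Variables (ja jb : 'I_n -> 'I_N) (nu : 'I_N) (kap : R).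
Hypotheses (cp : contact_pair g E ja jb nu kap) (kap0 : kap != 0).

(* The [nu]-component of the Jacobi identity for E_(ja b), E_(ja a), E_(jb a). *)
Lemma leaf_jacobi a b p : cc (ja b) (ja a) (ja a) p = cc (jb b) (ja a) (jb a) p.
Proof.
have [HA HB] := cp.
have cst x y (k : R) : (forall q, cc x y nu q = k) -> forall z, E z p (cc x y nu) = 0.
  move=> Hk z; rewrite (_ : cc x y nu = fun=> k); first exact: (tangent_cst (Et z p)).
  exact/funext.
(* Bracketing with a leaf field and taking the nu-component selects the component along its contact
   partner; here lies the link between the two leaves. *)
have sa x y d : \sum_i cc x y i p * cc i (ja d) nu p = - kap * cc x y (jb d) p.
  rewrite (leaf_sum HA) big1 => [|d' _]; last by rewrite (leaf_integrable0 HA) mulr0.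
  rewrite (leaf_reeb HA) mulr0 addr0 add0r (bigD1 d) //= big1 ?addr0 => [|d' /negbTE da].
    by rewrite (leaf_contact HB) eqxx mulr1 mulrC.
  by rewrite (leaf_contact HB) da !mulr0.
have sb x y d : \sum_i cc x y i p * cc i (jb d) nu p = kap * cc x y (ja d) p.
  rewrite (leaf_sum HA) addrAC [X in _ + X]big1 => [|d' _]; last first.
    by rewrite (leaf_integrable0 HB) mulr0.
  rewrite (leaf_reeb HB) mulr0 !addr0 (bigD1 d) //= big1 ?addr0 => [|d' /negbTE da].
    by rewrite (leaf_contact HA) eqxx mulr1 mulrC.
  by rewrite (leaf_contact HA) da !mulr0.
have := structure_jacobi (ja b) (ja a) (jb a) nu p.
rewrite sb !sa !(cst _ _ _ (leaf_integrable0 HA _ _)) !(cst _ _ _ (leaf_contact HA _ _)).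
rewrite !(cst _ _ _ (leaf_contact HB _ _)) !subr0.
have -> : cc (jb a) (ja b) (jb a) p = 0.
  rewrite (structureC frE); have := leaf_geodesic HB b a a p => H.
  by apply: oppr_inj; rewrite opprK oppr0; lra.
have -> : cc (ja a) (jb a) (jb b) p = cc (jb b) (ja a) (jb a) p.
  by rewrite (leaf_geodesic HB) (structureC frE) opprK.
rewrite mulr0 addr0 mulNr -mulrBr => /eqP; rewrite mulf_eq0 (negbTE kap0) /=.
by rewrite subr_eq0 => /eqP.
Qed.

End FrameJacobi.

(** * First-order expansions for a frame adapted to the varied metric *)

Section AdaptedFamilies.
Variables (R : realType) (N n : nat) (M : ptopologicalType) (A : manifold R N M).
Variables (g : metric R M) (F : 'I_N -> vfield R M) (K : set M).
Hypotheses (frF : orthoframe A g F) (cK : compact K).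
Variables (h : R -> metric R M) (E : R -> 'I_N -> vfield R M).
Implicit Types (ja jb : 'I_n -> 'I_N) (nu : 'I_N).

Record adapted_family := AdaptedFamily {
  adapted_frame : forall t, orthoframe A (h t) (E t);
  adapted_gram : forall i j, adm A F K (i == j)%:R (fun t p => h t p (F i p) (F j p));
  adapted_adm : forall i j, adm A F K (i == j)%:R (fun t p => fcomp g F (E t i) j p) }.

(** These vanish identically, not just to first order: the leaf fields of E stay in their
    distribution, and the original leaf fields stay orthogonal to the rest of E. For E t nu no
    component in F is prescribed. *)
Record adapted_leaf ja jb nu := AdaptedLeaf {
  adapted_L : forall t a b p, fcomp g F (E t (ja a)) (jb b) p = 0;
  adapted_L0 : forall t a p, fcomp g F (E t (ja a)) nu p = 0;
  adapted_P : forall t a b p, h t p (F (ja a) p) (E t (jb b) p) = 0;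
  adapted_P0 : forall t a p, h t p (F (ja a) p) (E t nu p) = 0 }.

Hypothesis ad : adapted_family.
Let Et' t i : is_vfield A (E t i). Proof. by have [_ H _ _] := adapted_frame ad t. Qed.
Let Fv i : is_vfield A (F i). Proof. by case: frF. Qed.
Let Ft i p : tangent_at A p (F i p). Proof. exact: vfield_tangent. Qed.
Let hr t : riemannian_metric A (h t). Proof. by have [H _ _ _] := adapted_frame ad t. Qed.

Local Notation cc := (structure_fun g F).
Let L i j t p := fcomp g F (E t i) j p.
Let P i j t p := h t p (F i p) (E t j p).
Let H i j t p := h t p (F i p) (F j p).
Let ct i j k t p := structure_fun (h t) (E t) i j k p.

Let La i j : adm A F K (i == j)%:R (L i j). Proof. exact: adapted_adm. Qed.
Let Ha i j : adm A F K (i == j)%:R (H i j). Proof. exact: adapted_gram. Qed.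

Lemma adapted_mixed_adm i j : adm A F K (i == j)%:R (P i j).
Proof.
have S := adm_sum frF (index_enum 'I_N) (fun k => adm_mul frF (La j k) (Ha i k)).
have -> : (i == j)%:R = \sum_k (j == k)%:R * (i == k)%:R :> R.
  rewrite (bigD1 j) //= big1 ?addr0 => [|k /negbTE jk]; first by rewrite eqxx mul1r.
  by rewrite eq_sym jk mul0r.
apply: adm_eq S => t p.
by rewrite [RHS](frame_change_metric frF (adapted_frame ad t)).
Qed.
Let Pa := adapted_mixed_adm.

Lemma adm_eqO a u : adm A F K a u -> eqO K 1 u (fun=> fun=> a).
Proof. by case. Qed.

Lemma adm0_bigO u : adm A F K 0 u -> bigO K 1 u.
Proof. by move=> /adm_eqO; exact: eqO0_bigO. Qed.

Lemma adapted_derive_bigO i a u : adm A F K a u -> bigO K 1 (fun t p => E t i p (u t)).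
Proof.
move=> [su _ du]; apply: eq_bigO (bigO_sum (index_enum 'I_N) (fun j _ =>
  bigOMl (adm_bigO0 (La i j)) (du j))) => t p.
by rewrite [RHS](frame_change_derive frF (adapted_frame ad t)).
Qed.

(** E t i differs from F i by O(t), and the derivatives of an admissible function are themselves
    O(t). *)
Lemma adapted_derive i a u : adm A F K a u ->
  eqO K 2 (fun t p => E t i p (u t)) (fun t p => F i p (u t)).
Proof.
move=> [su _ du]; apply: eq_bigO (bigO_sum (index_enum 'I_N) (fun j _ =>
  bigO_mul (adm_eqO (La i j)) (du j))) => t p.
rewrite (frame_change_derive frF (adapted_frame ad t)).
under eq_bigr do rewrite mulrBl.
rewrite sumrB; congr (_ - _); rewrite (bigD1 i) //= big1 ?addr0 => [|j /negbTE ij].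
  by rewrite eqxx mul1r.
by rewrite eq_sym ij mul0r.
Qed.

(* The [F l]-component of the bracket [E t i, E t j]. *)
Let inner i j l t p : R := E t i p (L j l t) - E t j p (L i l t)
  + \sum_c \sum_d L i c t p * L j d t p * cc c d l p.

Lemma structure_inner i j k t p : ct i j k t p = \sum_l inner i j l t p * P l k t p.
Proof. exact: (structure_change frF (adapted_frame ad t)). Qed.

Lemma sum_delta (G : 'I_N -> R) i : \sum_j (i == j)%:R * G j = G i.
Proof.
rewrite (bigD1 i) //= big1 ?addr0 => [|j /negbTE ij]; first by rewrite eqxx mul1r.
by rewrite eq_sym ij mul0r.
Qed.

Let cO c d l : bigO K 0 (fun=> cc c d l).
Proof. exact: (bigO_static cK (structure_smooth frF c d l)). Qed.

Lemma inner_eqO i j l : eqO K 1 (inner i j l) (fun=> cc i j l).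
Proof.
have H1 : eqO K 1 (fun t p => \sum_c \sum_d L i c t p * L j d t p * cc c d l p)
    (fun t p => \sum_c \sum_d (i == c)%:R * (j == d)%:R * cc c d l p).
  apply: eqO_sum => c _; apply: eqO_sum => d _.
  have bL := adm_mul frF (La i c) (La j d).
  by apply: eqO_mul_small (adm_eqO bL) (cO c d l).
have H2 := bigO_sub (adapted_derive_bigO i (La j l)) (adapted_derive_bigO j (La i l)).
apply: eq_bigO (bigO_add H2 H1) => t p; rewrite /inner.
have -> : \sum_c \sum_d (i == c)%:R * (j == d)%:R * cc c d l p = cc i j l p.
  under eq_bigr => c _.
    under eq_bigr => d _ do rewrite -mulrA.
    rewrite -mulr_sumr sum_delta; over.
  exact: sum_delta.
by rewrite addrA.
Qed.

Lemma inner_bigO0 i j l : bigO K 0 (inner i j l).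
Proof.
apply: eqO_bigO (bigOW (leq0n 1) (inner_eqO i j l)) _.
exact: cO.
Qed.

Lemma structure_eqO i j k : eqO K 1 (ct i j k) (fun=> cc i j k).
Proof.
have H1 : eqO K 1 (fun t p => \sum_l inner i j l t p * P l k t p)
    (fun t p => \sum_l cc i j l p * (l == k)%:R).
  apply: eqO_sum => l _; apply: eqO_mul (inner_bigO0 i j l) _ (inner_eqO i j l) _.
    exact: bigO_cst.
  exact: adm_eqO (Pa l k).
apply: eq_bigO H1 => t p; rewrite structure_inner; congr (_ - _).
by under eq_bigr do rewrite mulrC eq_sym; rewrite sum_delta.
Qed.

Lemma structure_small i j k : (forall p, cc i j k p = 0) -> bigO K 1 (ct i j k).
Proof.
move=> c0; apply: eq_bigO (structure_eqO i j k) => t p.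
by rewrite c0 subr0.
Qed.

Lemma eqO_diag (I : finType) (i : I) (u v : I -> R -> M -> R) :
  (forall k, k != i -> bigO K 1 (u k)) -> (forall k, k != i -> bigO K 1 (v k)) ->
  eqO K 2 (fun t p => \sum_k u k t p * v k t p) (fun t p => u i t p * v i t p).
Proof.
move=> Hu Hv.
have HS := @bigO_sum _ _ _ 2 _ (index_enum I) (fun k => k != i) _
  (fun k ki => bigO_mul (Hu k ki) (Hv k ki)).
apply: eq_bigO HS => t p; by rewrite [in RHS](bigD1 i) //= addrAC subrr add0r.
Qed.

Lemma adm_off i j (U : 'I_N -> 'I_N -> R -> M -> R) :
  (forall i j, adm A F K (i == j)%:R (U i j)) -> i != j -> bigO K 1 (U i j).
Proof. by move=> aU /negbTE ij; have := aU i j; rewrite ij; exact: adm0_bigO. Qed.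

Lemma mixed_square i : eqO K 2 (fun t p => P i i t p * P i i t p) (H i i).
Proof.
have off k : k != i -> bigO K 1 (P i k) by rewrite eq_sym; exact: adm_off.
apply: eqO_sym; apply: eq_bigO (eqO_diag off off) => t p; congr (_ - _).
by rewrite /H (metric_fcomp (adapted_frame ad t)).
Qed.

(* 1 = h(E_i, E_i) is (L i i)^2 (H i i) up to O(t^2). *)
Lemma adapted_square i :
  eqO K 2 (fun t p => L i i t p * L i i t p) (fun t p => 2 - H i i t p).
Proof.
have offL k : k != i -> bigO K 1 (L i k) by rewrite eq_sym; exact: adm_off.
have offH k : k != i -> bigO K 1 (H i k) by rewrite eq_sym; exact: adm_off.
have offP k : k != i -> bigO K 1 (P k i) by exact: adm_off.
have bL : bigO K 0 (L i i) by exact: adm_bigO0 (La i i).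
have H1 : eqO K 2 (fun=> fun=> 1) (fun t p => L i i t p * P i i t p).
  apply: eq_bigO (eqO_diag offL offP) => t p; congr (_ - _).
  have [_ _ Eo _] := adapted_frame ad t.
  have := Eo p i i; rewrite eqxx mulr1n => <-; rewrite [X in h t p X _](fcompE frF p (Et' t i)).
  by rewrite (metric_suml (hr t)) // => *; exact: vfield_tangent.
have H2 : eqO K 2 (P i i) (fun t p => L i i t p * H i i t p).
  apply: eq_bigO (eqO_diag offL offH) => t p; congr (_ - _).
  by rewrite /P (frame_change_metric frF (adapted_frame ad t)).
have H3 : bigO K 1 (fun t p => L i i t p * L i i t p - 1).
  have := adm_eqO (adm_mul frF (La i i) (La i i)); rewrite eqxx mulr1.
  exact.
have H4 : bigO K 1 (fun t p => H i i t p - 1).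
  by have := adm_eqO (Ha i i); rewrite eqxx.
apply: eq_bigO (bigO_sub (bigO_sub (bigO_opp H1) (bigOMl bL H2)) (bigO_mul H3 H4)) => t p.
by ring.
Qed.

Local Notation rho t := (rel_density (h t) F).

Lemma rel_density_eqO1 : eqO K 1 (fun t => rho t) (fun=> fun=> 1).
Proof.
have H1 := det_expansion (fun i j => adm_eqO (Ha i j)).
have H2 : eqO K 1 (fun t p => \det (\matrix_(i, j) H i j t p)) (fun=> fun=> 1).
  have H3 : bigO K 1 (fun t p => \sum_i (H i i t p - 1)).
    by apply: bigO_sum => i _; have := adm_eqO (Ha i i); rewrite eqxx.
  by apply: eq_bigO (bigO_add (bigOW (leqnSn 1) H1) H3) => t p; ring.
have b : bigO K 0 (fun t p => (rho t p + 1)^-1).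
  split=> //; exists 1, 1; split => // t p _ _; rewrite expr0 mulr1.
  have r0 := rel_density_gt0 frF (adapted_frame ad t) p.
  rewrite ger0_norm ?invr_ge0 ?addr_ge0 ?(ltW r0) // invf_le1 ?addr_gt0 //.
  by rewrite lerDr ltW.
apply: eq_bigO (bigOMl b H2) => t p.
have r0 := rel_density_gt0 frF (adapted_frame ad t) p.
have -> : \det (\matrix_(i, j) H i j t p) = rho t p ^+ 2.
  by rewrite sqr_sqrtr // ltW // (rel_det_gt0 frF (adapted_frame ad t)).
by field; rewrite gt_eqF // addr_gt0.
Qed.

(** From 2 (rho - 1) = (rho^2 - 1) - (rho - 1)^2, with rho^2 the Gram determinant. *)
Lemma rel_density_eqO2 : eqO K 2 (fun t p => 2 * (rho t p - 1))
  (fun t p => \sum_i (H i i t p - 1)).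
Proof.
have H1 := det_expansion (fun i j => adm_eqO (Ha i j)).
have H2 := bigO_mul rel_density_eqO1 rel_density_eqO1.
apply: eq_bigO (bigO_sub H1 H2) => t p.
have -> : \det (\matrix_(i, j) H i j t p) = rho t p ^+ 2.
  by rewrite sqr_sqrtr // ltW // (rel_det_gt0 frF (adapted_frame ad t)).
by rewrite expr2; ring.
Qed.

Let Gt i j k t p := christoffel (h t) (E t) i j k p.
Local Notation Gm := (christoffel g F).

Lemma christoffel_eqO i j k : eqO K 1 (Gt i j k) (fun=> Gm i j k).
Proof.
have H1 := eqO_add (eqO_sub (structure_eqO i j k) (structure_eqO j k i)) (structure_eqO k i j).
by apply: eq_bigO (bigO_scale 2^-1 H1) => t p; rewrite /Gt /christoffel /ct; ring.
Qed.

Lemma christoffel_small i j k : (forall p, Gm i j k p = 0) -> bigO K 1 (Gt i j k).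
Proof. by move=> c0; apply: eq_bigO (christoffel_eqO i j k) => t p; rewrite c0 subr0. Qed.

Section LeafSymbols.
Variables (ja jb : 'I_n -> 'I_N) (nu : 'I_N) (kap : R).
Hypothesis HA : contact_leaf g F ja jb nu kap.

(** With the next two lemmas: the second fundamental forms and mean curvatures of the leaves, and
    the acceleration of the Reeb field, vanish in the components that enter Q. Products of two of
    them are therefore O(t^2) for the varied metric. *)
Lemma leaf_christoffel a b d p : Gm (ja a) (ja b) (jb d) p = 0.
Proof.
rewrite /christoffel (leaf_integrable HA) (structureC frF (jb d)) (leaf_geodesic HA).
by ring.
Qed.

Lemma leaf_christoffel0 a p : Gm (ja a) (ja a) nu p = 0.
Proof.
have := leaf_geodesic0 HA a a p; rewrite /christoffel (structure_diag frF).
by rewrite (structureC frF nu) => H0; lra.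
Qed.

Lemma leaf_christoffel_reeb a p : Gm nu nu (ja a) p = 0.
Proof.
rewrite /christoffel (structure_diag frF) (structureC frF nu) (leaf_reeb HA).
by ring.
Qed.

Lemma leaf_sum_codom (G : 'I_N -> R) : \sum_(i | i \in codom ja) G i = \sum_a G (ja a).
Proof.
rewrite big_mkcond (leaf_sum HA) [X in _ + X + _]big1 => [|b _]; last first.
  case: ifP => // /codomP[a /esym/eqP]; by rewrite (leaf_neq HA).
rewrite addr0; case: ifP => [/codomP[a /esym/eqP]|_]; first by rewrite (leaf_neq0 HA).
by rewrite addr0; apply: eq_bigr => a _; rewrite codom_f.
Qed.

End LeafSymbols.

Section Leaf.
Variables (ja jb : 'I_n -> 'I_N) (nu : 'I_N) (kap : R).
Hypotheses (cp : contact_pair g F ja jb nu kap) (kap0 : kap != 0).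
Hypotheses (lA : adapted_leaf ja jb nu) (lB : adapted_leaf jb ja nu).

(** The formula is exact. The leaf fields have no F nu-component at any t, so no derivative of a
    frame coefficient enters, and only the contact brackets survive. *)
Lemma contact_structure a b t p : ct (ja a) (jb b) nu t p =
  kap * P nu nu t p * \sum_d L (ja a) (ja d) t p * L (jb b) (jb d) t p.
Proof.
have [HA HB] := cp.
rewrite structure_inner (leaf_sum HA) big1 ?add0r => [|d _]; last first.
  by rewrite [P _ _ _ _](adapted_P0 lA) mulr0.
rewrite big1 ?add0r => [|d _]; last by rewrite [P _ _ _ _](adapted_P0 lB) mulr0.
rewrite /inner.
have -> : L (jb b) nu t = fun=> 0 by apply/funext => q; exact: (adapted_L0 lB).
have -> : L (ja a) nu t = fun=> 0 by apply/funext => q; exact: (adapted_L0 lA).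
rewrite !(tangent_cst (vfield_tangent p (Et' t _))) subrr add0r.
rewrite [RHS]mulrAC; congr (_ * _).
rewrite (leaf_sum HA) [X in _ + X + _]big1 ?addr0 => [|d _]; last first.
  by rewrite big1 // => d' _; rewrite [L _ (jb d) _ _](adapted_L lA) !mul0r.
rewrite [X in _ + X]big1 ?addr0 => [|d _]; last first.
  by rewrite [L _ nu _ _](adapted_L0 lA) !mul0r.
rewrite mulr_sumr; apply: eq_bigr => d _.
rewrite (leaf_sum HA) big1 ?add0r => [|d' _]; last first.
  by rewrite [L _ (ja d') _ _](adapted_L lB) mulr0 mul0r.
rewrite [L _ nu _ _](adapted_L0 lB) mulr0 mul0r addr0.
rewrite (bigD1 d) //= big1 ?addr0 => [|d' /negbTE dd]; rewrite (leaf_contact HA).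
  by rewrite eqxx mulr1 mulrC.
by rewrite eq_sym dd !mulr0.
Qed.

(** The structure function vanishes at t = 0, so to first order the leaf fields may be replaced by
    those of F; only the components of E t nu along F contribute. *)
Lemma reeb_structure a b : eqO K 2 (ct nu (ja a) (jb b))
  (fun t p => - F (ja a) p (L nu (jb b) t) + \sum_c L nu c t p * cc c (ja a) (jb b) p).
Proof.
have [HA HB] := cp.
have H1 : eqO K 2 (ct nu (ja a) (jb b)) (inner nu (ja a) (jb b)).
  have HS : eqO K 2 (fun t p => \sum_l inner nu (ja a) l t p * P l (jb b) t p)
      (fun t p => \sum_l inner nu (ja a) l t p * (l == jb b)%:R).
    apply: eqO_sum => l _; case: (leaf_case l HA) => [[d ->]|[d ->]|->].
    - apply: eqO_eq => t p; rewrite [P _ _ _ _](adapted_P lA).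
      by rewrite (leaf_neq HA) mulr0.
    - have small : bigO K 1 (inner nu (ja a) (jb d)).
        by apply: eq_bigO (inner_eqO nu (ja a) (jb d)) => t p; rewrite (leaf_mix HA) subr0.
      by apply: eq_bigO (bigO_mul small (adm_eqO (Pa (jb d) (jb b)))) => t p; rewrite mulrBr.
    - have small : bigO K 1 (inner nu (ja a) nu).
        by apply: eq_bigO (inner_eqO nu (ja a) nu) => t p; rewrite (leaf_reeb HA) subr0.
      by apply: eq_bigO (bigO_mul small (adm_eqO (Pa nu (jb b)))) => t p; rewrite mulrBr.
  apply: eq_bigO HS => t p; rewrite structure_inner; congr (_ - _).
  by under eq_bigr do rewrite mulrC eq_sym; rewrite sum_delta.
apply: eqO_trans H1 _.
have H2 := adapted_derive (ja a) (La nu (jb b)).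
have H3 : eqO K 2 (fun t p => \sum_c L nu c t p * \sum_d L (ja a) d t p * cc c d (jb b) p)
    (fun t p => \sum_c L nu c t p * cc c (ja a) (jb b) p).
  have sumA t p (G : 'I_N -> R) : \sum_d L (ja a) d t p * G d =
      \sum_d L (ja a) (ja d) t p * G (ja d).
    rewrite (leaf_sum HA) [X in _ + X + _]big1 ?addr0 => [|d _]; last first.
      by rewrite [L _ _ _ _](adapted_L lA) mul0r.
    by rewrite [L _ nu _ _](adapted_L0 lA) mul0r addr0.
  apply: eqO_sum => c _; case: (leaf_case c HA) => [[d ->]|[d ->]|->].
  - apply: eqO_eq => t p; rewrite sumA (leaf_integrable HA) big1 // => d' _.
    by rewrite (leaf_integrable HA) mulr0.
  - have w1 : bigO K 1 (L nu (jb d)).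
      by have := La nu (jb d); rewrite eq_sym (leaf_neq0 HB); exact: adm0_bigO.
    have HS : eqO K 1 (fun t p => \sum_d' L (ja a) d' t p * cc (jb d) d' (jb b) p)
        (fun t p => \sum_d' (ja a == d')%:R * cc (jb d) d' (jb b) p).
      apply: eqO_sum => d' _; exact: eqO_mul_small (adm_eqO (La _ _)) (cO _ _ _).
    apply: eq_bigO (bigO_mul w1 HS) => t p.
    by rewrite sum_delta mulrBr.
  - apply: eqO_eq => t p; rewrite sumA (leaf_mix HA) big1 // => d' _.
    by rewrite (leaf_mix HA) mulr0.
apply: eq_bigO (bigO_sub H3 H2) => t p; rewrite /inner.
have -> : L (ja a) (jb b) t = fun=> 0 by apply/funext => q; exact: (adapted_L lA).
rewrite (tangent_cst (vfield_tangent p (Et' t _))).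
under [X in _ = _ + X - _]eq_bigr => c _.
  under eq_bigr => d _ do rewrite -mulrA.
  rewrite -mulr_sumr; over.
by ring.
Qed.

(** Via [leaf_jacobi], the zeroth-order coefficient left by [reeb_structure] becomes the trace in
    the divergence of a multiple of F (ja b). *)
Lemma leaf_trace b p : \sum_k cc (ja b) k k p = \sum_a cc (jb b) (ja a) (jb a) p.
Proof.
have [HA HB] := cp; rewrite (leaf_sum HA) [X in _ + X + _]big1 => [|a _]; last first.
  by have := leaf_geodesic HB b a a p => G; lra.
rewrite (structureC frF) (leaf_reeb HA) oppr0 !addr0; apply: eq_bigr => a _.
exact: (leaf_jacobi frF cp kap0).
Qed.

(** The trace is, up to O(t^2), minus the divergence of the field whose F (ja a)-component is the F
    (jb a)-component of E t nu. *)
Lemma reeb_trace : eqO K 2 (fun t p => \sum_a ct nu (ja a) (jb a) t p)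
  (fun t p => - \sum_a frame_div g F (L nu (jb a) t) (ja a) p).
Proof.
have [HA HB] := cp.
have H1 := eqO_sum (index_enum 'I_n) (fun a (_ : xpredT a) => reeb_structure a a).
apply: eqO_trans H1 _; apply: eqO_eq => t p.
rewrite big_split /= -sumrN exchange_big /=.
have -> : \sum_c \sum_a L nu c t p * cc c (ja a) (jb a) p =
    \sum_b \sum_a L nu (jb b) t p * cc (jb b) (ja a) (jb a) p.
  rewrite (leaf_sum HA) big1 ?add0r => [|d _]; last first.
    by rewrite big1 // => a _; rewrite (leaf_integrable HA) mulr0.
  by rewrite [X in _ + X]big1 ?addr0 // => a _; rewrite (leaf_mix HA) mulr0.
rewrite -big_split /=; apply: eq_bigr => b _.
by rewrite /frame_div opprB addrC leaf_trace mulr_sumr.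
Qed.

Let mA : pred 'I_N := fun i => i \in codom ja.
Let mB : pred 'I_N := fun i => i \in codom jb.

Lemma leaf_blocks i : (mA i + mB i + (i == nu) = 1)%N.
Proof.
have [HA HB] := cp.
have nA k : (forall a, (ja a == k) = false) -> mA k = false.
  by move=> Hk; apply/negbTE/codomP => -[a /esym/eqP]; rewrite Hk.
have nB k : (forall a, (jb a == k) = false) -> mB k = false.
  by move=> Hk; apply/negbTE/codomP => -[a /esym/eqP]; rewrite Hk.
case: (leaf_case i HA) => [[a ->]|[b ->]|->].
- rewrite nB ?(leaf_neq0 HA) /mA ?codom_f // => b; exact: (leaf_neq HB).
- rewrite nA ?(leaf_neq0 HB) /mB ?codom_f // => a; exact: (leaf_neq HA).
- by rewrite nA ?nB ?eqxx // => a; [exact: (leaf_neq0 HB)|exact: (leaf_neq0 HA)].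
Qed.

Lemma leaf_codom (f : 'I_n -> 'I_N) (Q : 'I_N -> Prop) :
  (forall a, Q (f a)) -> forall i, i \in codom f -> Q i.
Proof. by move=> HQ i /codomP[a ->]. Qed.

(** All terms of Q without nu, and those with mean curvatures, are products of two O(t) factors.
    With x = ct a b nu, y = ct nu a b, z = ct nu b a, the Koszul formula writes the rest as -3/4 x^2
    + x (y - z) / 2 + (y + z)^2 / 4. The last square is O(t^2), and in the middle term x may be
    replaced by its value at t = 0. *)
Lemma walczak_eqO : eqO K 2
  (fun t p => walczak_quadratic mA mB nu (fun i j k => Gt i j k t p))
  (fun t p => \sum_a \sum_b (- (3 / 4) * (ct (ja a) (jb b) nu t p) ^+ 2
    + kap / 2 * (a == b)%:R * (ct nu (ja a) (jb b) t p - ct nu (jb b) (ja a) t p))).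
Proof.
have [HA HB] := cp.
have thA (k : 'I_N) : (forall d p, Gm (jb d) (jb d) k p = 0) ->
    bigO K 1 (fun t p => \sum_(i | mB i) Gt i i k t p).
  by move=> Hk; apply: bigO_sum; apply: leaf_codom => d; exact: christoffel_small.
have thB (k : 'I_N) : (forall d p, Gm (ja d) (ja d) k p = 0) ->
    bigO K 1 (fun t p => \sum_(i | mA i) Gt i i k t p).
  by move=> Hk; apply: bigO_sum; apply: leaf_codom => d; exact: christoffel_small.
have b1 : bigO K 2 (fun t p => \sum_(b | mA b) ((\sum_(i | mB i) Gt i i b t p) ^+ 2
    + (\sum_(i | mB i) Gt i i b t p) * Gt nu nu b t p)).
  apply: bigO_sum; apply: leaf_codom => a.
  have th := thA (ja a) (fun d => leaf_christoffel HB d d a).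
  have nn := christoffel_small (leaf_christoffel_reeb HA a).
  by apply: eq_bigO (bigO_add (bigO_mul th th) (bigO_mul th nn)) => t p; rewrite expr2.
have b2 : bigO K 2 (fun t p => \sum_(b | mB b) ((\sum_(i | mA i) Gt i i b t p) ^+ 2
    + (\sum_(i | mA i) Gt i i b t p) * Gt nu nu b t p)).
  apply: bigO_sum; apply: leaf_codom => a.
  have th := thB (jb a) (fun d => leaf_christoffel HA d d a).
  have nn := christoffel_small (leaf_christoffel_reeb HB a).
  by apply: eq_bigO (bigO_add (bigO_mul th th) (bigO_mul th nn)) => t p; rewrite expr2.
have b3 : bigO K 2 (fun t p => \sum_(a | mA a) \sum_(b | mA b) \sum_(i | mB i)
    Gt a b i t p * Gt b a i t p).
  apply: bigO_sum; apply: leaf_codom => a; apply: bigO_sum; apply: leaf_codom => b.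
  apply: bigO_sum; apply: leaf_codom => d.
  exact: bigO_mul (christoffel_small (leaf_christoffel HA a b d))
    (christoffel_small (leaf_christoffel HA b a d)).
have b4 : bigO K 2 (fun t p => \sum_(a | mB a) \sum_(b | mB b) \sum_(i | mA i)
    Gt a b i t p * Gt b a i t p).
  apply: bigO_sum; apply: leaf_codom => a; apply: bigO_sum; apply: leaf_codom => b.
  apply: bigO_sum; apply: leaf_codom => d.
  exact: bigO_mul (christoffel_small (leaf_christoffel HB a b d))
    (christoffel_small (leaf_christoffel HB b a d)).
have b5 := bigO_mul (thA nu (leaf_christoffel0 HB)) (thB nu (leaf_christoffel0 HA)).
have yz a b : bigO K 1 (ct nu (ja a) (jb b)) /\ bigO K 1 (ct nu (jb b) (ja a)).
  by split; apply: structure_small => p; [exact: (leaf_mix HA)|exact: (leaf_mix HB)].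
have b6 : eqO K 2 (fun t p => \sum_a \sum_b
     (Gt (ja a) (jb b) nu t p * Gt (jb b) (ja a) nu t p
      - (Gt (ja a) (jb b) nu t p - Gt (jb b) (ja a) nu t p) * Gt nu (jb b) (ja a) t p))
  (fun t p => \sum_a \sum_b (- (3 / 4) * (ct (ja a) (jb b) nu t p) ^+ 2
    + kap / 2 * (a == b)%:R * (ct nu (ja a) (jb b) t p - ct nu (jb b) (ja a) t p))).
  apply: eqO_sum => a _; apply: eqO_sum => b _; have [y1 z1] := yz a b.
  have x1 := structure_eqO (ja a) (jb b) nu.
  have s1 := bigO_add y1 z1.
  apply: eq_bigO (bigO_add (bigO_scale 2^-1 (bigO_mul x1 (bigO_sub y1 z1)))
    (bigO_scale 4^-1 (bigO_mul s1 s1))) => t p.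
  have frE := adapted_frame ad t.
  rewrite (leaf_contact HA) /Gt /christoffel /ct.
  rewrite (structureC frE nu (jb b) (ja a)) (structureC frE (ja a) (jb b) nu).
  rewrite (structureC frE nu (ja a) (jb b)).
  by field.
apply: eq_bigO (bigO_add (bigO_sub (bigO_sub (bigO_sub (bigO_add b1 b2) b3) b4) b5) b6) => t p.
rewrite /walczak_quadratic.
rewrite (leaf_sum_codom HA (fun a => \sum_(i | mB i) _)).
under [X in _ = _ + X - _]eq_bigr => a _ do rewrite (leaf_sum_codom HB).
by ring.
Qed.

(** To first order [contact_structure] is kap P L L with diagonal factors, whose squares are H and 2
    - H by [mixed_square] and [adapted_square]. For a != b the structure function is itself O(t). *)
Lemma contact_square a b : eqO K 2 (fun t p => (ct (ja a) (jb b) nu t p) ^+ 2)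
  (fun t p => kap ^+ 2 * (a == b)%:R * H nu nu t p * (2 - H (ja a) (ja a) t p) *
     (2 - H (jb a) (jb a) t p)).
Proof.
have [HA HB] := cp.
case: (eqVneq a b) => [<-|ab]; last first.
  have x1 : bigO K 1 (ct (ja a) (jb b) nu).
    by apply: structure_small => p; rewrite (leaf_contact HA) (negbTE ab) mulr0.
  by apply: eq_bigO (bigO_mul x1 x1) => t p; rewrite mulr0n expr2; ring.
have offA d : d != a -> bigO K 1 (L (ja a) (ja d)).
  by move=> da; apply: adm_off => //; rewrite (leaf_inj HA) eq_sym.
have offB d : d != a -> bigO K 1 (L (jb a) (jb d)).
  by move=> da; apply: adm_off => //; rewrite (leaf_inj HB) eq_sym.
have b0 (U : 'I_N -> 'I_N -> R -> M -> R) i :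
    (forall i j, adm A F K (i == j)%:R (U i j)) -> bigO K 0 (U i i).
  by move=> aU; exact: adm_bigO0 (aU i i).
have bLA := b0 L (ja a) La; have bLB := b0 L (jb a) La; have bP := b0 P nu Pa.
have bHA := b0 H (ja a) Ha; have bHB := b0 H (jb a) Ha; have bH := b0 H nu Ha.
have b2A : bigO K 0 (fun t p => 2 - H (ja a) (ja a) t p) by apply: bigO_sub => //; exact: bigO_cst.
have b2B : bigO K 0 (fun t p => 2 - H (jb a) (jb a) t p) by apply: bigO_sub => //; exact: bigO_cst.
have m2 : eqO K 2 (ct (ja a) (jb a) nu)
    (fun t p => kap * P nu nu t p * (L (ja a) (ja a) t p * L (jb a) (jb a) t p)).
  have := eqO_diag offA offB => D.
  apply: eq_bigO (bigOMl (bigO_scale kap bP) D) => t p.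
  by rewrite contact_structure; ring.
have bx : bigO K 0 (ct (ja a) (jb a) nu).
  apply: eqO_bigO (bigOW _ m2) _ => //.
  exact: bigO_mul (bigO_scale kap bP) (bigO_mul bLA bLB).
have bm := bigO_mul (bigO_scale kap bP) (bigO_mul bLA bLB).
have H1 := eqO_mul bx bm m2 m2.
have H2 := eqO_mul (bigO_mul bP bP) (bigO_mul b2A b2B) (mixed_square nu)
  (eqO_mul (bigO_mul bLA bLA) b2B (adapted_square (ja a)) (adapted_square (jb a))).
apply: eq_bigO (bigO_add H1 (bigO_scale (kap ^+ 2) H2)) => t p.
by rewrite !expr2 mulr1n; ring.
Qed.

End Leaf.


(** * The curvature density to first order *)

Section Density.
Variables (ja jb : 'I_n -> 'I_N) (nu : 'I_N).
Hypothesis cp : contact_pair g F ja jb nu 2.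
Hypotheses (lA : adapted_leaf ja jb nu) (lB : adapted_leaf jb ja nu).
Hypothesis flat : eqO K 2 (H nu nu) (fun=> fun=> 1).

Let q t p := walczak_quadratic (fun i => i \in codom ja) (fun i => i \in codom jb) nu
  (fun i j k => Gt i j k t p).
(** For the f-basis this is the divergence of f applied to E t nu, because f maps e_a to e_(n+a) and
    e_(n+a) to - e_a. *)
Let Y t p := - \sum_a frame_div g F (L nu (jb a) t) (ja a) p
  + \sum_a frame_div g F (L nu (ja a) t) (jb a) p.

(** With kap = 2 each pair gives -3 + 3 (H_a - 1) + 3 (H_b - 1). The sum of the deviations is 3 tr
    (H - 1) without its nu-entry, which [flat] makes negligible; [rel_density_eqO2] rewrites it as 6
    (rho - 1). *)
Lemma walczak_expansion :
  eqO K 2 q (fun t p => - (3 * n)%:R + 6 * (rho t p - 1) + Y t p).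
Proof.
have [HA HB] := cp; have two0 : (2 : R) != 0 by rewrite pnatr_eq0.
have Y1 := reeb_trace cp two0 lA.
have two0' : - (2 : R) != 0 by rewrite oppr_eq0.
have Y2 := reeb_trace (contact_pairC cp) two0' lB.
have W := walczak_eqO cp.
have X a b : eqO K 2 (fun t p => (ct (ja a) (jb b) nu t p) ^+ 2)
    (fun t p => 4 * (a == b)%:R * (1 - (H (ja a) (ja a) t p - 1) - (H (jb a) (jb a) t p - 1))).
  have b1 i : bigO K 1 (fun t p => H i i t p - 1).
    by have := adm_eqO (Ha i i); rewrite eqxx.
  have b2 i : bigO K 0 (fun t p => 2 - H i i t p).
    by apply: bigO_sub; [exact: bigO_cst|exact: adm_bigO0 (Ha i i)].
  apply: eqO_trans (contact_square cp lA lB a b) _.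
  apply: eq_bigO (bigO_scale (4 * (a == b)%:R) (bigO_add (bigO_mul (b1 (ja a)) (b1 (jb a)))
    (bigOMr flat (bigO_mul (b2 (ja a)) (b2 (jb a)))))) => t p.
  by ring.
have W2 : eqO K 2 (fun t p => \sum_a \sum_b - (3 / 4) * (ct (ja a) (jb b) nu t p) ^+ 2)
    (fun t p => \sum_a \sum_b - (3 / 4) *
      (4 * (a == b)%:R * (1 - (H (ja a) (ja a) t p - 1) - (H (jb a) (jb a) t p - 1)))).
  apply: eqO_sum => a _; apply: eqO_sum => b _.
  by apply: eq_bigO (bigO_scale (- (3 / 4)) (X a b)) => t p; ring.
apply: eq_bigO (bigO_add (bigO_add W W2) (bigO_add (bigO_sub Y1 Y2)
  (bigO_add (bigO_scale (-3) rel_density_eqO2) (bigO_scale (-3) flat)))) => t p.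
rewrite (leaf_sum HA) /Y.
have -> : \sum_a \sum_b (- (3 / 4) * (ct (ja a) (jb b) nu t p) ^+ 2
    + 2 / 2 * (a == b)%:R * (ct nu (ja a) (jb b) t p - ct nu (jb b) (ja a) t p)) =
    \sum_a \sum_b - (3 / 4) * (ct (ja a) (jb b) nu t p) ^+ 2 +
    (\sum_a ct nu (ja a) (jb a) t p - \sum_a ct nu (jb a) (ja a) t p).
  rewrite -sumrB -big_split /=; apply: eq_bigr => a _; rewrite big_split /=; congr (_ + _).
  rewrite (bigD1 a) //= big1 ?addr0 => [|b /negbTE ab]; first by rewrite eqxx mulr1n; field.
  by rewrite eq_sym ab mulr0n mulr0 mul0r.
have -> : \sum_a \sum_b - (3 / 4) *
    (4 * (a == b)%:R * (1 - (H (ja a) (ja a) t p - 1) - (H (jb a) (jb a) t p - 1))) =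
    - (3 * n)%:R + 3 * \sum_a (H (ja a) (ja a) t p - 1) + 3 * \sum_a (H (jb a) (jb a) t p - 1).
  rewrite !mulr_sumr (_ : - (3 * n)%:R = \sum_(a < n) - (3 : R)); last first.
    by rewrite sumr_const card_ord natrM mulNrn mulr_natr.
  rewrite -!big_split /=; apply: eq_bigr => a _.
  rewrite (bigD1 a) //= big1 ?addr0 => [|b /negbTE ab]; first by rewrite eqxx mulr1n; field.
  by rewrite eq_sym ab mulr0n mulr0 mul0r mulr0.
by rewrite /q; ring.
Qed.

(** Y and rho - 1 are both O(t), so multiplication by rho changes only the constant term, which
    contributes -3n (rho - 1). *)
Lemma curvature_density : eqO K 2 (fun t p => q t p * rho t p)
  (fun t p => - (3 * n)%:R + (6 - (3 * n)%:R) * (rho t p - 1) + Y t p).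
Proof.
have [HA HB] := cp; have two0 : (2 : R) != 0 by rewrite pnatr_eq0.
have two0' : - (2 : R) != 0 by rewrite oppr_eq0.
have r1 := rel_density_eqO1.
have r0 : bigO K 0 (fun t => rho t).
  apply: eqO_bigO (bigO_cst K 1); exact: bigOW r1.
have Y1 : bigO K 1 Y.
  have b1 : bigO K 1 (fun t p => - \sum_a frame_div g F (L nu (jb a) t) (ja a) p).
    apply: eqO_bigO (bigOW (leqnSn 1) (eqO_sym (reeb_trace cp two0 lA))) _.
    by apply: bigO_sum => a _; apply: structure_small => p; exact: (leaf_mix HA).
  have b2 : bigO K 1 (fun t p => - \sum_a frame_div g F (L nu (ja a) t) (jb a) p).
    apply: eqO_bigO (bigOW (leqnSn 1) (eqO_sym (reeb_trace (contact_pairC cp) two0' lB))) _.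
    by apply: bigO_sum => a _; apply: structure_small => p; exact: (leaf_mix HB).
  by apply: eq_bigO (bigO_sub b1 b2) => t p; rewrite opprK.
apply: eq_bigO (bigO_add (bigOMr walczak_expansion r0)
  (bigO_add (bigO_scale 6 (bigO_mul r1 r1)) (bigO_mul Y1 r1))) => t p.
by ring.
Qed.

End Density.
End AdaptedFamilies.

(** * Construction of the adapted orthonormal frames *)

Section OrthonormalFields.
Variables (R : realType) (N : nat) (M : ptopologicalType) (A : manifold R N M).
Variables (g h : metric R M) (F E : 'I_N -> vfield R M).
Hypotheses (frF : orthoframe A g F) (hr : riemannian_metric A h).

(** Orthonormality makes the square coefficient matrix L of E in F invertible. What remains of v
    after projection is orthogonal to E, hence to F, hence to itself. *)
Lemma orthonormal_orthoframe : (forall i, is_vfield A (E i)) ->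
  (forall p i j, h p (E i p) (E j p) = (i == j)%:R) -> orthoframe A h E.
Proof.
move=> Ev Eo; split => // p v tv.
have [_ Fv _ Fs] := frF.
have Et i : tangent_at A p (E i p) by exact: vfield_tangent.
have Ft i : tangent_at A p (F i p) by exact: vfield_tangent.
pose L : 'M[R]_N := \matrix_(i, j) fcomp g F (E i) j p.
pose B : 'M[R]_N := \matrix_(i, j) h p (F i p) (E j p).
have LB : L *m B = 1%:M.
  apply/matrixP => i j; rewrite !mxE -(Eo p) [X in h p X _](fcompE frF p (Ev i)).
  rewrite (metric_suml hr) //; apply: eq_bigr => k _; by rewrite !mxE.
have tS : tangent_at A p (\sum_i h p v (E i p) *: E i p).
  by apply: tangent_at_sum => i; exact: tangent_atZ.
pose w := v - \sum_i h p v (E i p) *: E i p.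
have tw : tangent_at A p w by apply: tangent_atD => //; exact: tangent_atN.
have wE j : h p w (E j p) = 0.
  rewrite (metricBl hr) // (metric_suml hr) // (bigD1 j) //= big1 => [|i /negbTE ij].
    by rewrite Eo eqxx mulr1 addr0 subrr.
  by rewrite Eo ij mulr0.
have wF j : h p w (F j p) = 0.
  have : (\row_j h p w (F j p)) *m L^T = 0.
    apply/rowP => i; rewrite !mxE -[RHS](wE i) [X in _ = h p _ X](fcompE frF p (Ev i)).
    rewrite (metric_sumr hr) //; apply: eq_bigr => k _; by rewrite !mxE mulrC.
  have [uL _] := mulmx1_unit LB.
  move/(congr1 (fun z => z *m (invmx L)^T)).
  rewrite -mulmxA -trmx_mul mulVmx // trmx1 mulmx1 mul0mx => /rowP/(_ j).
  by rewrite !mxE.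
have w0 : h p w w = 0.
  rewrite {2}(Fs p w tw) (metric_sumr hr) // big1 // => j _; by rewrite wF mulr0.
have [//|] := eqVneq w 0; first by move/eqP; rewrite subr_eq0 => /eqP.
by case: hr => _ _ pos _ /(pos p w tw); rewrite w0 ltxx.
Qed.

End OrthonormalFields.

Section BuildFamily.
Variables (R : realType) (N n : nat) (M : ptopologicalType) (A : manifold R N M).
Variables (g : metric R M) (F : 'I_N -> vfield R M) (K : set M).
Hypotheses (frF : orthoframe A g F) (cK : compact K).
Variable h : R -> metric R M.
Hypothesis hr : forall t, riemannian_metric A (h t).
Hypothesis Ha : forall i j, adm A F K (i == j)%:R (fun t p => h t p (F i p) (F j p)).
Let Fv i : is_vfield A (F i). Proof. by case: frF. Qed.
Let Fo p i j : g p (F i p) (F j p) = (i == j)%:R. Proof. by case: frF. Qed.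
Let gr : riemannian_metric A g. Proof. by case: frF. Qed.
Let Ft i p : tangent_at A p (F i p). Proof. exact: vfield_tangent. Qed.

Definition row_field (j : 'I_n -> 'I_N) (L : R -> M -> 'M[R]_n) t a : vfield R M :=
  fun p => \sum_b L t p a b *: F (j b) p.

Lemma row_field_vfield j (L : R -> M -> 'M[R]_n) t a :
  (forall a b, adm A F K (a == b)%:R (fun t p => L t p a b)) ->
  is_vfield A (row_field j L t a).
Proof. by move=> aL; apply: is_vfield_lin => b //; case: (aL a b). Qed.

Lemma row_field_comp j L t a k p :
  fcomp g F (row_field j L t a) k p = \sum_b L t p a b * (j b == k)%:R.
Proof.
rewrite /fcomp /row_field (metric_suml gr) //.
by apply: eq_bigr => b _; rewrite Fo.
Qed.

Lemma row_field_adm j (L : R -> M -> 'M[R]_n) a k :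
  (forall a b, adm A F K (a == b)%:R (fun t p => L t p a b)) ->
  adm A F K (j a == k)%:R (fun t p => fcomp g F (row_field j L t a) k p).
Proof.
move=> aL; have := adm_sum frF (index_enum 'I_n) (fun b =>
  adm_mul frF (aL a b) (adm_cst K frF (j b == k)%:R)).
rewrite (_ : \sum_b _ = (j a == k)%:R); last first.
  rewrite (bigD1 a) //= big1 ?addr0 => [|b /negbTE ab]; first by rewrite eqxx mul1r.
  by rewrite eq_sym ab mul0r.
by apply: adm_eq => t p; rewrite row_field_comp.
Qed.

Lemma row_field_metric j L t a p v : tangent_at A p v ->
  h t p (row_field j L t a p) v = \sum_b L t p a b * h t p (F (j b) p) v.
Proof. by move=> tv; rewrite /row_field (metric_suml (hr t)). Qed.

(** Gram-Schmidt within one block, by [adm_cholesky]. The last clause, invertibility of L, later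
    transfers orthogonality from the new fields back to the old ones. *)
Lemma row_field_orthonormal (j : 'I_n -> 'I_N) :
  (forall a b, (j a == j b) = (a == b)) ->
  exists L : R -> M -> 'M[R]_n, [/\ forall a b, adm A F K (a == b)%:R (fun t p => L t p a b),
    forall t p a b, h t p (row_field j L t a p) (row_field j L t b p) = (a == b)%:R &
    forall t p (x : 'I_n -> R), (forall a, \sum_b L t p a b * x b = 0) -> forall a, x a = 0].
Proof.
move=> jinj.
pose G t p : 'M[R]_n := \matrix_(a, b) h t p (F (j a) p) (F (j b) p).
have [||t p x x0|L [aL HL]] := @adm_cholesky _ _ _ _ _ _ K frF n G.
- by move=> a b; rewrite -jinj; apply: adm_eq (Ha (j a) (j b)) => t p; rewrite mxE.
- by move=> t p a b; rewrite !mxE (metric_sym (hr t)).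
- pose v := \sum_a x ord0 a *: F (j a) p.
  have tv : tangent_at A p v by apply: tangent_at_sum => a; exact: tangent_atZ.
  have -> : (x *m G t p *m x^T) ord0 ord0 = h t p v v.
    rewrite [in RHS]/v (metric_suml (hr t)) // mxE.
    under eq_bigr => b _ do rewrite !mxE mulr_suml.
    rewrite exchange_big /=; apply: eq_bigr => a _; rewrite (metric_sumr (hr t)) // mulr_sumr.
    by apply: eq_bigr => b _; rewrite !mxE; ring.
  case: (hr t) => _ _ pos _; apply: pos => //; apply: contraNneq x0 => v0.
  apply/eqP/rowP => a; rewrite [RHS]mxE -(metric0l gr (Ft (j a) p)) -v0 (metric_suml gr) //.
  rewrite (bigD1 a) //= big1 ?addr0 => [|b /negbTE ba]; first by rewrite Fo eqxx mulr1.
  by rewrite Fo jinj ba mulr0.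
exists L; split => // [t p a b|t p x Lx a].
  have tL c : tangent_at A p (row_field j L t c p).
    by apply: tangent_at_sum => b'; exact: tangent_atZ.
  have := HL t p => /matrixP/(_ a b); rewrite [RHS]mxE => <-.
  rewrite row_field_metric // mxE.
  under [RHS]eq_bigr => c _ do rewrite !mxE mulr_suml.
  rewrite exchange_big /=; apply: eq_bigr => c _.
  rewrite /row_field (metric_sumr (hr t)) // mulr_sumr.
  by apply: eq_bigr => d _; rewrite !mxE; ring.
have uL : L t p \in unitmx by have := HL t p; rewrite -mulmxA => /mulmx1_unit[].
have : L t p *m (\col_a x a) = 0.
  by apply/colP => c; rewrite !mxE -[RHS](Lx c); apply: eq_bigr => b _; rewrite mxE.
move/(congr1 (mulmx (invmx (L t p)))); rewrite mulKmx // mulmx0 => /colP/(_ a).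
by rewrite !mxE.
Qed.

Section Assemble.
Variables (ja jb : 'I_n -> 'I_N) (nu : 'I_N) (kap : R).
Hypothesis cp : contact_pair g F ja jb nu kap.
Hypothesis Hab : forall t p a b, h t p (F (ja a) p) (F (jb b) p) = 0.

Definition index_case (T : Type) (fa fb : 'I_n -> T) (f0 : T) (k : 'I_N) : T :=
  if [pick a | ja a == k] is Some a then fa a
  else if [pick b | jb b == k] is Some b then fb b else f0.

Lemma index_caseA T (fa fb : 'I_n -> T) f0 a : index_case fa fb f0 (ja a) = fa a.
Proof.
have [HA HB] := cp; rewrite /index_case; case: pickP => [b|/(_ a)]; last by rewrite eqxx.
by rewrite (leaf_inj HA) => /eqP ->.
Qed.

Lemma index_caseB T (fa fb : 'I_n -> T) f0 b : index_case fa fb f0 (jb b) = fb b.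
Proof.
have [HA HB] := cp; rewrite /index_case; case: pickP => [a|_]; first by rewrite (leaf_neq HA).
case: pickP => [d|/(_ b)]; last by rewrite eqxx.
by rewrite (leaf_inj HB) => /eqP ->.
Qed.

Lemma index_case0 T (fa fb : 'I_n -> T) f0 : index_case fa fb f0 nu = f0.
Proof.
have [HA HB] := cp; rewrite /index_case; case: pickP => [a|_]; first by rewrite (leaf_neq0 HA).
by case: pickP => // b; rewrite (leaf_neq0 HB).
Qed.

Lemma adapted_family_exists : exists E, [/\ adapted_family A g F K h E,
  adapted_leaf g F h E ja jb nu & adapted_leaf g F h E jb ja nu].
Proof.
have [HA HB] := cp.
have [LA [aLA oA iA]] := row_field_orthonormal (leaf_inj HA).
have [LB [aLB oB iB]] := row_field_orthonormal (leaf_inj HB).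
pose EA := row_field ja LA; pose EB := row_field jb LB.
have vA t a : is_vfield A (EA t a) by exact: row_field_vfield.
have vB t b : is_vfield A (EB t b) by exact: row_field_vfield.
have tA t a p : tangent_at A p (EA t a p) by exact: vfield_tangent.
have tB t b p : tangent_at A p (EB t b p) by exact: vfield_tangent.
have oAB t p a b : h t p (EA t a p) (EB t b p) = 0.
  rewrite row_field_metric // big1 // => c _; rewrite [X in _ * X](metric_sym (hr t)) //.
  rewrite row_field_metric // big1 ?mulr0 // => d _.
  by rewrite (metric_sym (hr t)) // Hab mulr0.
pose ca a t p := h t p (EA t a p) (F nu p); pose cb b t p := h t p (EB t b p) (F nu p).
have aca a : adm A F K 0 (ca a).
  have := adm_sum frF (index_enum 'I_n) (fun b => adm_mul frF (aLA a b) (Ha (ja b) nu)).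
  rewrite big1 => [|b _]; last by rewrite (leaf_neq0 HA) mulr0.
  by apply: adm_eq => t p; rewrite /ca row_field_metric.
have acb b : adm A F K 0 (cb b).
  have := adm_sum frF (index_enum 'I_n) (fun c => adm_mul frF (aLB b c) (Ha (jb c) nu)).
  rewrite big1 => [|c _]; last by rewrite (leaf_neq0 HB) mulr0.
  by apply: adm_eq => t p; rewrite /cb row_field_metric.
(* Gram-Schmidt: the component of [F nu] normal to both blocks. *)
pose v t : vfield R M := fun p =>
  F nu p - (\sum_a ca a t p *: EA t a p + \sum_b cb b t p *: EB t b p).
have vv t : is_vfield A (v t).
  apply: (@is_vfieldB _ _ _ A (F nu)
    (fun p => \sum_a ca a t p *: EA t a p + \sum_b cb b t p *: EB t b p)) => //.
  apply: (@is_vfieldD _ _ _ A (fun p => \sum_a ca a t p *: EA t a p)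
    (fun p => \sum_b cb b t p *: EB t b p)).
    by apply: is_vfield_lin => // a; case: (aca a).
  by apply: is_vfield_lin => // b; case: (acb b).
have tv t p : tangent_at A p (v t p) by exact: vfield_tangent.
have tSA t p : tangent_at A p (\sum_a ca a t p *: EA t a p).
  by apply: tangent_at_sum => a; exact: tangent_atZ.
have tSB t p : tangent_at A p (\sum_b cb b t p *: EB t b p).
  by apply: tangent_at_sum => b; exact: tangent_atZ.
have hv t p w : tangent_at A p w -> h t p (v t p) w = h t p (F nu p) w -
    (\sum_a ca a t p * h t p (EA t a p) w + \sum_b cb b t p * h t p (EB t b p) w).
  move=> tw; rewrite /v (metricBl (hr t)) //; last exact: tangent_atD.
  by rewrite (metricDl (hr t)) // !(metric_suml (hr t)).
have hvA t p a : h t p (v t p) (EA t a p) = 0.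
  rewrite hv // (bigD1 a) //= oA eqxx mulr1 big1 => [|b /negbTE ba]; last by rewrite oA ba mulr0.
  rewrite big1 => [|b _]; last by rewrite (metric_sym (hr t)) // oAB mulr0.
  by rewrite /ca (metric_sym (hr t)) // !addr0 subrr.
have hvB t p b : h t p (v t p) (EB t b p) = 0.
  rewrite hv // [X in _ - (_ + X)](bigD1 b) //= oB eqxx mulr1.
  rewrite big1 => [|a _]; last by rewrite oAB mulr0.
  rewrite big1 => [|d /negbTE bd]; last by rewrite oB bd mulr0.
  by rewrite /cb (metric_sym (hr t)) // add0r addr0 subrr.
pose q t p := h t p (F nu p) (F nu p) -
  (\sum_a ca a t p * ca a t p + \sum_b cb b t p * cb b t p).
have hvv t p : h t p (v t p) (v t p) = q t p.
  rewrite hv // big1 => [|a _]; last by rewrite (metric_sym (hr t)) // hvA mulr0.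
  rewrite big1 => [|b _]; last by rewrite (metric_sym (hr t)) // hvB mulr0.
  by rewrite addr0 subr0 (metric_sym (hr t)) // hv.
have gv t p k : fcomp g F (v t) k p = (nu == k)%:R - (\sum_a ca a t p * fcomp g F (EA t a) k p
    + \sum_b cb b t p * fcomp g F (EB t b) k p).
  rewrite /fcomp /v (metricBl gr) //; last exact: tangent_atD.
  by rewrite Fo (metricDl gr) // !(metric_suml gr).
have gA0 t p a : fcomp g F (EA t a) nu p = 0.
  by rewrite row_field_comp big1 // => b _; rewrite (leaf_neq0 HA) mulr0.
have gB0 t p b : fcomp g F (EB t b) nu p = 0.
  by rewrite row_field_comp big1 // => d _; rewrite (leaf_neq0 HB) mulr0.
(* The new leaf fields have no F nu-component with respect to g, so that of v is 1 and v does not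
   vanish. *)
have q0 t p : 0 < q t p.
  rewrite -hvv; case: (hr t) => _ _ pos _; apply: pos => //; apply/eqP => v0.
  have := gv t p nu; rewrite {1}/fcomp v0 (metric0l gr) // eqxx.
  rewrite big1 => [|a _]; last by rewrite gA0 mulr0.
  rewrite big1 => [|b _]; last by rewrite gB0 mulr0.
  by rewrite addr0 subr0 => /eqP; rewrite eq_sym oner_eq0.
have aq : adm A F K 1 q.
  have := adm_sub frF (Ha nu nu) (adm_add frF
    (adm_sum frF (index_enum 'I_n) (fun a => adm_mul frF (aca a) (aca a)))
    (adm_sum frF (index_enum 'I_n) (fun b => adm_mul frF (acb b) (acb b)))).
  rewrite eqxx big1 => [|a _]; last by rewrite mulr0.
  by rewrite addr0 subr0.
pose s t p := (Num.sqrt (q t p))^-1.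
have sq0 t p : 0 < Num.sqrt (q t p) by rewrite sqrtr_gt0.
have as_ : adm A F K 1 s.
  by have := adm_inv frF sq0 (adm_sqrt frF q0 aq); rewrite sqrtr1 invr1.
pose E0 t : vfield R M := scale_vf (s t) (v t).
have v0 t : is_vfield A (E0 t) by apply: is_vfield_scale => //; case: as_.
pose E t := index_case (EA t) (EB t) (E0 t).
have EEA t a : E t (ja a) = EA t a by exact: index_caseA.
have EEB t b : E t (jb b) = EB t b by exact: index_caseB.
have EE0 t : E t nu = E0 t by exact: index_case0.
have vE t k : is_vfield A (E t k).
  by case: (leaf_case k HA) => [[a ->]|[b ->]|->]; rewrite ?EEA ?EEB ?EE0.
have h0A t p a : h t p (E0 t p) (EA t a p) = 0.
  by rewrite /E0 /scale_vf (metricZl (hr t)) // hvA mulr0.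
have h0B t p b : h t p (E0 t p) (EB t b p) = 0.
  by rewrite /E0 /scale_vf (metricZl (hr t)) // hvB mulr0.
have t0 t p : tangent_at A p (E0 t p) by exact: vfield_tangent.
have h00 t p : h t p (E0 t p) (E0 t p) = 1.
  rewrite {1}/E0 /scale_vf (metricZl (hr t)) // (metric_sym (hr t)) // {1}/E0 /scale_vf.
  rewrite (metricZl (hr t)) // hvv /s.
  have := sqr_sqrtr (ltW (q0 t p)) => {3}<-.
  by field; rewrite gt_eqF.
have oE t p i j : h t p (E t i p) (E t j p) = (i == j)%:R.
  case: (leaf_case i HA) => [[a ->]|[b ->]|->]; case: (leaf_case j HA) => [[c ->]|[d ->]|->];
    rewrite ?EEA ?EEB ?EE0.
  - by rewrite (leaf_inj HA) oA.
  - by rewrite (leaf_neq HA) oAB.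
  - by rewrite (leaf_neq0 HA) (metric_sym (hr t)) // h0A.
  - by rewrite (leaf_neq HB) (metric_sym (hr t)) // oAB.
  - by rewrite (leaf_inj HB) oB.
  - by rewrite (leaf_neq0 HB) (metric_sym (hr t)) // h0B.
  - by rewrite eq_sym (leaf_neq0 HA) h0A.
  - by rewrite eq_sym (leaf_neq0 HB) h0B.
  - by rewrite eqxx h00.
exists E; split; first split=> // [t|i j].
- exact: (orthonormal_orthoframe frF (hr t) (vE t) (oE t)).
- case: (leaf_case i HA) => [[a ->]|[b ->]|->].
  + by apply: adm_eq (row_field_adm ja a j aLA) => t p; rewrite EEA.
  + by apply: adm_eq (row_field_adm jb b j aLB) => t p; rewrite EEB.
  + have S1 := adm_sum frF (index_enum 'I_n) (fun a =>
      adm_mul frF (aca a) (row_field_adm ja a j aLA)).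
    have S2 := adm_sum frF (index_enum 'I_n) (fun b =>
      adm_mul frF (acb b) (row_field_adm jb b j aLB)).
    have := adm_mul frF as_ (adm_sub frF (adm_cst K frF (nu == j)%:R) (adm_add frF S1 S2)).
    rewrite big1 => [|a _]; last by rewrite mul0r.
    rewrite big1 => [|a _]; last by rewrite mul0r.
    rewrite addr0 subr0 mul1r; apply: adm_eq => t p.
    by rewrite EE0 /E0 (fcompZ frF) // gv.
- split=> [t a b p|t a p|t a b p|t a p]; rewrite ?EEA ?EEB ?EE0.
  + by rewrite row_field_comp big1 // => c _; rewrite (leaf_neq HA) mulr0.
  + exact: gA0.
  + rewrite (metric_sym (hr t)) // row_field_metric // big1 // => c _.
    by rewrite (metric_sym (hr t)) // Hab mulr0.
  + apply: (iA t p (fun a => h t p (F (ja a) p) (E0 t p))) => c.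
    by rewrite -(row_field_metric ja LA) // (metric_sym (hr t)) // h0A.
- split=> [t a b p|t a p|t a b p|t a p]; rewrite ?EEA ?EEB ?EE0.
  + by rewrite row_field_comp big1 // => c _; rewrite (leaf_neq HB) mulr0.
  + exact: gB0.
  + rewrite (metric_sym (hr t)) // row_field_metric // big1 // => c _.
    by rewrite Hab mulr0.
  + apply: (iB t p (fun a => h t p (F (jb a) p) (E0 t p))) => c.
    by rewrite -(row_field_metric jb LB) // (metric_sym (hr t)) // h0B.
Qed.

End Assemble.
End BuildFamily.

(** * The frame of a K-contact manifold *)

Section CoordinateBlocks.
Variables (R : realType) (N : nat) (M : ptopologicalType) (A : manifold R N M).
Variables (I : finType) (g : metric R M) (E : I -> vfield R M).
Hypothesis frE : orthoframe A g E.
Let gr : riemannian_metric A g. Proof. by case: frE. Qed.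
Let Et i p : tangent_at A p (E i p).
Proof. by have [_ Ev _ _] := frE; exact: vfield_tangent. Qed.
Let Eo p i j : g p (E i p) (E j p) = (i == j)%:R. Proof. by case: frE. Qed.

Lemma sum_codom k (j : 'I_k -> I) (G : I -> tvec R M) : injective j ->
  \sum_(i | i \in codom j) G i = \sum_a G (j a).
Proof.
move=> ji; have u : uniq (codom j) by rewrite map_inj_uniq ?enum_uniq.
by rewrite -(big_uniq _ u) big_image.
Qed.

Lemma block_expansion (m : pred I) p v : block A g E m p v ->
  v = \sum_(i | m i) g p v (E i p) *: E i p.
Proof.
move=> [tv v0]; have [_ _ _ Es] := frE; rewrite {1}(Es p v tv) [RHS]big_mkcond.
apply: eq_bigr => i _; case: ifPn => // mi; by rewrite v0 // scale0r.
Qed.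

Lemma spanned_block k (j : 'I_k -> I) p : injective j ->
  spanned (fun a => E (j a)) p = block A g E (fun i => i \in codom j) p.
Proof.
move=> ji; apply/seteqP; split=> [v [a ->]|v bv].
  split=> [|i ni]; first by apply: tangent_at_sum => b; exact: tangent_atZ.
  rewrite (metric_suml gr) // big1 // => b _; rewrite Eo.
  by case: eqP ni => [<-|_ _]; [rewrite codom_f|rewrite mulr0].
exists (fun a => g p v (E (j a) p)).
by rewrite {1}(block_expansion bv) (sum_codom (fun i => g p v (E i p) *: E i p)).
Qed.

(** The explicit sum shows that the [get] in [orthoproj_at] has a value; testing that value against
    the frame fields of the block determines it. *)
Lemma orthoproj_block (D : tdistribution R M) (m : pred I) p v :
  D p = block A g E m p -> tangent_at A p v ->
  orthoproj_at g D p v = \sum_(i | m i) g p v (E i p) *: E i p.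
Proof.
move=> Dp tv; rewrite /orthoproj_at Dp.
set w := \sum_(i | m i) _.
have tw : tangent_at A p w by apply: tangent_at_sum => i; exact: tangent_atZ.
have gw i : g p w (E i p) = if m i then g p v (E i p) else 0.
  rewrite (metric_suml gr) //; case: ifPn => mi; last first.
    rewrite big1 // => j mj; rewrite Eo; case: eqP => [ji|]; last by rewrite mulr0.
    by move: mi; rewrite -ji mj.
  rewrite (bigD1 i) //= Eo eqxx mulr1 big1 ?addr0 // => j /andP[_ /negbTE ji].
  by rewrite Eo ji mulr0.
have [[tx x0] xv] : [set w | block A g E m p w /\
    forall z, block A g E m p z -> g p (v - w) z = 0]
    (get [set w | block A g E m p w /\ forall z, block A g E m p z -> g p (v - w) z = 0]).
  apply: getPex; exists w; split.
    by split=> // i /negbTE mi; rewrite gw mi.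
  move=> z bz; have [tz _] := bz.
  rewrite {1}(block_expansion bz) (metric_sumr gr) //; last first.
    by apply: tangent_atD => //; exact: tangent_atN.
  rewrite big1 // => i mi; rewrite (metricBl gr) // gw mi subrr mulr0 //.
set x := get _ in tx x0 xv *.
rewrite (block_expansion (conj tx x0)); apply: eq_bigr => i mi; congr (_ *: _).
have : block A g E m p (E i p).
  by split=> // j mj; rewrite Eo; case: eqP mj => // <-; rewrite mi.
by move=> /xv; rewrite (metricBl gr) // => /eqP; rewrite subr_eq0 => /eqP.
Qed.

End CoordinateBlocks.

Section KContactFrame.
Variables (R : realType) (n : nat) (M : ptopologicalType).
Variables (A : manifold R (n + n).+1 M).
Variables (f : M -> tvec R M -> tvec R M) (xi : vfield R M) (eta : M -> tvec R M -> R).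
Variables (g : metric R M) (e : 'I_(n + n) -> vfield R M) (D1 D2 D3 : tdistribution R M).
Hypotheses (HK : K_contact A f xi eta g) (He : f_basis A f g e).
Hypotheses (HD1 : D1 = spanned (fun i : 'I_n => e (lshift n i))).
Hypotheses (HD2 : D2 = spanned (fun i : 'I_n => e (rshift n i))).
Hypotheses (HD3 : D3 = spanned (fun _ : 'I_1 => xi)).
Hypotheses (Hint1 : integrable_distribution A D1) (Hint2 : integrable_distribution A D2).
Hypotheses (Hgeo1 : totally_geodesic A g D1) (Hgeo2 : totally_geodesic A g D2).
Hypotheses (H13 : forall X Y, is_vfield A X -> is_vfield A Y -> Tmix A g D2 D1 D3 X Y = 0).
Hypotheses (H23 : forall X Y, is_vfield A X -> is_vfield A Y -> Tmix A g D1 D2 D3 X Y = 0).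

Let gr : riemannian_metric A g. Proof. exact: Kc_metric HK. Qed.
Let xiv : is_vfield A xi. Proof. exact: Kc_vfield HK. Qed.
Let ev i : is_vfield A (e i). Proof. by case: He. Qed.
Let xit p : tangent_at A p (xi p). Proof. exact: vfield_tangent. Qed.
Let et i p : tangent_at A p (e i p). Proof. exact: vfield_tangent. Qed.
Let ft p u : tangent_at A p u -> tangent_at A p (f p u).
Proof. by have [H _ _] := Kc_endo HK; exact: H. Qed.

Definition kc_frame (k : 'I_(n + n).+1) : vfield R M :=
  if unlift ord0 k is Some i then e i else xi.
Local Notation F := kc_frame.
Definition kc_a (a : 'I_n) : 'I_(n + n).+1 := lift ord0 (lshift n a).
Definition kc_b (a : 'I_n) : 'I_(n + n).+1 := lift ord0 (rshift n a).

Lemma kc_frame0 : F ord0 = xi. Proof. by rewrite /F unlift_none. Qed.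
Lemma kc_frameS i : F (lift ord0 i) = e i. Proof. by rewrite /F liftK. Qed.

(** Compatibility of the metric with f at the pair (u, xi), where f xi = 0. *)
Lemma kc_eta p u : tangent_at A p u -> g p u (xi p) = eta p u.
Proof.
move=> tu; have := Kc_compat HK tu (xit p).
rewrite (Kc_f_xi HK) (Kc_eta_xi HK) mulr1 (metric_sym gr (ft tu) (tangent_at0 A p)).
by rewrite (metric0l gr (ft tu)) => /esym/eqP; rewrite subr_eq0 => /eqP.
Qed.

Lemma kc_eta_basis i p : eta p (e i p) = 0.
Proof.
have [_ _ im _] := He.
have [u tu <-] : image_field A f p (e i p).
  rewrite im; exists (fun j => (j == i)%:R).
  rewrite (bigD1 i) //= eqxx scale1r big1 ?addr0 // => j /negbTE ->.
  by rewrite scale0r.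
exact: Kc_eta_f HK _ _ tu.
Qed.

(** Spanning comes from u = - f(f u) + eta(u) xi, since f(f u) lies in the image of f and is a
    combination of the f-basis. *)
Lemma kc_orthoframe : orthoframe A g F.
Proof.
have [_ eo im _] := He.
have Fv k : is_vfield A (F k) by rewrite /F; case: unlift.
have Ft k p : tangent_at A p (F k p) by exact: vfield_tangent.
have Fo p i j : g p (F i p) (F j p) = (i == j)%:R.
  case: (unliftP ord0 i) => [i' ->|->]; case: (unliftP ord0 j) => [j' ->|->];
    rewrite ?kc_frame0 ?kc_frameS.
  - by rewrite eo (inj_eq (@lift_inj _ ord0)).
  - by rewrite kc_eta // kc_eta_basis.
  - by rewrite (metric_sym gr) // kc_eta // kc_eta_basis.
  - by rewrite kc_eta // (Kc_eta_xi HK).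
split => // p u tu.
have : image_field A f p (f p (f p u)) by exists (f p u) => //; exact: ft.
rewrite im => -[a Ha].
pose a' k := if unlift ord0 k is Some i then - a i else eta p u.
have ua : u = \sum_k a' k *: F k p.
  have := Kc_square HK tu; rewrite Ha => Hs.
  rewrite big_ord_recl kc_frame0 {1}/a' unlift_none.
  under eq_bigr => i _ do rewrite kc_frameS /a' liftK scaleNr.
  by rewrite sumrN Hs opprD opprK addrCA subrr addr0.
rewrite {1}ua; apply: eq_bigr => k _; congr (_ *: _).
rewrite ua (metric_suml gr) // (bigD1 k) //= Fo eqxx mulr1 big1 ?addr0 // => j /negbTE jk.
by rewrite Fo jk mulr0.
Qed.
Let frF := kc_orthoframe.
Local Notation cc := (structure_fun g F).


Section Foliation.
Variables (D : tdistribution R M) (k : nat) (j : 'I_k -> 'I_(n + n).+1).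
Hypotheses (HD : D = spanned (fun a => F (j a))) (ji : injective j).
Let Fv i : is_vfield A (F i). Proof. by case: frF. Qed.
Let Ft i p : tangent_at A p (F i p). Proof. exact: vfield_tangent. Qed.
Let Fo p i l : g p (F i p) (F l p) = (i == l)%:R. Proof. by case: frF. Qed.

Let DE p : D p = block A g F (fun i => i \in codom j) p.
Proof. by rewrite HD; exact: (spanned_block frF p ji). Qed.

Lemma foliation_section a : section_of A D (F (j a)).
Proof.
split=> // p; rewrite DE; split=> // i ni; rewrite Fo.
by case: eqP ni => // <-; rewrite codom_f.
Qed.

Lemma foliation_integrable a b i p : integrable_distribution A D -> i \notin codom j ->
  cc (j a) (j b) i p = 0.
Proof.
move=> HI ni; have [_] := HI _ _ (foliation_section a) (foliation_section b).
by move=> /(_ p); rewrite DE => -[_]; exact.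
Qed.

(** In the Koszul formula the part symmetric in a and b of g(nabla_a F_b, F_i) is half of c(i,a,b) +
    c(i,b,a). *)
Lemma foliation_geodesic a b i p : totally_geodesic A g D -> i \notin codom j ->
  cc i (j a) (j b) p = - cc i (j b) (j a) p.
Proof.
move=> HG ni; have := HG _ _ (foliation_section a) (foliation_section b).
set V := levi_civita A g _ _ + _ => HV.
have lv a' b' : is_vfield A (levi_civita A g (F a') (F b')) by exact: (lc_vfield frF).
have tV : tangent_at A p (V p) by apply: vfield_tangent; exact: is_vfieldD.
have : V p - orthoproj_at g D p (V p) = 0 by have := congr1 (@^~ p) HV.
rewrite (orthoproj_block frF (DE p) tV) => /eqP; rewrite subr_eq0 => /eqP HVp.
have : g p (V p) (F i p) = 0.
  rewrite HVp (metric_suml gr) // big1 // => l lj; rewrite Fo.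
  by case: eqP ni => [<-|]; rewrite ?lj ?mulr0.
rewrite /V vfieldDE (metricDl gr) //; try exact: vfield_tangent.
rewrite !(lc_frame frF) /christoffel (structureC frF (j a) (j b)).
by rewrite (structureC frF i (j b)) (structureC frF i (j a)) => H; lra.
Qed.

Lemma foliation_proj i : orthoproj g D (F i) = if i \in codom j then F i else 0.
Proof.
apply/funext => p; rewrite /orthoproj (orthoproj_block frF (DE p) (Ft i p)).
case: ifPn => ij; last first.
  rewrite big1 // => l lj; rewrite Fo; case: eqP ij => [->|]; first by rewrite lj.
  by rewrite scale0r.
rewrite (bigD1 i) //= Fo eqxx scale1r big1 ?addr0 // => l /andP[_ /negbTE li].
by rewrite Fo eq_sym li scale0r.
Qed.

Lemma foliation_proj0 : orthoproj g D 0 = 0.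
Proof.
apply/funext => p; rewrite /orthoproj (orthoproj_block frF (DE p) (tangent_at0 A p)).
by rewrite big1 // => i _; rewrite (metric0l gr) // scale0r.
Qed.

Lemma foliation_perp i : i \notin codom j -> orthoproj_perp g D (F i) = F i.
Proof. by move=> /negbTE ni; rewrite /orthoproj_perp foliation_proj ni subr0. Qed.

Lemma foliation_Ttilde i l m p : i \notin codom j -> l \notin codom j -> m \in codom j ->
  g p (Ttilde A g D (F i) (F l) p) (F m p) = 2^-1 * cc i l m p.
Proof.
move=> ni nl mj; rewrite /Ttilde !foliation_perp // (lc_torsion frF) //.
have tb : tangent_at A p (bracket (F i) (F l) p).
  by apply: vfield_tangent; exact: is_vfield_bracket.
rewrite /scale_vf /orthoproj (orthoproj_block frF (DE p) tb).
rewrite (metricZl gr) //; last by apply: tangent_at_sum => s; exact: tangent_atZ.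
congr (_ * _); rewrite (metric_suml gr) // (bigD1 m) //= Fo eqxx mulr1 big1 ?addr0 //.
by move=> s /andP[_ /negbTE sm]; rewrite Fo sm mulr0.
Qed.

Lemma foliation_Ttilde0 : Ttilde A g D 0 0 = 0.
Proof.
rewrite /Ttilde /orthoproj_perp foliation_proj0 subr0 subrr foliation_proj0.
by apply/funext => p; rewrite /scale_vf scaler0.
Qed.

End Foliation.

Lemma kc_a_inj : injective kc_a.
Proof. by move=> a b /lift_inj/lshift_inj. Qed.
Lemma kc_b_inj : injective kc_b.
Proof. by move=> a b /lift_inj/rshift_inj. Qed.
Lemma kc_neq a b : (kc_a a == kc_b b) = false.
Proof. by rewrite (inj_eq (@lift_inj _ ord0)) eq_lrshift. Qed.

(** As eta is constant on the frame, d eta of two basis fields is -1/2 eta of their bracket; the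
    normalization of [ext_der] is the origin of the factor 2. *)
Lemma kc_structure_reeb i l p : cc (lift ord0 i) (lift ord0 l) ord0 p =
  - 2 * g p (e i p) (f p (e l p)).
Proof.
rewrite /structure_fun !kc_frameS kc_frame0 kc_eta; last first.
  by apply: vfield_tangent; exact: is_vfield_bracket.
have := Kc_contact HK p (ev i) (ev l); rewrite /ext_der.
have -> : (fun q => eta q (e l q)) = fun=> 0 by apply/funext => q; rewrite kc_eta_basis.
have -> : (fun q => eta q (e i q)) = fun=> 0 by apply/funext => q; rewrite kc_eta_basis.
by rewrite !(tangent_cst (et _ p)) => <-; lra.
Qed.

(** The contact condition at (xi, e_i) gives g(xi, f e_i) = eta(f e_i) = 0. *)
Lemma kc_reeb i p : cc ord0 (lift ord0 i) ord0 p = 0.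
Proof.
rewrite /structure_fun kc_frameS kc_frame0 kc_eta; last first.
  by apply: vfield_tangent; exact: is_vfield_bracket.
have := Kc_contact HK p xiv (ev i); rewrite /ext_der.
have -> : (fun q => eta q (e i q)) = fun=> 0 by apply/funext => q; rewrite kc_eta_basis.
have -> : (fun q => eta q (xi q)) = fun=> 1 by apply/funext => q; rewrite (Kc_eta_xi HK).
rewrite (tangent_cst (et _ p)) (tangent_cst (xit p)).
rewrite (metric_sym gr (xit p) (ft (et i p))) kc_eta; last exact: ft.
by rewrite (Kc_eta_f HK (et i p)) => H; lra.
Qed.

Lemma kc_contact a b p : cc (kc_a a) (kc_b b) ord0 p = 2 * (a == b)%:R.
Proof.
have [_ eo _ fe] := He.
rewrite kc_structure_reeb -fe (Kc_square HK (et _ p)) kc_eta_basis scale0r addr0.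
rewrite (metric_sym gr (et _ p)) ?(metricNl gr) ?eo //; last exact: tangent_atN.
by rewrite (inj_eq (@lshift_inj _ _)) eq_sym; ring.
Qed.

Lemma kc_sum (G : 'I_(n + n).+1 -> R) :
  \sum_k G k = \sum_a G (kc_a a) + \sum_a G (kc_b a) + G ord0.
Proof. by rewrite big_ord_recl addrC big_split_ord. Qed.

Let D1E : D1 = spanned (fun a => F (kc_a a)).
Proof. by rewrite HD1; congr spanned; apply/funext => a; rewrite kc_frameS. Qed.
Let D2E : D2 = spanned (fun a => F (kc_b a)).
Proof. by rewrite HD2; congr spanned; apply/funext => a; rewrite kc_frameS. Qed.
Let D3E : D3 = spanned (fun a : 'I_1 => F ((fun _ => ord0) a)).
Proof. by rewrite HD3; congr spanned; apply/funext => a; rewrite kc_frame0. Qed.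
Let inj1 : injective (fun _ : 'I_1 => ord0 : 'I_(n + n).+1).
Proof. by move=> a b _; rewrite !ord1. Qed.


(** On the pair (F (j a), xi) the second summand of [Tmix] has both arguments projected to 0, and
    the first is half the D'-part of their bracket. *)
Lemma kc_mix (D D' : tdistribution R M) (j j' : 'I_n -> 'I_(n + n).+1) a b p :
  D = spanned (fun a => F (j a)) -> injective j ->
  D' = spanned (fun a => F (j' a)) -> injective j' ->
  (forall i, j i \notin codom j') -> (forall i, j i != ord0) -> (forall i, j' i != ord0) ->
  (forall X Y, is_vfield A X -> is_vfield A Y -> Tmix A g D' D D3 X Y = 0) ->
  cc ord0 (j a) (j' b) p = 0.
Proof.
move=> HD jinj HD' jinj' njj' nj nj' HT.
have [_ Fv _ _] := frF.
have := HT (F (j a)) (F ord0) (Fv _) (Fv _).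
have n0 : ord0 \notin codom j by apply/codomP => -[i /esym/eqP]; exact/negP.
have n0' : ord0 \notin codom j' by apply/codomP => -[i /esym/eqP]; exact/negP.
have nj3 : j a \notin codom (fun _ : 'I_1 => ord0 : 'I_(n + n).+1).
  by apply/codomP => -[i /eqP]; exact/negP.
rewrite /Tmix !(foliation_proj HD jinj) !(foliation_proj D3E inj1).
rewrite codom_f (negbTE n0) (negbTE nj3) (codom_f (fun _ : 'I_1 => ord0) ord0).
rewrite (foliation_Ttilde0 HD' jinj') addr0 => /(congr1 (@^~ p)) /= T0.
have := foliation_Ttilde HD' jinj' p (njj' a) n0' (codom_f j' b).
rewrite T0 (metric0l gr); last exact: vfield_tangent.
by rewrite (structureC frF ord0) => H; lra.
Qed.

Theorem kc_contact_pair : contact_pair g F kc_a kc_b ord0 2.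
Proof.
have n0 j i : lift ord0 j != ord0 :> 'I_(n + n).+1 by rewrite eq_sym neq_lift.
have a0 : ord0 \notin codom kc_a.
  by apply/codomP => -[i /eqP]; rewrite (negbTE (neq_lift _ _)).
have b0 : ord0 \notin codom kc_b.
  by apply/codomP => -[i /eqP]; rewrite (negbTE (neq_lift _ _)).
have ab i : kc_a i \notin codom kc_b by apply/codomP => -[l /eqP]; rewrite kc_neq.
have ba i : kc_b i \notin codom kc_a.
  by apply/codomP => -[l /eqP]; rewrite eq_sym kc_neq.
split; split.
- exact: kc_sum.
- by move=> a b; rewrite (inj_eq kc_a_inj).
- exact: kc_neq.
- by move=> a; rewrite eq_sym (negbTE (neq_lift _ _)).
- by move=> a b d p; apply: (foliation_integrable D1E kc_a_inj).
- by move=> a b p; apply: (foliation_integrable D1E kc_a_inj).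
- by move=> d a b p; apply: (foliation_geodesic D1E kc_a_inj).
- by move=> a b p; apply: (foliation_geodesic D1E kc_a_inj).
- exact: kc_contact.
- by move=> a p; exact: kc_reeb.
- move=> a b p; apply: (kc_mix a b p D1E kc_a_inj D2E kc_b_inj) => //.
- by move=> G; rewrite kc_sum [\sum_a G (kc_a a) + _]addrC.
- by move=> a b; rewrite (inj_eq kc_b_inj).
- by move=> a b; rewrite eq_sym kc_neq.
- by move=> a; rewrite eq_sym (negbTE (neq_lift _ _)).
- by move=> a b d p; apply: (foliation_integrable D2E kc_b_inj).
- by move=> a b p; apply: (foliation_integrable D2E kc_b_inj).
- by move=> d a b p; apply: (foliation_geodesic D2E kc_b_inj).
- by move=> a b p; apply: (foliation_geodesic D2E kc_b_inj).
- by move=> a b p; rewrite (structureC frF) kc_contact eq_sym mulNr.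
- by move=> a p; exact: kc_reeb.
- move=> a b p; apply: (kc_mix a b p D2E kc_b_inj D1E kc_a_inj) => //.
Qed.

End KContactFrame.

(** * The action *)

Section OpenDomainIntegrals.
Variables (R : realType) (N : nat) (M : ptopologicalType) (A : manifold R N M).
Variables (g : metric R M) (F : 'I_N -> vfield R M).
Hypothesis frF : orthoframe A g F.
Variables (mu : {measure set (borel M) -> \bar R}) (K K' Om : set M).
Hypotheses (Hmu : is_volume_measure A g mu) (cK : compact K) (cK' : compact K').
Hypotheses (oO : open Om) (KO : K `<=` Om) (OK' : Om `<=` K').

Lemma smooth_integrable (f : M -> R) : smooth A f ->
  mu.-integrable (Om : set (borel M)) (EFin \o f).
Proof.
move=> sf; have mO : measurable (Om : set (borel M)) by exact: open_borel.
have [C HC] := @compact_continuous_bound R _ K' f cK' (fun x _ => smooth_continuous sf (x := x)).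
apply: measurable_bounded_integrable => //.
- exact: (volume_finite frF Hmu cK' mO OK').
- by apply: measurable_funS (smooth_measurable sf).
- exists C; split; first exact: num_real.
  move=> y Cy x Ox; apply: (@le_trans _ _ C); last exact: ltW.
  by apply: HC; exact: OK'.
Qed.

(** Smoothness is bundled in because it gives integrability over Om, whose closure is compact, and
    hence additivity. *)
Definition null_integral (f : M -> R) :=
  smooth A f /\ \int[mu]_(p in (Om : set (borel M))) f p = 0.

Lemma null_integralD f1 f2 : null_integral f1 -> null_integral f2 ->
  null_integral (fun p => f1 p + f2 p).
Proof.
move=> [s1 i1] [s2 i2]; split; first exact: smooth_add.
have mO : measurable (Om : set (borel M)) by exact: open_borel.
rewrite RintegralD ?i1 ?i2 ?addr0 //; exact: smooth_integrable.
Qed.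

Lemma null_integralN f : null_integral f -> null_integral (fun p => - f p).
Proof.
move=> [s i]; split; first exact: smooth_opp.
have mO : measurable (Om : set (borel M)) by exact: open_borel.
under eq_Rintegral do rewrite -mulN1r.
by rewrite RintegralZl ?i ?mulr0 //; exact: smooth_integrable.
Qed.

Lemma null_integral_sum (I : Type) (r : seq I) (P : pred I) (f : I -> M -> R) :
  (forall i, P i -> null_integral (f i)) ->
  null_integral (fun p => \sum_(i <- r | P i) f i p).
Proof.
move=> Hf; elim: r => [|i r [IHs IHi]].
  have -> : (fun p => \sum_(i <- [::] | P i) f i p) = fun=> 0.
    by apply/funext => p; rewrite big_nil.
  split; first exact: smooth_cst.
  by rewrite Rintegral_cst ?mul0r //; exact: open_borel.
have [E|nP] := boolP (P i); last first.
  have -> : (fun p => \sum_(j <- i :: r | P j) f j p) = (fun p => \sum_(j <- r | P j) f j p).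
    by apply/funext => p; rewrite big_cons (negbTE nP).
  by [].
have -> : (fun p => \sum_(j <- i :: r | P j) f j p) =
    (fun p => f i p + \sum_(j <- r | P j) f j p).
  by apply/funext => p; rewrite big_cons E.
by apply: null_integralD; [exact: Hf|].
Qed.

(** The support K lies in Om, so integrating over Om or over M is the same. *)
Lemma null_integral_div i phi : smooth A phi -> (forall q, ~ K q -> phi q = 0) ->
  null_integral (frame_div g F phi i).
Proof.
move=> sphi phi0; split; first exact: (frame_div_smooth frF).
have [_ I0] := divergence_theorem frF Hmu i cK sphi phi0.
rewrite -[RHS]I0 Rintegral_mkcond; apply: eq_Rintegral => p _.
rewrite /patch; case: ifPn => // nO; rewrite (frame_div_local frF) //.
have oK : open (~` K).
  by apply: closed_openC; apply: compact_closed => //; exact: hausdorff_carrier A.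
have : nbhs p (~` K).
  by apply: open_nbhs_nbhs; split => // Kp; move/negP: nO; apply; apply/mem_set/KO.
by apply: filterS => q /phi0.
Qed.

End OpenDomainIntegrals.

Lemma walczak_smooth (R : realType) (N : nat) (M : ptopologicalType) (A : manifold R N M)
    (I : finType) (mA mB : pred I) nu (G : I -> I -> I -> M -> R) :
  (forall i j k, smooth A (G i j k)) ->
  smooth A (fun p => walczak_quadratic mA mB nu (fun i j k => G i j k p)).
Proof.
move=> sG; rewrite /walczak_quadratic.
repeat first [exact: sG | apply: smooth_add | apply: smooth_opp | apply: smooth_sum => ?
  | apply: smooth_mul].
Qed.

Section Action.
Variables (R : realType) (N n : nat) (M : ptopologicalType) (A : manifold R N M).
Variables (g : metric R M) (F : 'I_N -> vfield R M) (K Om : set M).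
Hypotheses (frF : orthoframe A g F) (cK : compact K) (KO : K `<=` Om).
Hypotheses (oO : open Om) (cO : compact (closure Om)).
Variables (h : R -> metric R M) (E : R -> 'I_N -> vfield R M).
Hypothesis ad : adapted_family A g F K h E.
Variables (ja jb : 'I_n -> 'I_N) (nu : 'I_N).
Hypothesis cp : contact_pair g F ja jb nu 2.
Hypotheses (lA : adapted_leaf g F h E ja jb nu) (lB : adapted_leaf g F h E jb ja nu).
Hypothesis flat : eqO K 2 (fun t p => h t p (F nu p) (F nu p)) (fun=> fun=> 1).
Variables (D1 D2 : tdistribution R M).
Hypotheses (HD1 : D1 = spanned (fun a => F (ja a))) (HD2 : D2 = spanned (fun a => F (jb a))).
Let frE t : orthoframe A (h t) (E t). Proof. exact: (adapted_frame ad). Qed.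
Let hr t : riemannian_metric A (h t). Proof. by have [] := frE t. Qed.
Let Fv i : is_vfield A (F i). Proof. by case: frF. Qed.
Let Ev t i : is_vfield A (E t i). Proof. by case: (frE t). Qed.

(** The distribution does not move with t: [adapted_P] and [adapted_P0] give one inclusion between
    the span of F and that of E t, [adapted_L] and [adapted_L0] the other. *)
Lemma adapted_block (j j' : 'I_n -> 'I_N) kap D t : contact_leaf g F j j' nu kap ->
  adapted_leaf g F h E j j' nu -> D = spanned (fun a => F (j a)) ->
  D = block A (h t) (E t) (fun i => i \in codom j).
Proof.
move=> HA lj HD; apply/funext => p; apply/seteqP; split=> [v|v bv].
  rewrite HD => -[a ->]; split=> [|k nk].
    by apply: tangent_at_sum => i; apply: tangent_atZ; exact: vfield_tangent.
  rewrite (metric_suml (hr t)); [|by move=> i; exact: vfield_tangent|exact: vfield_tangent].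
  rewrite big1 // => i _; case: (leaf_case k HA) nk => [[b ->]|[b ->]|->].
  - by rewrite codom_f.
  - by rewrite (adapted_P lj) mulr0.
  - by rewrite (adapted_P0 lj) mulr0.
have ji : injective j by move=> a b /eqP; rewrite (leaf_inj HA) => /eqP.
rewrite HD; exists (fun b => \sum_a h t p v (E t (j a) p) * fcomp g F (E t (j a)) (j b) p).
rewrite {1}(block_expansion (frE t) bv) (sum_codom (fun i => h t p v (E t i p) *: E t i p) ji).
under [RHS]eq_bigr => b _ do rewrite scaler_suml.
rewrite exchange_big /=; apply: eq_bigr => a _.
rewrite {2}(fcompE frF p (Ev t (j a))) scaler_sumr.
have vsum (G : 'I_N -> tvec R M) : (forall b, G (j' b) = 0) -> G nu = 0 ->
    \sum_k G k = \sum_b G (j b).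
  move=> G1 G2; rewrite -(sum_codom G ji) [RHS]big_mkcond; apply: eq_bigr => k _.
  case: ifPn => // nk; case: (leaf_case k HA) nk => [[b ->]|[b ->]|->] //.
  by rewrite codom_f.
rewrite vsum => [|b|].
- by apply: eq_bigr => b _; rewrite scalerA.
- by rewrite (adapted_L lj) scale0r scaler0.
- by rewrite (adapted_L0 lj) scale0r scaler0.
Qed.

Let mA : pred 'I_N := fun i => i \in codom ja.
Let mB : pred 'I_N := fun i => i \in codom jb.
Let q t p := walczak_quadratic mA mB nu (fun i j k => christoffel (h t) (E t) i j k p).
Local Notation rho t := (rel_density (h t) F).
Local Notation Gm t := (christoffel (h t) (E t)).
Hypothesis ex : exists mu, is_volume_measure A g mu.
Let mu := volume A g.
Let Hmu : is_volume_measure A g mu. Proof. exact: volumeP. Qed.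
Let Hnu t : is_volume_measure A (h t) (volume A (h t)).
Proof. by apply: volumeP; exact: (volume_exists_density frF (frE t)). Qed.
Let mO : measurable (Om : set (borel M)). Proof. exact: open_borel. Qed.
Let OK' : Om `<=` closure Om. Proof. exact: subset_closure. Qed.

Let q_smooth t : smooth A (q t).
Proof. by apply: walczak_smooth => i j k; exact: (christoffel_smooth (frE t)). Qed.

Let rho_smooth t : smooth A (rho t).
Proof. exact: (rel_density_smooth frF (frE t)). Qed.

Lemma volume_density_integral t (f : M -> R) : smooth A f ->
  \int[volume A (h t)]_(p in (Om : set (borel M))) f p =
  \int[mu]_(p in (Om : set (borel M))) (f p * rho t p).
Proof.
move=> sf; rewrite /Rintegral (integral_volume_density frF (frE t) ex cO oO OK') //.
exact: measurable_funS (smooth_measurable sf).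
Qed.

(** Walczak's divergences integrate to 0 for the volume of h t. Their fields vanish off K, where the
    symbols of E t coincide with those of F and the leaves are totally geodesic. Only then is the
    integral moved to the fixed volume. *)
Lemma mutual_action_density t : mutual_action A Om D1 D2 (h t) =
  \int[mu]_(p in (Om : set (borel M))) (q t p * rho t p).
Proof.
have [HA HB] := cp.
pose dA p := \sum_(b | mA b) frame_div (h t) (E t) (fun x => \sum_(i | mB i) Gm t i i b x) b p.
pose dB p := \sum_(b | mB b) frame_div (h t) (E t) (fun x => \sum_(i | mA i) Gm t i i b x) b p.
have small i j k : (forall p, christoffel g F i j k p = 0) -> forall p, ~ K p -> Gm t i j k p = 0.
  by move=> c0 p nK; have [_ /(_ isT t p nK)] := christoffel_small frF cK ad c0.
have NA : null_integral A (volume A (h t)) Om dA.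
  apply: (null_integral_sum (frE t) (Hnu t) cO oO OK') => b /codomP[a ->].
  apply: (null_integral_div (frE t) (Hnu t) cK KO).
    by apply: smooth_sum => i; exact: (christoffel_smooth (frE t)).
  move=> p nK; rewrite big1 // => i /codomP[d ->].
  by apply: small => // p'; exact: (leaf_christoffel frF HB).
have NB : null_integral A (volume A (h t)) Om dB.
  apply: (null_integral_sum (frE t) (Hnu t) cO oO OK') => b /codomP[a ->].
  apply: (null_integral_div (frE t) (Hnu t) cK KO).
    by apply: smooth_sum => i; exact: (christoffel_smooth (frE t)).
  move=> p nK; rewrite big1 // => i /codomP[d ->].
  by apply: small => // p'; exact: (leaf_christoffel frF HA).
have [sAB IAB] := null_integralD (frE t) (Hnu t) cO oO OK' NA NB.
rewrite -(volume_density_integral t (q_smooth t)) /mutual_action.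
have -> : mutual_curvature A (h t) D1 D2 = (fun p => (dA p + dB p) + q t p) :> (M -> R).
  apply/funext => p; rewrite (adapted_block t HA lA HD1) (adapted_block t HB lB HD2).
  exact: (mutual_curvature_walczak (frE t) p (leaf_blocks cp)).
rewrite RintegralD //.
- by rewrite IAB add0r.
- exact: (smooth_integrable (frE t) (Hnu t) cO oO OK').
- exact: (smooth_integrable (frE t) (Hnu t) cO oO OK').
Qed.

(** The pointwise error is O(t^2) on K and exactly 0 off K, so integration costs only the finite
    volume of Om. *)
Lemma mutual_action_estimate : exists C d, 0 < d /\ forall t, `|t| < d ->
  volume A (h t) (Om : set (borel M)) = mu Om ->
  `|mutual_action A Om D1 D2 (h t) + (3 * n)%:R * fine (mu Om)| <= C * t ^+ 2.
Proof.
have [HA HB] := cp.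
have [[C [d [d0 HC]]] zero] := curvature_density frF cK ad cp lA lB flat.
exists (`|C| * fine (mu Om)), d; split=> // t td vol.
pose w j x := fcomp g F (E t nu) j x.
pose Y p := - \sum_a frame_div g F (w (jb a)) (ja a) p + \sum_a frame_div g F (w (ja a)) (jb a) p.
pose T p := - (3 * n)%:R + (6 - (3 * n)%:R) * (rho t p - 1) + Y p.
have w0 j : nu != j -> forall p, ~ K p -> w j p = 0.
  move=> /negbTE nj p nK; have := adapted_adm ad nu j; rewrite nj => /adm0_bigO[_].
  by move/(_ isT t p nK).
have sw j : smooth A (w j) by exact: (fcomp_smooth frF).
have NY : null_integral A mu Om Y.
  apply: (null_integralD frF Hmu cO oO OK').
    apply: (null_integralN frF Hmu cO oO OK').
    apply: (null_integral_sum frF Hmu cO oO OK') => a _.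
    apply: (null_integral_div frF Hmu cK KO) => //.
    by apply: w0; rewrite eq_sym (leaf_neq0 HB).
  apply: (null_integral_sum frF Hmu cO oO OK') => a _.
  apply: (null_integral_div frF Hmu cK KO) => //.
  by apply: w0; rewrite eq_sym (leaf_neq0 HA).
have Irho : \int[mu]_(p in (Om : set (borel M))) rho t p = fine (mu Om).
  have := @volume_density_integral t (fun=> 1) (smooth_cst _).
  rewrite Rintegral_cst // mul1r vol => ->.
  by apply: eq_Rintegral => p _; rewrite mul1r.
have int f : smooth A f -> mu.-integrable (Om : set (borel M)) (EFin \o f).
  exact: (smooth_integrable frF Hmu cO oO OK').
have [sY IY] := NY.
have sr1 : smooth A (fun p => (6 - (3 * n)%:R) * (rho t p - 1)).
  by apply: smooth_mul; [exact: smooth_cst|apply: smooth_sub => //; exact: smooth_cst].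
have sT : smooth A T.
  by apply: smooth_add => //; apply: smooth_add => //; exact: smooth_cst.
have IT : \int[mu]_(p in (Om : set (borel M))) T p = - (3 * n)%:R * fine (mu Om).
  rewrite /T RintegralD //; [|apply: int; apply: smooth_add => //; exact: smooth_cst|exact: int].
  rewrite IY addr0 RintegralD //; [|apply: int; exact: smooth_cst|exact: int].
  rewrite Rintegral_cst // RintegralZl //; last first.
    by apply: int; apply: smooth_sub => //; exact: smooth_cst.
  rewrite RintegralB //; [|exact: int|apply: int; exact: smooth_cst].
  by rewrite Irho Rintegral_cst // mul1r subrr mulr0 addr0.
have sq : smooth A (fun p => q t p * rho t p) by exact: smooth_mul.
have sD : smooth A (fun p => q t p * rho t p - T p) by exact: smooth_sub.
have -> : mutual_action A Om D1 D2 (h t) + (3 * n)%:R * fine (mu Om) =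
    \int[mu]_(p in (Om : set (borel M))) (q t p * rho t p - T p).
  rewrite mutual_action_density RintegralB //; [|exact: int|exact: int].
  by rewrite IT mulNr opprK.
apply: (le_trans (le_normr_Rintegral mO (int _ sD))).
rewrite mulrAC -(Rintegral_cst mu mO).
apply: le_Rintegral => //.
- have := int _ sD; move=> /integrable_norm; exact.
- by apply: int; exact: smooth_cst.
move=> p Op; have [Kp|nK] := pselect (K p); last first.
  have -> : q t p * rho t p - T p = 0 by exact: zero isT t p nK.
  by rewrite normr0 mulr_ge0 // sqr_ge0.
apply: (le_trans (HC t p td Kp)).
by rewrite -[t ^+ 2]real_normK ?num_real // ler_wpM2r ?exprn_ge0 // ler_norm.
Qed.

End Action.

Theorem proposition14 (R : realType) (n : nat) (M : ptopologicalType)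
    (A : manifold R (n + n).+1 M)
    (f : M -> tvec R M -> tvec R M) (xi : vfield R M)
    (eta : M -> tvec R M -> R) (g : metric R M)
    (e : 'I_(n + n) -> vfield R M)
    (D1 D2 D3 : tdistribution R M)
    (HK : K_contact A f xi eta g)
    (He : f_basis A f g e)
    (HD1 : D1 = spanned (fun i : 'I_n => e (lshift n i)))
    (HD2 : D2 = spanned (fun i : 'I_n => e (rshift n i)))
    (HD3 : D3 = spanned (fun _ : 'I_1 => xi))
    (Hint1 : integrable_distribution A D1)
    (Hint2 : integrable_distribution A D2)
    (Hgeo1 : totally_geodesic A g D1)
    (Hgeo2 : totally_geodesic A g D2)
    (H13 : forall X Y, is_vfield A X -> is_vfield A Y ->
       Tmix A g D2 D1 D3 X Y = 0)
    (H23 : forall X Y, is_vfield A X -> is_vfield A Y ->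
       Tmix A g D1 D2 D3 X Y = 0) :
  critical_point A D1 D2
    (fun Omega eps gt =>
       [/\ volume_preserving A Omega eps g gt,
           forall t, `|t| < eps -> orthogonal_distributions (gt t) D1 D2
         & forall p, is_derive (0 : R) (1 : R)
             (fun t => gt t p (xi p) (xi p)) 0])
    g.
Proof.
move=> Omega eps gt aO var [vol orth flat].
have [oO cO _] := aO; have [eps0 _ _ _ KO] := var.
pose h := extended_family g eps gt; pose F := kc_frame xi e.
have hE t : `|t| < eps -> gt t = h t by rewrite /h /extended_family => ->.
have frF : orthoframe A g F := kc_orthoframe HK He.
have cp : contact_pair g F (@kc_a n) (@kc_b n) ord0 2.
  exact: (kc_contact_pair HK He HD1 HD2 HD3 Hint1 Hint2 Hgeo1 Hgeo2 H13 H23).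
have D1E : D1 = spanned (fun a => F (kc_a a)).
  by rewrite HD1; congr spanned; apply/funext => a; rewrite /F kc_frameS.
have D2E : D2 = spanned (fun a => F (kc_b a)).
  by rewrite HD2; congr spanned; apply/funext => a; rewrite /F kc_frameS.
have cK := variation_support_compact aO var.
have in_span (j : 'I_n -> 'I_(n + n).+1) a p : spanned (fun b => F (j b)) p (F (j a) p).
  exists (fun b => (b == a)%:R); rewrite (bigD1 a) //= eqxx scale1r big1 ?addr0 // => b /negbTE ->.
  by rewrite scale0r.
have hab t p a b : h t p (F (kc_a a) p) (F (kc_b b) p) = 0.
  (* Beyond eps the extended family is g itself, for which the f-basis is orthonormal. *)
  have [te|te] := boolP (`|t| < eps).
    by rewrite -(hE t te) (orth t te) // ?D1E ?D2E; exact: in_span.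
  have [_ _ Fo _] := frF; have [HA _] := cp.
  by rewrite /h /extended_family (negbTE te) Fo (leaf_neq HA).
have [E [ad lA lB]] := adapted_family_exists frF (extended_metric frF var)
  (extended_component_adm frF aO var) cp hab.
have frE t : orthoframe A (h t) (E t) := adapted_frame ad t.
(* Without a volume measure for g there is none for any g_t, by the density comparison; then
   [volume] is the zero measure throughout and the action is constantly 0. *)
have [ex|nex] := pselect (exists mu, is_volume_measure A g mu); last first.
  have z t : `|t| < eps -> mutual_action A Omega D1 D2 (gt t) = 0.
    move=> te; rewrite (hE t te) /mutual_action volume0.
      by rewrite /Rintegral integral_measure_zero.
    by move=> /(volume_exists_density (frE t) frF).
  apply: (@is_derive_quadratic _ _ 0); apply: filterS (nbhs0_lt eps0) => t te.
  by rewrite (z 0) ?normr0 // (z t te) subrr normr0 mul0r.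
have flatF p : is_derive (0 : R) (1 : R) (fun t => gt t p (F ord0 p) (F ord0 p)) 0.
  by rewrite /F kc_frame0; exact: flat.
have flatK := extended_component_flat frF aO var flatF.
have [C [d [d0 H]]] := mutual_action_estimate frF cK KO oO cO ad cp lA lB flatK D1E D2E ex.
have {}H t : `|t| < Num.min d eps ->
    `|mutual_action A Omega D1 D2 (gt t) + (3 * n)%:R * fine (volume A g Omega)| <= C * t ^+ 2.
  rewrite lt_min => /andP[td te]; have := vol t te; rewrite (hE t te).
  exact: H.
have de0 : 0 < Num.min d eps by rewrite lt_min d0.
(* The estimate at t = 0 has error 0 and so gives the exact value of the action at g. *)
have F0 : mutual_action A Omega D1 D2 (gt 0) = - ((3 * n)%:R * fine (volume A g Omega)).
  have := H 0; rewrite normr0 expr0n /= mulr0 => /(_ de0).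
  by rewrite normr_le0 addr_eq0 => /eqP.
apply: (@is_derive_quadratic _ _ C); apply: filterS (nbhs0_lt de0) => t td.
by rewrite F0 opprK; exact: H.
Qed.
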